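(* There is an open and dense subset $\mathcal{U}$ of $\mathcal{E}^{2}(\mathbb{T})$ (with the $C^2$ topology) such that every $T\in\mathcal{U}$ has a unique Lyapunov minimizing measure, and this measure is supported on a periodic orbit of $T$ (i.e. it equals $\delta_\Gamma=\frac{1}{\#\Gamma}\sum_{x\in\Gamma}\delta_x$ for some periodic orbit $\Gamma$ of $T$).
   Context: $\mathbb{T}=\mathbb{R}/\mathbb{Z}$ is the circle with its standard metric $d$. A $C^1$ map $T:\mathbb{T}\to\mathbb{T}$ is expanding if there are $C>0$ and $\lambda>1$ with $|DT^n(x)|\ge C\lambda^n$ for all $x\in\mathbb{T}$, $n\ge1$. For $k\ge1$, $\mathcal{E}^k(\mathbb{T})$ denotes the space of $C^k$ expanding self-maps of $\mathbb{T}$ with the $C^k$ distance $d_{C^k}(S,T)=\sum_{i=0}^k d_{C^0}(D^iS,D^iT)$. For a $T$-invariant Borel probability measure $\mu$, its Lyapunov exponent is $\lambda_T(\mu)=\int\log|DT|\,d\mu$. Let $\alpha(T)=\inf\{\lambda_T(\nu):\nu$ a $T$-invariant Borel probability measure$\}$. An invariant measure $\mu$ is a Lyapunov minimizing measure if $\lambda_T(\mu)=\alpha(T)$. *)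

(* Defs.v *)
From HB Require Import structures.
From mathcomp Require Import all_boot all_order all_algebra.
From mathcomp Require Import all_classical all_reals all_analysis.
Set Implicit Arguments. Unset Strict Implicit. Unset Printing Implicit Defensive.
Import Order.TTheory GRing.Theory Num.Theory.
Import numFieldNormedType.Exports.
Local Open Scope classical_set_scope.
Local Open Scope ring_scope.

(* The circle T = R/Z is identified with the fundamental domain [0,1);
   a self-map of the circle is given by a lift f : R -> R with
   f (x + 1) = f x + deg for an integer deg. *)

Section Circle.
Variable R : realType.

Definition frac (x : R) : R := x - (Num.floor x)%:~R.

Definition circ_dist (x y : R) : R :=
  Num.min (frac (x - y)) (1 - frac (x - y)).

Definition circ_map (f : R -> R) (x : R) : R := frac (f x).

Definition is_C2_circle_lift (f : R -> R) : Prop :=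
  (exists deg : int, forall x, f (x + 1) = f x + deg%:~R) /\
  (forall x, derivable f x 1) /\
  (forall x, derivable (f^`())%classic x 1) /\
  continuous (f^`(2))%classic.

Definition expanding (f : R -> R) : Prop :=
  exists C lam : R, 0 < C /\ 1 < lam /\
    forall (n : nat) (x : R), (1 <= n)%N ->
      C * lam ^+ n <= `| ((iter n f)^`())%classic x |.

Definition E2 (f : R -> R) : Prop := is_C2_circle_lift f /\ expanding f.

Definition dC2 (f g : R -> R) : R :=
  sup (range (fun x => circ_dist (f x) (g x))) +
  sup (range (fun x => `| (f^`())%classic x - (g^`())%classic x |)) +
  sup (range (fun x => `| (f^`(2))%classic x - (g^`(2))%classic x |)).

Definition open_in_E2 (U : set (R -> R)) : Prop :=
  U `<=` E2 /\
  forall f, U f -> exists2 e : R, 0 < e &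
    forall g, E2 g -> dC2 g f < e -> U g.

Definition dense_in_E2 (U : set (R -> R)) : Prop :=
  forall f, E2 f -> forall e : R, 0 < e -> exists2 g, U g & dC2 g f < e.

(* T-invariant Borel probability measures on T (measures on R carried
   by [0,1)) *)
Definition invariant (f : R -> R) (P : probability R R) : Prop :=
  P `[0%R, 1%R[%classic = 1%E /\
  forall A : set R, measurable A -> P (circ_map f @^-1` A) = P A.

Definition lyap (f : R -> R) (P : probability R R) : \bar R :=
  (\int[P]_(x in `[0%R, 1%R[%classic) (ln `| (f^`())%classic x |)%:E)%E.

Definition alpha (f : R -> R) : \bar R :=
  ereal_inf [set lyap f P | P in [set P | invariant f P]].

Definition lyap_minimizing (f : R -> R) (P : probability R R) : Prop :=
  invariant f P /\ lyap f P = alpha f.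

Definition is_periodic_orbit_measure (f : R -> R) (P : probability R R) : Prop :=
  exists (x0 : R) (n : nat), [/\ (0 < n)%N, 0 <= x0 < 1,
    iter n (circ_map f) x0 = x0 &
    forall A : set R, measurable A ->
      P A = ((n%:R)^-1 * \sum_(i < n) \1_A (iter i (circ_map f) x0))%:E].

End Circle.

(* Main.v *)
(* Lift the map to f on R and put phi = ln |f'|.  A Mane subaction u turns phi,
   up to its minimal average over periodic orbits and a coboundary, into a
   nonnegative Lipschitz function psi.  Counting words along a periodic orbit
   with small psi-average and using the entropy bound for words (in the spirit
   of Bressaud-Quas), one closes a short cycle of words into periodic orbits of
   length n with n^a * S_n psi as small as desired, for every a.  Cutting such
   an orbit at close pairs of points halves its length while S_n psi grows by a
   constant factor only, so it ends with a periodic orbit whose S_n psi is tiny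
   compared with the smallest distance gamma between two of its points.

   Composing f with a C^2-small H = id + W that fixes this orbit and lowers
   the derivative only at scale theta * gamma around it makes the orbit the
   unique minimizer.  This is witnessed by an explicit potential: it bounds the
   Birkhoff sums of ln |g'| from below by those of the orbit plus delta for each
   visit to a closed set that only the orbit avoids forever.  The construction
   of the potential is stable under C^2-small perturbations of g.  Integrating
   the bound against an invariant measure shows that a minimizing measure gives
   no mass to the closed set, hence is carried by the orbit. *)

Require Import Defs.
From HB Require Import structures.
From mathcomp Require Import all_boot all_order all_algebra.
From mathcomp Require Import all_classical all_reals all_analysis.
From mathcomp Require Import measurable_realfun.
From mathcomp Require Import ring lra zify.
Import Order.TTheory GRing.Theory Num.Theory.
Import numFieldNormedType.Exports.
Import Defs.
Local Open Scope ring_scope.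

Set Implicit Arguments.
Unset Strict Implicit.
Unset Printing Implicit Defensive.

(** Pigeonhole alone would close cycles through exponentially many [m]-words, against a cost of only
    [mu ^- m] per jump. Mutual information between adjacent blocks replaces the count: normalised
    entropies cannot drop at each of a fixed number of doublings of [m], so at some scale adjacent
    words are nearly independent, and the cycle length then grows with [m] at as small an
    exponential rate as desired.

    A bump of slope [- c] and radius [rho] has second derivative of order [c / rho], so
    C^2-smallness forces [c = ep1 * rho]. The gain is thus linear in the gap of the orbit, and
    [S_n psi] has to be small against that gap. The subaction of [f] is kept for all perturbed maps;
    being only Lipschitz, it costs a term linear in the distance to the orbit, while the gain is
    quadratic there.

    The ratios between the scales are fixed before the orbit is chosen, the radius [e] of the stable
    neighbourhood after it. *)

(** * Short cycles in coloured graphs *)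

Section ShortCycle.
Variables (R : realFieldType) (V W : finType) (c : W -> V) (t : W -> W).
Variables (good : pred W) (M : R) (g : nat).

Definition colour_count (v : V) : R := \sum_w (c w == v)%:R.
Definition pair_count (v x : V) : R := \sum_w ((c w == v) && (c (t w) == x))%:R.
(** The pointwise mutual information of the colours of [w] and [t w] exceeds [ln M], written without
    division. *)
Definition dense_at (w : W) : bool :=
  M * colour_count (c w) * colour_count (c (t w)) <
  pair_count (c w) (c (t w)) * #|W|%:R.
Definition good_edge : rel V :=
  fun v x => [exists w, [&& good w, c w == v & c (t w) == x]].

(** Walks have length at least 1, so that [v \in reach k v] already yields a cycle. *)
Fixpoint reach (k : nat) (v : V) : {set V} :=
  if k is k'.+1 then
    [set x | good_edge v x || [exists w, good_edge v w && (x \in reach k' w)]]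
  else finset.set0.

Lemma reachP k v x : x \in reach k v ->
  exists s, [/\ path good_edge v s, last v s = x & (0 < size s <= k)%N].
Proof.
elim: k v => [|k IH] v; first by rewrite inE.
rewrite inE => /orP[ex|/existsP[w /andP[ew /IH[s [ps ls /andP[s0 sk]]]]]].
  by exists [:: x]; rewrite /= ex.
by exists (w :: s); rewrite /= ew ps ls.
Qed.

Hypothesis M1 : 1 <= M.
Hypothesis W0 : (0 < #|W|)%N.
Hypothesis tinj : injective t.
Hypothesis Hdense : \sum_w (dense_at w)%:R <= #|W|%:R / 8 :> R.
Hypothesis Hbad : \sum_w (~~ good w)%:R <= #|W|%:R / (16 * M) :> R.
Hypothesis Hg : 8 * M < g%:R.

Let mass (A : {set V}) : R := \sum_(x in A) colour_count x.
Let N : R := #|W|%:R.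

Let N_gt0 : 0 < N. Proof. by rewrite ltr0n. Qed.

Let cc_ge0 v : 0 <= colour_count v.
Proof. by apply: sumr_ge0 => w _; rewrite ler0n. Qed.

Let cc_gt0 w : 0 < colour_count (c w).
Proof.
rewrite /colour_count (bigD1 w) //= eqxx ltr_wpDr ?ltr01 //.
by apply: sumr_ge0 => *; rewrite ler0n.
Qed.

Let sum_pick (a : V) (F : V -> R) : \sum_x (a == x)%:R * F x = F a.
Proof.
rewrite (bigD1 a) //= eqxx mul1r big1 ?addr0 // => x xa.
by rewrite eq_sym (negbTE xa) mul0r.
Qed.

Let massE (A : {set V}) : mass A = \sum_w (c w \in A)%:R.
Proof.
rewrite /mass /colour_count exchange_big /=; apply: eq_bigr => w _.
rewrite big_mkcond -[RHS](sum_pick _ (fun x => (x \in A)%:R)).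
by apply: eq_bigr => x _; case: (x \in A); rewrite ?mulr1 ?mulr0.
Qed.

Let mass_ge0 A : 0 <= mass A.
Proof. by apply: sumr_ge0. Qed.

Let massS (A B : {set V}) : A \subset B -> mass A <= mass B.
Proof.
move=> AB; rewrite !massE; apply: ler_sum => w _; rewrite ler_nat.
by case: (boolP (c w \in A)) => // /(fintype.subsetP AB) ->.
Qed.

Let massU (A B : {set V}) : mass (A :\: B) + mass B = mass (A :|: B).
Proof.
rewrite !massE -big_split /=; apply: eq_bigr => w _.
by rewrite !inE; do 2 case: (_ \in _); rewrite /= ?addr0 ?add0r.
Qed.

Let massN A : mass A <= N.
Proof.
rewrite massE /N -sum1_card natr_sum; apply: ler_sum => w _.
by rewrite ler_nat leq_b1.
Qed.

(** Markov kernel that resamples [w] uniformly inside its colour class. It is symmetric with row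
    sums 1, hence preserves sums over [W]. *)
Let ker (w w' : W) : R := (c w == c w')%:R / colour_count (c w).

Let kerC w w' : ker w w' = ker w' w.
Proof. by rewrite /ker eq_sym; case: eqP => [->|]; rewrite ?mul0r. Qed.

Let ker_ge0 w w' : 0 <= ker w w'.
Proof. by rewrite mulr_ge0 ?invr_ge0 ?ler0n. Qed.

Let ker1 w : \sum_w' ker w w' = 1.
Proof.
rewrite /ker -mulr_suml (_ : \sum_w' _ = colour_count (c w)).
  by rewrite divff // gt_eqF.
by apply: eq_bigr => w' _; rewrite eq_sym.
Qed.

Let sum_kerl (F : W -> R) : \sum_w \sum_w' ker w w' * F w = \sum_w F w.
Proof. by apply: eq_bigr => w _; rewrite -mulr_suml ker1 mul1r. Qed.

Let sum_kerr (F : W -> R) : \sum_w \sum_w' ker w w' * F w' = \sum_w F w.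
Proof.
rewrite exchange_big -[RHS]sum_kerl; apply: eq_bigr => w _ /=.
by under eq_bigr do rewrite kerC.
Qed.

(** Of the ordered pairs [(w, w')] and [(w', w)] at least one counts, which gives [N / 2] by
    symmetry of [ker]. Bad [w], bad [w'] and dense [w'] remove at most [N / 16], [N / 16] and
    [N / 8]. *)
Let step_low (B : V -> {set V}) :
  (forall w w', c (t w') \in B (c (t w)) -> c (t w) \in B (c (t w')) -> False) ->
  N / 4 <= \sum_w \sum_w' ker w w' *
    [&& good w, good w', ~~ dense_at w' & c (t w') \notin B (c (t w))]%:R.
Proof.
move=> nocyc.
set X := fun w w' => (c (t w') \notin B (c (t w)))%:R : R.
have X2 : N / 2 <= \sum_w \sum_w' ker w w' * X w w'.
  suff : N <= \sum_w \sum_w' ker w w' * X w w' + \sum_w \sum_w' ker w w' * X w w'.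
    by move=> ?; lra.
  rewrite [X in _ + X]exchange_big /= -big_split /=.
  rewrite /N -sum1_card natr_sum; apply: ler_sum => w _.
  rewrite -(ker1 w) -big_split /=; apply: ler_sum => w' _.
  rewrite [ker w' w]kerC -mulrDr ler_peMr // /X.
  have := nocyc w w'; case: (_ \in _); case: (_ \in _) => /= h.
  - by case: h.
  - by rewrite add0r.
  - by rewrite addr0.
  - by lra.
have : \sum_w \sum_w' (ker w w' * X w w' - ker w w' * (~~ good w)%:R
     - ker w w' * (~~ good w')%:R - ker w w' * (dense_at w')%:R) <=
   \sum_w \sum_w' ker w w' *
    [&& good w, good w', ~~ dense_at w' & c (t w') \notin B (c (t w))]%:R.
  apply: ler_sum => w _; apply: ler_sum => w' _.
  rewrite -!mulrBr ler_wpM2l // /X.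
  by case: (good w); case: (good w'); case: (dense_at w'); case: (c (t w') \notin B (c (t w))); rewrite /=; lra.
under eq_bigr do rewrite !big_split /= !sumrN.
rewrite !big_split /= !sumrN sum_kerl !sum_kerr.
have : #|W|%:R / (16 * M) <= N / 16.
  have M0 : 0 < 16 * M by have := M1; lra.
  rewrite -/N ler_pM2l // lef_pV2 ?posrE //; have := M1; lra.
have := Hdense; have := Hbad; rewrite -/N.
move: X2; lra.
Qed.

(** When the transition to [x] is not dense, the colour [x] has count at least [N / M] times its
    conditional frequency after [c w]. So a set of likely successors also has large mass. *)
Let pairs_le (w : W) (B : {set V}) : good w ->
  N / M * \sum_w' ker w w' *
    [&& good w, good w', ~~ dense_at w' & c (t w') \notin B]%:R <=
  mass ([set x | good_edge (c w) x] :\: B).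
Proof.
move=> gw; rewrite gw /=.
have -> : \sum_w' ker w w' * [&& good w', ~~ dense_at w' & c (t w') \notin B]%:R =
  \sum_x (colour_count (c w))^-1 * \sum_w' ((c w' == c w) && (c (t w') == x) &&
       [&& good w', ~~ dense_at w' & x \notin B])%:R.
  rewrite -mulr_sumr exchange_big /= mulr_sumr; apply: eq_bigr => w' _.
  rewrite /ker eq_sym; case: (c w' == c w) => /=; last first.
    by rewrite !mul0r big1 ?mulr0 // => x _.
  rewrite mul1r; congr (_ * _).
  rewrite -[LHS](sum_pick _ (fun x => [&& good w', ~~ dense_at w' & x \notin B]%:R)).
  by apply: eq_bigr => x _; rewrite -natrM mulnb.
rewrite [leRHS]big_mkcond mulr_sumr; apply: ler_sum => x _.
have M0 : 0 < M by have := M1; lra.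
set S := \sum_w' _.
have [/existsP[w' /and5P[/eqP cw /eqP ct gw' nd xB]]|nex] :=
  boolP [exists w', [&& c w' == c w, c (t w') == x, good w', ~~ dense_at w' & x \notin B]].
  have -> : x \in [set x | good_edge (c w) x] :\: B.
    by rewrite !inE xB /=; apply/existsP; exists w'; rewrite gw' cw ct !eqxx.
  have S1 : S <= pair_count (c w) x.
    apply: ler_sum => w2 _; rewrite ler_nat.
    by case: ((c w2 == c w) && (c (t w2) == x)) => //=; rewrite leq_b1.
  move: nd; rewrite /dense_at -leNgt cw ct -/N => nd.
  have cw0 := cc_gt0 w.
  have -> : N / M * ((colour_count (c w))^-1 * S) = (S * N) / (M * colour_count (c w)).
    by field; rewrite !gt_eqF.
  rewrite ler_pdivrMr ?mulr_gt0 // mulrC (le_trans _ (le_trans nd _)) //.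
    by rewrite mulrC ler_pM2r.
  by rewrite mulrC.
have -> : S = 0.
  rewrite /S big1 // => w' _.
  apply/eqP; rewrite pnatr_eq0 eqb0; apply/negP => h; case/negP: nex.
  by apply/existsP; exists w'; case/and3P: h => /andP[-> ->] -> /andP[-> ->].
by rewrite !mulr0; case: ifP.
Qed.

(** As [t] is a bijection, the sum on the left may be taken along [t w]. A good edge from [c w] to
    [c (t w)] inherits all that [c (t w)] reaches, and the other successors of [c w] add
    [N ^+ 2 / (4 * M)] in total; bad [w] lose at most [N ^+ 2 / (16 * M)]. *)
Let increment k :
  (forall w w', c (t w') \in reach k (c (t w)) -> c (t w) \in reach k (c (t w')) -> False) ->
  \sum_w mass (reach k (c w)) + N ^+ 2 / (8 * M) <= \sum_w mass (reach k.+1 (c w)).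
Proof.
move=> nocyc.
have M0 : 0 < M by have := M1; lra.
have low := step_low nocyc.
have -> : \sum_w mass (reach k (c w)) = \sum_w mass (reach k (c (t w))).
  by rewrite (reindex_inj tinj).
have H : \sum_w (mass (reach k (c (t w))) - (~~ good w)%:R * N + N / M * \sum_w' ker w w' *
    [&& good w, good w', ~~ dense_at w' & c (t w') \notin reach k (c (t w))]%:R) <=
   \sum_w mass (reach k.+1 (c w)).
  apply: ler_sum => w _; have [gw|bw] := boolP (good w); last first.
    rewrite /= mul1r (eq_bigr (fun=> 0)); last by move=> *; rewrite mulr0.
    rewrite big1 // mulr0 addr0 (le_trans _ (mass_ge0 _)) // subr_le0.
    exact: massN.
  rewrite mul0r subr0.
  have -> : reach k.+1 (c w) = [set x | good_edge (c w) x] :|: reach k.+1 (c w).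
    by apply/finset.setP => x; rewrite !inE; case: good_edge.
  have sub : [set x | good_edge (c w) x] :|: reach k (c (t w)) \subset
     [set x | good_edge (c w) x] :|: reach k.+1 (c w).
    apply: finset.setUS; apply/fintype.subsetP => x xr; rewrite inE; apply/orP; right.
    apply/existsP; exists (c (t w)); rewrite xr andbT.
    by apply/existsP; exists w; rewrite gw !eqxx.
  apply: le_trans (massS sub); rewrite -massU addrC lerD2r.
  by have := pairs_le (reach k (c (t w))) gw; rewrite gw.
apply: le_trans H.
rewrite !big_split /= sumrN -mulr_suml -mulr_sumr -addrA lerD2l.
have H2 : N / M * (N / 4) <= N / M * \sum_w \sum_w' ker w w' *
    [&& good w, good w', ~~ dense_at w' & c (t w') \notin reach k (c (t w))]%:R.
  by rewrite ler_pM2l // divr_gt0.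
apply: (@le_trans _ _ (- (N / (16 * M) * N) + N / M * (N / 4))); last first.
  apply: lerD H2; rewrite lerN2 ler_pM2r //; exact: Hbad.
have -> : - (N / (16 * M) * N) + N / M * (N / 4) = 3 * (N ^+ 2 / (16 * M)).
  by field; rewrite gt_eqF.
have -> : N ^+ 2 / (8 * M) = 2 * (N ^+ 2 / (16 * M)).
  by field; rewrite gt_eqF.
by rewrite ler_pM2r ?divr_gt0 ?exprn_gt0 ?mulr_gt0 //; lra.
Qed.

(** Without a short cycle the total reachable mass would grow by [N ^+ 2 / (8 * M)] at each of [g]
    steps, but it is at most [N ^+ 2]. Two walks of length at most [g] between the same two
    vertices, one each way, make the factor 2. *)
Lemma short_cycle : exists s : seq V,
  cycle good_edge s && (0 < size s <= g.*2)%N.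
Proof.
have [//|nc] := pselect (exists s : seq V, cycle good_edge s && (0 < size s <= g.*2)%N).
have nocyc k w w' : (k < g)%N -> c (t w') \in reach k (c (t w)) ->
    c (t w) \in reach k (c (t w')) -> False.
  move=> kg /reachP[s [ps ls /andP[s0 sk]]] /reachP[s' [ps' ls' /andP[s0' sk']]].
  apply: nc; exists (s ++ s').
  rewrite size_cat -addnn ltn_addr //= (leq_add (leq_trans sk _) (leq_trans sk' _)) ?(ltnW kg) // andbT.
  case: s' s0' ps' ls' sk' => //= a s' _ /andP[ea ps'] ls' _.
  case/lastP: s s0 ps ls sk => // s b _; rewrite rcons_path last_rcons => /andP[ps eb] bE _.
  have pc : path good_edge (c (t w)) (rcons s b ++ a :: s').
    by rewrite cat_path last_rcons rcons_path ps eb bE /= ea.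
  case: s ps eb pc => [|x s] /=.
    by move=> _ eb /and3P[_ -> pa]; rewrite rcons_path pa /= ls'.
  move=> _ _ /andP[ex pc]; rewrite rcons_path pc /=.
  by rewrite last_cat /= ls'.
have main k : (k <= g)%N -> k%:R * (N ^+ 2 / (8 * M)) <= \sum_w mass (reach k (c w)).
  elim: k => [|k IH] kg; first by rewrite mul0r sumr_ge0.
  apply: le_trans (increment (fun w w' => @nocyc k w w' kg)).
  by rewrite -natr1 mulrDl mul1r lerD2r IH // ltnW.
have up : \sum_w mass (reach g (c w)) <= N * N.
  rewrite mulr_natl /N -sumr_const; apply: ler_sum => w _; exact: massN.
have := le_trans (main g (leqnn g)) up.
have M0 : 0 < M by have := M1; lra.
rewrite mulrA ler_pdivrMr ?mulr_gt0 // -expr2 mulrC ler_pM2l ?exprn_gt0 // => /(lt_le_trans Hg).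
by rewrite ltxx.
Qed.
End ShortCycle.

(** * Entropy of words *)

Lemma ln_sub1 (R : realType) (x : R) : 0 < x -> ln x <= x - 1.
Proof. by move=> x0; have := expR_ge1Dx (ln x); rewrite lnK ?posrE //; lra. Qed.

Section Information.
Variables (R : realType) (V W : finType) (c : W -> V) (t : W -> W).
Hypothesis W0 : (0 < #|W|)%N.
Hypothesis tinj : injective t.
Let N : R := #|W|%:R.
Let cc (v : V) : R := colour_count R c v.
Let pc (v x : V) : R := pair_count R c t v x.

(** Exponential of the pointwise mutual information of [c] and [c \o t] under the uniform law on
    [W]. *)
Definition density (w : W) : R := pc (c w) (c (t w)) * N / (cc (c w) * cc (c (t w))).

Lemma colour_count_gt0 w : 0 < cc (c w).
Proof.
rewrite /cc /colour_count (bigD1 w) //= eqxx ltr_wpDr ?ltr01 //.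
by apply: sumr_ge0 => *; rewrite ler0n.
Qed.

Lemma colour_count_ge0 v : 0 <= cc v.
Proof. by apply: sumr_ge0. Qed.

Lemma pair_count_gt0 w : 0 < pc (c w) (c (t w)).
Proof.
rewrite /pc /pair_count (bigD1 w) //= !eqxx ltr_wpDr ?ltr01 //.
by apply: sumr_ge0 => *; rewrite ler0n.
Qed.

Let N_gt0 : 0 < N. Proof. by rewrite ltr0n. Qed.

Lemma density_gt0 w : 0 < density w.
Proof. by rewrite divr_gt0 // mulr_gt0 ?colour_count_gt0 ?pair_count_gt0. Qed.

Lemma sum_colour_count : \sum_v cc v = N.
Proof.
rewrite exchange_big /= /N -sum1_card natr_sum; apply: eq_bigr => w _.
by rewrite (bigD1 (c w)) //= eqxx big1 ?addr0 // => x /negbTE; rewrite eq_sym => ->.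
Qed.

(** The mean of the inverse density is the probability, under the product of the marginals, of the
    pairs that really occur. *)
Lemma sum_density_inv : \sum_w (density w)^-1 <= N.
Proof.
have -> : \sum_w (density w)^-1 =
    \sum_v \sum_x \sum_w ((c w == v) && (c (t w) == x))%:R * (cc v * cc x / (pc v x * N)).
  rewrite pair_bigA exchange_big /=; apply: eq_bigr => w _.
  rewrite (bigD1 (c w, c (t w))) //= !eqxx mul1r invf_div big1 ?addr0 //.
  move=> [v x] /=; rewrite xpair_eqE ![_ == c _]eq_sym => /negbTE ->.
  by rewrite mul0r.
have NE : N = \sum_v \sum_x cc v * cc x / N.
  under eq_bigr do rewrite -mulr_suml -mulr_sumr sum_colour_count mulfK ?gt_eqF //.
  by rewrite sum_colour_count.
rewrite [leRHS]NE; apply: ler_sum => v _; apply: ler_sum => x _.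
rewrite -mulr_suml -/(pair_count R c t v x) -/(pc v x).
have [->|p0] := eqVneq (pc v x) 0.
  by rewrite mul0r divr_ge0 ?mulr_ge0 ?colour_count_ge0.
move: (pc v x) (cc v) (cc x) N N_gt0 p0 => p a b n n0 p0.
by rewrite le_eqVlt; apply/orP; left; apply/eqP; field; rewrite p0 gt_eqF.
Qed.

(* Markov's inequality for the positive part of the information density; the
   negative part has mean at most 1 because [- ln x <= 1 / x]. *)
Lemma information_dense (E : R) : 0 <= E -> \sum_w ln (density w) <= E * N ->
  \sum_w (dense_at c t (expR (8 * (E + 1))) w)%:R <= N / 8.
Proof.
move=> E0 HE.
have H w : (dense_at c t (expR (8 * (E + 1))) w)%:R * (8 * (E + 1)) <=
    ln (density w) + (density w)^-1.
  have d0 := density_gt0 w.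
  have lnV : - ln (density w) <= (density w)^-1 - 1.
    by rewrite -lnV ?posrE // ln_sub1 // invr_gt0.
  have i0 : 0 < (density w)^-1 by rewrite invr_gt0.
  case: (boolP (dense_at _ _ _ _)) => [dw|_]; last by rewrite mul0r; lra.
  rewrite mul1r; suff : 8 * (E + 1) <= ln (density w) by lra.
  rewrite -[leLHS]expRK ler_ln ?posrE ?expR_gt0 //.
  move: dw; rewrite /dense_at /density ler_pdivlMr ?mulr_gt0 ?colour_count_gt0 //.
  by rewrite mulrA => /ltW.
have := ler_sum (index_enum W) (fun w (_ : xpredT w) => H w).
rewrite -mulr_suml big_split /= => H1.
have E8 : 0 < 8 * (E + 1) by lra.
rewrite -(ler_pM2r E8).
have := sum_density_inv.
have -> : N / 8 * (8 * (E + 1)) = E * N + N by field.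
move: H1 HE; lra.
Qed.
End Information.

Lemma periodic_mod (T : Type) (P : nat) (d : nat -> T) :
  (forall i, d (i + P)%N = d i) -> forall i, d (i %% P)%N = d i.
Proof.
move=> dP i; rewrite {2}(divn_eq i P) addnC.
elim: (i %/ P)%N => [|k IH]; first by rewrite mul0n addn0.
by rewrite mulSn addnCA addnC dP.
Qed.

Section Words.
Variables (R : realType) (A : finType) (P : nat) (d : nat -> A).
Hypothesis P0 : (0 < P)%N.
Hypothesis dP : forall i, d (i + P)%N = d i.
Hypothesis A0 : (0 < #|A|)%N.

Definition word m (i : 'I_P) : m.-tuple A := [tuple d (i + j) | j < m].
Definition shift m (i : 'I_P) : 'I_P := Ordinal (ltn_pmod (i + m) P0).

Lemma shift_inj m : injective (shift m).
Proof.
move=> i j [] /eqP; rewrite eqn_modDr !modn_small ?ltn_ord // => /eqP.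
exact: val_inj.
Qed.

Lemma word_eq m i j : (word m i == word m j) =
  [forall k : 'I_m, d (i + k) == d (j + k)].
Proof.
apply/eqP/forallP => [e k|e].
  by have := congr1 (fun w => tnth w k) e; rewrite !tnth_mktuple => ->.
by apply: eq_from_tnth => k; rewrite !tnth_mktuple; apply/eqP.
Qed.

Lemma word_double m i j : (word (m + m) i == word (m + m) j) =
  (word m i == word m j) && (word m (shift m i) == word m (shift m j)).
Proof.
rewrite !word_eq; apply/forallP/andP => [e|[/forallP e1 /forallP e2] k].
  split; apply/forallP => k; first by have := e (lshift m k).
  have := e (rshift m k) => /=.
  by rewrite -[d ((i + m) %% P + k)](periodic_mod dP) -[d ((j + m) %% P + k)](periodic_mod dP)
    !modnDml !(periodic_mod dP) !addnA.
case: (split_ordP k) => l ->; first by have := e1 l.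
have := e2 l => /=.
by rewrite -[d ((i + m) %% P + l)](periodic_mod dP) -[d ((j + m) %% P + l)](periodic_mod dP)
    !modnDml !(periodic_mod dP) !addnA.
Qed.

Let N : R := #|'I_P|%:R.

Definition word_count m i : R := colour_count R (word m) (word m i).

(** [P] times the Shannon entropy of the [m]-words read along one period. *)
Definition word_entropy m : R := \sum_i ln (N / word_count m i).

Let N_gt0 : 0 < N. Proof. by rewrite ltr0n card_ord. Qed.

Let wc_gt0 m i : 0 < word_count m i. Proof. exact: colour_count_gt0. Qed.

Lemma word_entropy_ge0 m : 0 <= word_entropy m.
Proof.
apply: sumr_ge0 => i _; rewrite ln_ge0 // ler_pdivlMr // mul1r.
rewrite /word_count /colour_count /N -sum1_card natr_sum; apply: ler_sum => j _.
by rewrite ler_nat leq_b1.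
Qed.

(** Gibbs' inequality against the uniform law on [m]-tuples, through [ln x <= x - 1]. *)
Lemma word_entropy_le m : word_entropy m <= N * (m%:R * ln #|A|%:R).
Proof.
have c0 : 0 < (#|A| ^ m)%:R :> R by rewrite ltr0n expn_gt0 A0.
have -> : m%:R * ln #|A|%:R = ln (#|A| ^ m)%:R :> R.
  by rewrite natrX lnXn ?ltr0n // mulr_natl.
have H i : ln (N / word_count m i) <= ln (#|A| ^ m)%:R + (N / (#|A| ^ m)%:R / word_count m i - 1).
  have p : 0 < N / (#|A| ^ m)%:R / word_count m i by rewrite !divr_gt0.
  have lnE : ln (N / (#|A| ^ m)%:R / word_count m i) = ln (N / word_count m i) - ln (#|A| ^ m)%:R.
    by rewrite mulrAC [LHS]ln_div ?posrE ?divr_gt0.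
  by have := ln_sub1 p; rewrite lnE; lra.
apply: le_trans (ler_sum _ (fun i _ => H i)) _.
rewrite big_split /= sumr_const -[_ *+ _]mulr_natl -/N gerDl.
rewrite big_split /= sumrN sumr_const -mulr_sumr subr_le0.
rewrite -/N; apply: (@le_trans _ _ (N / (#|A| ^ m)%:R * (#|A| ^ m)%:R)); last by rewrite divfK ?gt_eqF.
rewrite ler_pM2l ?divr_gt0 // -card_tuple -sum1_card natr_sum.
rewrite (eq_bigr (fun i => \sum_v (word m i == v)%:R / colour_count R (word m) v)); last first.
  move=> i _; rewrite (bigD1 (word m i)) //= eqxx big1 ?addr0 ?div1r // => v.
  by rewrite eq_sym => /negbTE ->; rewrite mul0r.
rewrite exchange_big /=; apply: ler_sum => v _; rewrite -mulr_suml.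
have [->|n0] := eqVneq (\sum_i (word m i == v)%:R : R) 0; first by rewrite mul0r.
by rewrite /colour_count divff.
Qed.

(** A [2m]-word is a pair of adjacent [m]-words, so their mutual information is
    [H(m) + H(m) - H(2m)]; the second [H(m)] is that of the shifted word. *)
Lemma sum_ln_density m :
  \sum_i ln (density R (word m) (shift m) i) = word_entropy m *+ 2 - word_entropy (m + m).
Proof.
have pcE i : pair_count R (word m) (shift m) (word m i) (word m (shift m i)) =
    word_count (m + m) i.
  by apply: eq_bigr => j _; rewrite word_double.
have hs : word_entropy m = \sum_i ln (N / word_count m (shift m i)).
  by rewrite /word_entropy (reindex_inj (shift_inj (m := m))).
rewrite mulr2n {2}hs -big_split -sumrB /=; apply: eq_bigr => i _.
rewrite /density pcE -/(word_count m i) -/(word_count m (shift m i)) -/N.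
rewrite !ln_div ?posrE ?mulr_gt0 //.
rewrite !lnM ?posrE //. ring.
Qed.

(* The normalised entropies h(2^j) / 2^j take values in a bounded interval, so
   they cannot drop by a fixed amount at too many consecutive scales. *)
Lemma low_information_scale (delta : R) (J n : nat) : 0 < delta ->
  2 * ln #|A|%:R < delta * n%:R ->
  exists j, (J <= j < J + n)%N /\
    \sum_i ln (density R (word (2 ^ j)) (shift (2 ^ j)) i) <= delta * (2 ^ j)%:R * N.
Proof.
move=> d0 Hn.
have [//|nex] := pselect (exists j, (J <= j < J + n)%N /\
    \sum_i ln (density R (word (2 ^ j)) (shift (2 ^ j)) i) <= delta * (2 ^ j)%:R * N).
(* If all scales fail, each doubling lowers the normalised entropy by [delta * N / 2]; after [n]
   doublings this exceeds its initial bound [N * ln #|A|]. *)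
have main k : (k <= n)%N -> word_entropy (2 ^ (J + k)) / (2 ^ (J + k))%:R <=
    word_entropy (2 ^ J) / (2 ^ J)%:R - k%:R * (delta * N / 2).
  elim: k => [|k IH] kn; first by rewrite addn0 mul0r subr0.
  have /negP : ~ (\sum_i ln (density R (word (2 ^ (J + k))) (shift (2 ^ (J + k))) i)
      <= delta * (2 ^ (J + k))%:R * N).
    by move=> h; apply: nex; exists (J + k)%N; rewrite leq_addr ltn_add2l kn.
  rewrite -ltNge sum_ln_density addnn -mul2n -expnS -addnS => H.
  have := IH (ltnW kn).
  set m := (2 ^ (J + k))%N in H *.
  have m0 : 0 < m%:R :> R by rewrite ltr0n expn_gt0.
  have -> : (2 ^ (J + k.+1))%:R = 2 * m%:R :> R by rewrite addnS expnS natrM.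
  move=> IH'; have -> : k.+1%:R = k%:R + 1 :> R by rewrite natr1.
  rewrite [in leRHS]mulrDl mul1r opprD addrA.
  apply: le_trans (lerD IH' (lexx _)).
  rewrite ler_pdivrMr ?mulr_gt0 //.
  have -> : (word_entropy m / m%:R - delta * N / 2) * (2 * m%:R) =
     word_entropy m *+ 2 - delta * m%:R * N by field; rewrite gt_eqF.
  move: H; lra.
have := main n (leqnn n).
have : 0 <= word_entropy (2 ^ (J + n)) / (2 ^ (J + n))%:R by rewrite divr_ge0 ?word_entropy_ge0.
have : word_entropy (2 ^ J) / (2 ^ J)%:R <= N * ln #|A|%:R.
  rewrite ler_pdivrMr ?ltr0n ?expn_gt0 //; have := word_entropy_le (2 ^ J).
  by rewrite [_%:R * ln _]mulrC mulrA.
move=> h1 h2 h3; have h4 := le_trans h2 h3.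
have : N * (2 * ln #|A|%:R) < N * (delta * n%:R) by rewrite ltr_pM2l.
move: h1 h4; lra.
Qed.

End Words.

Local Open Scope classical_set_scope.
Local Open Scope ring_scope.

(** * Expanding lifts and the closing lemma *)

Section Expanding.
Variable R : realType.
Implicit Types (f phi : R -> R) (D : R -> R -> R) (x y mu C L : R) (d k : int).

(** [D] is an adapted metric on the line. A lift expands between any two points, not only nearby
    ones, so inverse branches and local charts never appear. *)
Record expmap f d L mu C D : Prop := Expmap {
  em_per : forall x, f (x + 1) = f x + d%:~R;
  em_lip : forall x y, `|f x - f y| <= L * `|x - y|;
  em_mu : 1 < mu;
  em_ge : forall x y, `|x - y| <= D x y;
  em_le : forall x y, D x y <= C * `|x - y|;
  em_tri : forall x y z, D x z <= D x y + D y z;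
  em_sym : forall x y, D x y = D y x;
  em_shift : forall x y k, D (x + k%:~R) (y + k%:~R) = D x y;
  em_exp : forall x y, mu * D x y <= D (f x) (f y) }.

Definition Sum f phi n x : R := \sum_(i < n) phi (iter i f x).

Definition perpt f n x := (0 < n)%N /\ exists k : int, iter n f x = x + k%:~R.

Definition int_periodic phi := forall x k, phi (x + k%:~R) = phi x.

Definition lipschitz_with (K : R) phi := forall x y, `|phi x - phi y| <= K * `|x - y|.

Lemma int_per f d : (forall x, f (x + 1) = f x + d%:~R) ->
  forall x k, f (x + k%:~R) = f x + (d * k)%:~R.
Proof.
move=> fd x k.
have nat_per n y : f (y + n%:R) = f y + (d * n%:Z)%:~R.
  elim: n => [|n IH]; first by rewrite mulr0 !addr0.
  rewrite -natr1 addrA fd IH -addrA -intrD; congr (_ + _%:~R).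
  by rewrite -addn1 PoszD mulrDr mulr1.
case: k => n; first exact: nat_per.
have := nat_per n.+1 (x - n.+1%:R); rewrite subrK => ->.
by rewrite NegzE mulrN !intrN addrK.
Qed.

Lemma iter_per f d : (forall x, f (x + 1) = f x + d%:~R) ->
  forall n x k, iter n f (x + k%:~R) = iter n f x + (d ^+ n * k)%:~R.
Proof.
move=> fd; elim=> [|n IH] x k; first by rewrite mul1r.
by rewrite /= IH (int_per fd) exprS mulrA.
Qed.

Lemma lipschitz_continuous (K : R) phi : lipschitz_with K phi -> continuous phi.
Proof.
move=> lp x; apply/cvgrPdist_le => e e0.
have K0 : 0 < `|K| + 1 by rewrite ltr_wpDl.
have /cvgrPdist_le/(_ (e / (`|K| + 1))) : (y @[y --> x] --> x) by exact: cvg_id.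
rewrite divr_gt0 // => /(_ isT); apply: filterS => y.
rewrite ler_pdivlMr // => H; apply: le_trans (lp _ _) (le_trans _ H).
by rewrite mulrC ler_wpM2l // (le_trans (ler_norm _)) // lerDl.
Qed.

Lemma exp_unbounded mu C : 1 < mu -> exists n, C < mu ^+ n.
Proof.
move=> mu1.
have bern n : 1 + n%:R * (mu - 1) <= mu ^+ n.
  elim: n => [|n IH]; first by rewrite mul0r addr0.
  rewrite exprS; have : mu * (1 + n%:R * (mu - 1)) <= mu * mu ^+ n by rewrite ler_pM2l //; lra.
  apply: le_trans; rewrite -natr1.
  have : 0 <= n%:R * (mu - 1) ^+ 2 by rewrite mulr_ge0 // sqr_ge0.
  by nra.
have [n Hn] : exists n : nat, C / (mu - 1) < n%:R.
  by exists (Num.truncn `|C / (mu - 1)|).+1; rewrite (le_lt_trans (ler_norm _)) // truncnS_gt.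
exists n; apply: lt_le_trans (bern n).
rewrite ltr_pdivrMr in Hn; last by lra.
by lra.
Qed.

Lemma frac_exists x : exists k : int, 0 <= x - k%:~R < 1.
Proof.
exists (Num.floor x); have := floor_itv x; rewrite intrD /=; lra.
Qed.

Lemma periodic_bounded (K : R) phi : 0 <= K -> lipschitz_with K phi -> int_periodic phi ->
  forall x, `|phi x - phi 0| <= K.
Proof.
move=> K0 lp pp x; have [k kx] := frac_exists x.
have -> : phi x = phi (x - k%:~R) by rewrite -intrN pp.
apply: le_trans (lp _ _) _; rewrite subr0 ger0_norm; last by lra.
by rewrite -[leRHS]mulr1 ler_wpM2l //; lra.
Qed.

Section Fixed.
Variables (f : R -> R) (d : int) (L mu C : R) (D : R -> R -> R).
Hypothesis Hf : expmap f d L mu C D.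

Let mu1 : 1 < mu. Proof. exact: em_mu Hf. Qed.

Let mu0 : 0 < mu. Proof. exact: lt_trans ltr01 mu1. Qed.

Lemma metric_ge0 x y : 0 <= D x y.
Proof. exact: le_trans (em_ge Hf x y). Qed.

Lemma em_C_ge1 : 1 <= C.
Proof.
by have := le_trans (em_ge Hf 1 0) (em_le Hf 1 0); rewrite subr0 normr1 mulr1.
Qed.

Lemma em_L_ge0 : 0 <= L.
Proof.
by have := le_trans (normr_ge0 _) (em_lip Hf 1 0); rewrite subr0 normr1 mulr1.
Qed.

Lemma iter_exp n x y : mu ^+ n * D x y <= D (iter n f x) (iter n f y).
Proof.
elim: n => [|n IH]; first by rewrite mul1r.
rewrite exprS -mulrA /=; apply: le_trans (em_exp Hf _ _).
by rewrite ler_pM2l ?mu0.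
Qed.

Lemma iter_inj n : injective (iter n f).
Proof.
move=> x y xy; have := iter_exp n x y; rewrite xy.
have -> : D (iter n f y) (iter n f y) = 0.
  apply/eqP; rewrite eq_le metric_ge0 andbT.
  by apply: le_trans (em_le Hf _ _) _; rewrite subrr normr0 mulr0.
rewrite pmulr_rle0 ?exprn_gt0 ?mu0 //.
move=> D0; apply/eqP; rewrite -subr_eq0 -normr_le0.
exact: le_trans (em_ge Hf x y) D0.
Qed.

Lemma lip_iter n : lipschitz_with (L ^+ n) (iter n f).
Proof.
elim: n => [|n IH] x y; first by rewrite mul1r.
rewrite exprS -mulrA; apply: le_trans (em_lip Hf _ _) _.
by rewrite ler_wpM2l ?em_L_ge0 //; exact: IH.
Qed.

(** Otherwise the images of 0 and 1 under all multiples of [n] iterations stay at distance 1,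
    against expansion. *)
Lemma degree_neq (n : nat) : (0 < n)%N -> d ^+ n != 1.
Proof.
move=> n0; apply/eqP => dn.
have [m Hm] := exp_unbounded C mu1.
have : `|iter (n * m) f 1 - iter (n * m) f 0| = 1.
  have := iter_per (em_per Hf) (n * m) 0 1; rewrite add0r => ->.
  by rewrite addrAC subrr add0r mulr1 exprM dn expr1n normr1.
have H1 := le_trans (iter_exp (n * m) 1 0) (em_le Hf _ _) => e; rewrite e mulr1 in H1.
have : mu ^+ m <= mu ^+ (n * m) by rewrite ler_weXn2l ?leq_pmull // ltW.
have : 1 <= D 1 0 by have := em_ge Hf 1 0; rewrite subr0 normr1.
have : 0 < mu ^+ (n * m) by rewrite exprn_gt0 ?mu0.
by move: H1 Hm; nra.
Qed.

Lemma degree_neq0 : d != 0.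
Proof.
apply/eqP => d0; have := em_per Hf 0; rewrite d0 addr0 add0r => e.
have := @iter_inj 1 1 0 e => /eqP; rewrite oner_eq0 //.
Qed.

Lemma affine_surj (g : R -> R) (e : int) : continuous g -> e != 0 ->
  (forall k : int, g k%:~R = g 0 + (e * k)%:~R) -> forall v, exists x, g x = v.
Proof.
move=> cg e0 gk v.
set n : nat := (Num.truncn `|v - g 0|).+1.
have nv : `|v - g 0| < n%:R by rewrite truncnS_gt.
have e1 : 1 <= `|e%:~R| :> R.
  rewrite -intr_norm -[leLHS]/(1%:~R) ler_int.
  by rewrite -gtz0_ge1 normr_gt0.
have gn : g n%:R = g 0 + e%:~R * n%:R by rewrite -[n%:R]/(n%:Z%:~R) gk intrM.
have gNn : g (- n%:R) = g 0 - e%:~R * n%:R.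
  by rewrite -[n%:R]/(n%:Z%:~R) -intrN gk intrM intrN mulrN.
have n0 : 0 <= n%:R :> R by [].
have [|||c _ <-] := @IVT R g (- n%:R) n%:R v; last by exists c.
- by lra.
- exact: continuous_subspaceT.
- rewrite gn gNn ge_min le_max; move: nv e1 n0; rewrite ltr_norml.
  move: (n%:R) (g 0) (e%:~R : R) => N a b /andP[h1 h2] h3 h4.
  by case: (lerP 0 b) h3 => hb h3; rewrite ?(ger0_norm hb) ?(ltr0_norm hb) in h3;
    apply/andP; split; apply/orP; [left|right|right|left]; nra.
Qed.

Lemma iter_continuous n : continuous (iter n f).
Proof. exact: lipschitz_continuous (lip_iter n). Qed.

Lemma iter_surj n y : exists x, iter n f x = y.
Proof.
apply: (affine_surj (e := d ^+ n)).
- exact: iter_continuous.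
- by rewrite expf_neq0 // degree_neq0.
- by move=> k; rewrite -[k%:~R in LHS]add0r (iter_per (em_per Hf)).
Qed.

(** The displacement [iter n f x - x] grows by the nonzero integer [d ^+ n - 1] under a unit
    translation, so the intermediate value theorem gives every [K]. No contraction argument is
    involved; closeness to a pseudo-orbit is proved afterwards. *)
Lemma periodic_exists n (K : int) : (0 < n)%N -> exists p, iter n f p = p + K%:~R.
Proof.
move=> n0.
have [|||p Hp] := @affine_surj (fun x => iter n f x - x) (d ^+ n - 1) _ _ _ K%:~R.
- by move=> x; apply: cvgB; [exact: iter_continuous | exact: cvg_id].
- by rewrite subr_eq0 degree_neq.
- move=> k; rewrite -[k%:~R in LHS]add0r (iter_per (em_per Hf)) subr0 add0r.
  by rewrite mulrBl mul1r intrB addrA.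
by exists p; rewrite -Hp addrC subrK.
Qed.

(* Going once around the cycle, the distances [D (iter l f p) (Z l)] are
   multiplied by at least [mu], up to the jumps, and come back to their initial
   value; so summing the inequalities over the cycle bounds their sum. *)
Lemma closing n (Z : nat -> R) (K : int) : (0 < n)%N -> Z n = Z 0 + K%:~R ->
  exists p, iter n f p = p + K%:~R /\
    \sum_(l < n) D (iter l f p) (Z l) <= C / (mu - 1) * \sum_(l < n) `|f (Z l) - Z l.+1|.
Proof.
move=> n0 ZK; have [p pK] := periodic_exists K n0; exists p; split=> //.
pose E l := D (iter l f p) (Z l).
have En : \sum_(l < n) E l.+1 = \sum_(l < n) E l.
  case: n n0 ZK pK => // n _ ZK pK.
  rewrite big_ord_recr [RHS]big_ord_recl addrC; congr (_ + _).
  by rewrite /E /bump ZK pK (em_shift Hf).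
have step l : mu * E l <= E l.+1 + C * `|f (Z l) - Z l.+1|.
  apply: le_trans (em_exp Hf _ _) _; apply: le_trans (em_tri Hf _ (Z l.+1) _) _.
  by rewrite lerD2l (le_trans (em_le Hf _ _)) // distrC.
have := ler_sum (index_enum 'I_n) (fun l (_ : xpredT l) => step l).
rewrite -mulr_sumr big_split /= En -mulr_sumr => H.
rewrite mulrAC ler_pdivlMr; last by rewrite subr_gt0.
by rewrite mulrBr mulr1 [_ * mu]mulrC; move: H; rewrite /E; lra.
Qed.

(** Distances grow by a factor [mu], so the last one dominates a geometric series. *)
Lemma expanding_sum n x y :
  \sum_(i < n) D (iter i f x) (iter i f y) <= (mu - 1)^-1 * D (iter n f x) (iter n f y).
Proof.
have m0 : 0 < mu - 1 by rewrite subr_gt0.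
rewrite [leRHS]mulrC ler_pdivlMr //; elim: n => [|n IH].
  by rewrite big_ord0 mul0r metric_ge0.
rewrite big_ord_recr /= mulrDl; have := em_exp Hf (iter n f x) (iter n f y).
by move: IH; lra.
Qed.

Lemma distortion (K : R) phi n x y : 0 <= K -> lipschitz_with K phi ->
  `|Sum f phi n x - Sum f phi n y| <= K * C / (mu - 1) * `|iter n f x - iter n f y|.
Proof.
move=> K0 lp; rewrite /Sum -sumrB; apply: le_trans (ler_norm_sum _ _ _) _.
apply: (@le_trans _ _ (K * \sum_(i < n) D (iter i f x) (iter i f y))).
  rewrite mulr_sumr; apply: ler_sum => i _; apply: le_trans (lp _ _) _.
  by rewrite ler_wpM2l // (em_ge Hf).
rewrite -!mulrA ler_wpM2l //; apply: le_trans (expanding_sum _ _ _) _.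
rewrite mulrCA ler_wpM2l ?invr_ge0 ?subr_ge0 ?(ltW mu1) //.
exact: em_le Hf _ _.
Qed.

Lemma SumD phi n m x : Sum f phi (n + m) x = Sum f phi n x + Sum f phi m (iter n f x).
Proof.
rewrite /Sum big_split_ord /=; congr (_ + _); apply: eq_bigr => i _.
by rewrite addnC iterD.
Qed.

Lemma SumS phi n x : Sum f phi n.+1 x = Sum f phi n x + phi (iter n f x).
Proof. by rewrite /Sum big_ord_recr. Qed.

Lemma Sum_per phi n : int_periodic phi -> int_periodic (Sum f phi n).
Proof.
by move=> pp x k; apply: eq_bigr => i _; rewrite (iter_per (em_per Hf)) pp.
Qed.

Lemma closing_sum (K : R) phi n (Z : nat -> R) (k : int) : 0 <= K -> lipschitz_with K phi ->
  (0 < n)%N -> Z n = Z 0 + k%:~R ->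
  exists p, iter n f p = p + k%:~R /\
    `|Sum f phi n p - \sum_(l < n) phi (Z l)| <=
      K * (C / (mu - 1)) * \sum_(l < n) `|f (Z l) - Z l.+1|.
Proof.
move=> K0 lp n0 ZK; have [p [pK Hp]] := closing n0 ZK; exists p; split=> //.
rewrite /Sum -sumrB; apply: le_trans (ler_norm_sum _ _ _) _.
apply: (@le_trans _ _ (K * \sum_(i < n) D (iter i f p) (Z i))); last first.
  by rewrite -mulrA ler_wpM2l.
rewrite mulr_sumr; apply: ler_sum => i _; apply: le_trans (lp _ _) _.
by rewrite ler_wpM2l // (em_ge Hf).
Qed.

Lemma closing_orbit (K : R) phi n x (k : int) : 0 <= K -> lipschitz_with K phi ->
  (0 < n)%N ->
  exists p, iter n f p = p + k%:~R /\
    `|Sum f phi n p - Sum f phi n x| <= K * (C / (mu - 1)) * `|iter n f x - (x + k%:~R)|.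
Proof.
move=> K0 lp n0.
(* Replacing time [n] by [x + k] leaves a single jump, at the last step. *)
have [|p [pk Hp]] := @closing_sum K phi n
  (fun l => if (l < n)%N then iter l f x else x + k%:~R) k K0 lp n0.
  by rewrite ltnn n0.
exists p; split=> //; move: Hp.
rewrite (eq_bigr (fun i : 'I_n => phi (iter i f x))); last by move=> i _; rewrite ltn_ord.
move/le_trans; apply; apply: ler_wpM2l.
  by rewrite mulr_ge0 // divr_ge0 ?subr_ge0 ?(ltW mu1) // (le_trans ler01) // em_C_ge1.
case: n n0 {pk} => // n _.
rewrite big_ord_recr /= ltnS leqnn ltnn big1 ?add0r // => i _.
by rewrite ltnS (ltnW (ltn_ord i)) ltnS ltn_ord subrr normr0.
Qed.

End Fixed.
End Expanding.

(** * The Mane subaction *)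

Section Mane.
Variable R : realType.
Variables (f : R -> R) (d : int) (L mu C : R) (D : R -> R -> R).
Hypothesis Hf : expmap f d L mu C D.
Variables (K : R) (phi : R -> R).
Hypothesis K0 : 0 <= K.
Hypothesis phiL : lipschitz_with K phi.
Hypothesis phiP : int_periodic phi.

Definition periodic_averages : set R :=
  [set a | exists n p, perpt f n p /\ a = Sum f phi n p / n%:R].

Definition minimal_average : R := inf periodic_averages.

Let K1 : R := K * (C / (mu - 1)).

Let mu1 : 1 < mu. Proof. exact: em_mu Hf. Qed.

Let K1_ge0 : 0 <= K1.
Proof.
by rewrite mulr_ge0 // divr_ge0 ?subr_ge0 ?(ltW mu1) // (le_trans ler01) // (em_C_ge1 Hf).
Qed.

Lemma periodic_averages_has_inf : has_inf periodic_averages.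
Proof.
split.
  have [p pk] := periodic_exists Hf 0 (ltnSn 0).
  by exists (Sum f phi 1 p / 1%:R); exists 1%N, p; split=> //; split=> //; exists 0.
exists (phi 0 - K) => _ [n [p [[n0 _] ->]]].
rewrite ler_pdivlMr ?ltr0n // mulrC -[n in n%:R]card_ord -sum1_card natr_sum mulr_suml.
apply: ler_sum => i _; rewrite mul1r.
have := periodic_bounded K0 phiL phiP (iter i f p); rewrite ler_norml => /andP[h _].
by move: h; lra.
Qed.

Lemma minimal_average_le n p : perpt f n p -> n%:R * minimal_average <= Sum f phi n p.
Proof.
move=> np; have n0 : 0 < n%:R :> R by rewrite ltr0n; case: np.
rewrite mulrC -ler_pdivlMr //; apply: ge_inf; first by case: periodic_averages_has_inf.
by exists n, p.
Qed.

(** Any orbit segment closes up with one jump of size at most 1, at a cost of at most [K1]. This is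
    what makes the infimum in [subaction] finite. *)
Lemma Sum_lower n x : n%:R * minimal_average - K1 <= Sum f phi n x.
Proof.
case: (posnP n) => [->|n0]; first by rewrite mul0r sub0r /Sum big_ord0 oppr_le0 K1_ge0.
have [k kx] := frac_exists (iter n f x - x).
have [p [pk Hp]] := closing_orbit Hf x k K0 phiL n0.
have := minimal_average_le (conj n0 (ex_intro _ k pk) : perpt f n p).
have : K1 * `|iter n f x - (x + k%:~R)| <= K1.
  rewrite -[leRHS]mulr1 ler_wpM2l // ?K1_ge0 // opprD addrA ger0_norm; lra.
by move: Hp; rewrite -/K1 ler_norml => /andP[_]; lra.
Qed.

(** Preimages are taken modulo 1, so that the infimum is a function on the circle. *)
Definition backward_sums (x : R) : set R :=
  [set a | exists n y (k : int), iter n f y = x + k%:~R /\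
     a = Sum f phi n y - n%:R * minimal_average].

Definition subaction (x : R) : R := inf (backward_sums x).

Lemma backward_has_inf x : has_inf (backward_sums x).
Proof.
split; first by exists (Sum f phi 0 x - 0%:R * minimal_average); exists 0%N, x, 0; rewrite addr0.
exists (- K1) => _ [n [y [k [_ ->]]]].
by have := Sum_lower n y; lra.
Qed.

Lemma subaction_le x n y (k : int) : iter n f y = x + k%:~R ->
  subaction x <= Sum f phi n y - n%:R * minimal_average.
Proof.
move=> e; apply: ge_inf; first by case: (backward_has_inf x).
by exists n, y, k.
Qed.

Lemma subaction_ge x b : (forall n y (k : int), iter n f y = x + k%:~R ->
  b <= Sum f phi n y - n%:R * minimal_average) -> b <= subaction x.
Proof.
move=> H; apply: lb_le_inf; first by case: (backward_has_inf x).
by move=> _ [n [y [k [e ->]]]]; exact: H e.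
Qed.

Lemma subaction_periodic : int_periodic subaction.
Proof.
have le x (k : int) : subaction (x + k%:~R) <= subaction x.
  apply: subaction_ge => n y j e; apply: (subaction_le (k := j - k)).
  by rewrite e intrB; ring.
move=> x k; apply/eqP; rewrite eq_le le /=.
by have := le (x + k%:~R) (- k); rewrite intrN addrK.
Qed.

Lemma subaction_lip : lipschitz_with K1 subaction.
Proof.
have le x y : subaction x <= subaction y + K1 * `|x - y|.
  rewrite -lerBlDr; apply: subaction_ge => n z k e.
  (* Keeping the same [k] selects the same inverse branch: the endpoints differ by [x - y] exactly
     and distortion applies. *)
  have [z' e'] := iter_surj Hf n (x + k%:~R).
  have := subaction_le e'; have := distortion Hf n z z' K0 phiL.
  have -> : K * C / (mu - 1) = K1 by rewrite /K1 mulrA.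
  rewrite e e' opprD addrACA subrr addr0 [`|y - x|]distrC ler_norml.
  by move=> /andP[h1 h2]; move: h1 h2; lra.
move=> x y; rewrite ler_norml; have := le x y; have := le y x.
by rewrite distrC => h1 h2; apply/andP; split; lra.
Qed.

Definition normalized (x : R) : R := phi x - minimal_average + subaction x - subaction (f x).

(** A backward orbit of [x], prolonged by one step, is a backward orbit of [f x]. *)
Lemma normalized_ge0 x : 0 <= normalized x.
Proof.
rewrite /normalized subr_ge0 -lerBlDl; apply: subaction_ge => n y k e.
have e' : iter n.+1 f y = f x + (d * k)%:~R by rewrite /= e (int_per (em_per Hf)).
have := subaction_le e'; rewrite SumS e phiP.
have -> : n.+1%:R = n%:R + 1 :> R by rewrite natr1.
lra.
Qed.

Lemma normalized_periodic : int_periodic normalized.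
Proof.
by move=> x k; rewrite /normalized phiP (int_per (em_per Hf)) !subaction_periodic.
Qed.

Lemma normalized_lip : lipschitz_with (K + K1 + K1 * L) normalized.
Proof.
move=> x y.
have -> : normalized x - normalized y =
  (phi x - phi y) + (subaction x - subaction y) - (subaction (f x) - subaction (f y)).
  by rewrite /normalized; ring.
apply: le_trans (ler_normB _ _) _; rewrite mulrDl; apply: lerD.
  apply: le_trans (ler_normD _ _) _; rewrite mulrDl; apply: lerD.
    exact: phiL.
  exact: subaction_lip.
apply: le_trans (subaction_lip _ _) _.
by rewrite -mulrA ler_wpM2l ?K1_ge0 // (em_lip Hf).
Qed.

Lemma Sum_normalized n x : Sum f normalized n x =
  Sum f phi n x - n%:R * minimal_average + subaction x - subaction (iter n f x).
Proof.
elim: n => [|n IH]; first by rewrite /Sum !big_ord0; ring.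
have -> : n.+1%:R = n%:R + 1 :> R by rewrite natr1.
by rewrite !SumS IH /normalized; ring.
Qed.

Lemma Sum_normalized_perpt n p : perpt f n p ->
  Sum f normalized n p = Sum f phi n p - n%:R * minimal_average.
Proof.
by move=> [n0 [k e]]; rewrite Sum_normalized e subaction_periodic addrK.
Qed.

Lemma small_periodic_average (delta : R) : 0 < delta ->
  exists n p, perpt f n p /\ Sum f normalized n p <= n%:R * delta.
Proof.
move=> d0; have [_ [n [p [np ->]]] H] := inf_adherent d0 periodic_averages_has_inf.
exists n, p; split=> //; rewrite Sum_normalized_perpt //.
have n0 : 0 < n%:R :> R by rewrite ltr0n; case: np.
by rewrite ltr_pdivrMr // in H; move: H; rewrite /minimal_average; lra.
Qed.

End Mane.

(** * Periodic orbits with superpolynomially small sums *)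

Lemma sum_mul (R : nmodType) (F : nat -> R) (g m : nat) :
  \sum_(l < g * m) F l = \sum_(i < g) \sum_(j < m) F (i * m + j)%N.
Proof.
elim: g => [|g IH]; first by rewrite !big_ord0.
by rewrite mulSnr big_split_ord /= IH big_ord_recr.
Qed.

(** Follows from [1 + b m <= expR (b m)] raised to the power [a + 1], with [b = beta / (a + 1)]: one
    power of [m] is left over to beat the constants. *)
Lemma poly_exp_small (R : realType) (a : nat) (beta c eta : R) : 0 < beta -> 0 < c -> 0 < eta ->
  exists m0, forall m, (m0 <= m)%N -> c * m%:R ^+ a * expR (- (beta * m%:R)) <= eta.
Proof.
move=> b0 c0 e0; pose b := beta / a.+1%:R.
have bp : 0 < b by rewrite divr_gt0.
exists (Num.truncn (c / (b ^+ a.+1 * eta))).+1 => m hm.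
have m0 : 0 < m%:R :> R by rewrite ltr0n (leq_trans _ hm).
have Hm : c / (b ^+ a.+1 * eta) < m%:R.
  by apply: lt_le_trans (truncnS_gt _) _; rewrite ler_nat.
have E : (b * m%:R) ^+ a.+1 <= expR (beta * m%:R).
  have -> : beta * m%:R = (b * m%:R) *+ a.+1.
    by rewrite -[RHS]mulr_natr /b mulrAC divfK ?pnatr_eq0.
  rewrite -[_ *+ a.+1]mulr_natr expRM_natr.
  have bm0 : 0 < b * m%:R by rewrite mulr_gt0.
  apply: lerXn2r; rewrite ?nnegrE ?expR_ge0 ?(ltW bm0) //.
  by have := expR_ge1Dx (b * m%:R); lra.
have bm : 0 < (b * m%:R) ^+ a.+1 by rewrite exprn_gt0 // mulr_gt0.
rewrite expRN ler_pdivrMr ?expR_gt0 //.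
apply: (@le_trans _ _ (eta * (b * m%:R) ^+ a.+1)); last by rewrite ler_pM2l.
rewrite ltr_pdivrMr ?mulr_gt0 ?exprn_gt0 // in Hm.
rewrite exprMn [m%:R ^+ a.+1]exprS.
have ma : 0 < m%:R ^+ a :> R by rewrite exprn_gt0.
have -> : eta * (b ^+ a.+1 * (m%:R * m%:R ^+ a)) = m%:R * (b ^+ a.+1 * eta) * m%:R ^+ a by ring.
by rewrite ler_pM2r // ltW.
Qed.

Section Coding.
Variable R : realType.
Variables (f : R -> R) (d : int) (L mu C : R) (D : R -> R -> R).
Hypothesis Hf : expmap f d L mu C D.
Variables (K : R) (psi : R -> R).
Hypothesis K0 : 0 <= K.
Hypothesis psiL : lipschitz_with K psi.
Hypothesis psiP : int_periodic psi.
Hypothesis psi0 : forall x, 0 <= psi x.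

Let mu1 : 1 < mu. Proof. exact: em_mu Hf. Qed.
Let mu0 : 0 < mu. Proof. exact: lt_trans ltr01 mu1. Qed.
Let C1 : 1 <= C. Proof. exact: em_C_ge1 Hf. Qed.

Lemma closing_mod n (z : nat -> R) (dg : nat -> int) : (0 < n)%N -> z n = z 0%N ->
  exists p, perpt f n p /\ Sum f psi n p <= \sum_(l < n) psi (z l) +
     K * (C / (mu - 1)) * \sum_(l < n) `|f (z l) - (z l.+1 + (dg l)%:~R)|.
Proof.
move=> n0 zn.
(* The integers [dg] carried at each step accumulate to the translation that lifts the pseudo-orbit
   to the line. *)
pose kk := fix kk l : int := if l is l'.+1 then d * kk l' + dg l' else 0.
have [|p [pk Hp]] := @closing_sum _ _ _ _ _ _ _ Hf K psi n (fun l => z l + (kk l)%:~R) (kk n) K0 psiL n0.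
  by rewrite zn addr0.
exists p; split; first by split=> //; exists (kk n).
have e1 : \sum_(l < n) psi (z l + (kk l)%:~R) = \sum_(l < n) psi (z l).
  by apply: eq_bigr => l _; rewrite psiP.
have e2 : \sum_(l < n) `|f (z l + (kk l)%:~R) - (z l.+1 + (kk l.+1)%:~R)| =
    \sum_(l < n) `|f (z l) - (z l.+1 + (dg l)%:~R)|.
  by apply: eq_bigr => l _; rewrite (int_per (em_per Hf)) /= intrD; congr `| _ |; ring.
by move: Hp; rewrite e1 e2 ler_norml => /andP[_]; rewrite lerBlDl.
Qed.

Section Orbit.
Variables (P : nat) (q : R).
Hypothesis Pq : perpt f P q.

Definition orbit_floor t : int := Num.floor (iter t f q).
Definition orbit_frac t : R := iter t f q - (orbit_floor t)%:~R.
(** The integer carried by [f] from one representative in [0,1) to the next; these digits are the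
    symbolic coding of the orbit. *)
Definition orbit_digit t : int := orbit_floor t.+1 - d * orbit_floor t.

Lemma orbit_frac_itv t : 0 <= orbit_frac t < 1.
Proof.
by rewrite /orbit_frac /orbit_floor; have := floor_itv (iter t f q); rewrite intrD /=; lra.
Qed.

Lemma orbit_frac_step t : f (orbit_frac t) = orbit_frac t.+1 + (orbit_digit t)%:~R.
Proof.
rewrite /orbit_frac -intrN (int_per (em_per Hf)) /orbit_digit /= mulrN intrB intrN; ring.
Qed.

Lemma orbit_shift t : exists k : int, iter (t + P) f q = iter t f q + k%:~R.
Proof.
have [_ [k e]] := Pq; exists (d ^+ t * k).
by rewrite iterD e (iter_per (em_per Hf)).
Qed.

Lemma orbit_floor_shift t : exists k : int,
   iter (t + P) f q = iter t f q + k%:~R /\ orbit_floor (t + P) = orbit_floor t + k.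
Proof.
have [k e] := orbit_shift t; exists k; split => //.
by rewrite /orbit_floor e floorDrz ?intr_int // intrKfloor.
Qed.

Lemma orbit_fracP t : orbit_frac (t + P) = orbit_frac t.
Proof.
have [k [e fe]] := orbit_floor_shift t.
by rewrite /orbit_frac e fe intrD; ring.
Qed.

Lemma orbit_digitP t : orbit_digit (t + P) = orbit_digit t.
Proof.
apply: (@intr_inj R); have := orbit_frac_step (t + P); rewrite -addSn !orbit_fracP orbit_frac_step.
by move/addrI.
Qed.

Lemma orbit_frac_mod t : orbit_frac (t %% P) = orbit_frac t.
Proof. exact: periodic_mod orbit_fracP t. Qed.

(** It does not depend on the orbit, hence neither does the alphabet: the number of scales to
    inspect can be fixed before the orbit. *)
Definition digit_bound : nat := (Num.truncn (`|f 0| + L + 1)).+1.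

Lemma orbit_digit_bound t : `|orbit_digit t| <= digit_bound.
Proof.
rewrite -(ler_int R) intr_norm.
have -> : (orbit_digit t)%:~R = f (orbit_frac t) - f 0 + f 0 - orbit_frac t.+1.
  by rewrite orbit_frac_step; ring.
have h1 := em_lip Hf (orbit_frac t) 0.
have := orbit_frac_itv t; have := orbit_frac_itv t.+1 => i1 i2.
have h2 : `|f (orbit_frac t) - f 0| <= L.
  by apply: le_trans h1 _; rewrite -[leRHS]mulr1 subr0 ler_wpM2l ?(em_L_ge0 Hf) // ger0_norm; lra.
have h3 : `|orbit_frac t.+1| <= 1 by rewrite ger0_norm; lra.
apply: (@le_trans _ _ (`|f 0| + L + 1)); last exact/ltW/truncnS_gt.
apply: le_trans (ler_normB _ _) _; apply: lerD => //.
by apply: le_trans (ler_normD _ _) _; rewrite addrC lerD2l.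
Qed.

Definition orbit_letter t : 'I_(digit_bound.*2.+1) :=
  inord (absz (orbit_digit t + digit_bound%:Z)).

Lemma orbit_letter_inj s t : orbit_letter s = orbit_letter t -> orbit_digit s = orbit_digit t.
Proof.
move=> /(congr1 val); have bs := orbit_digit_bound s; have bt := orbit_digit_bound t.
by rewrite /orbit_letter /= !inordK; lia.
Qed.

Lemma orbit_letterP t : orbit_letter (t + P) = orbit_letter t.
Proof. by rewrite /orbit_letter orbit_digitP. Qed.

(** Equal digits translate both iterates by the same integer [E], so after [m] steps they are at
    distance at most 1; expansion divides this by [mu ^+ m]. *)
Lemma same_word_close m s t : (forall j, (j < m)%N -> orbit_letter (s + j) = orbit_letter (t + j)) ->
  `|orbit_frac s - orbit_frac t| <= C / mu ^+ m.
Proof.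
move=> H.
have [E [Es Et]] : exists E : int, iter m f (orbit_frac s) = orbit_frac (s + m) + E%:~R /\
    iter m f (orbit_frac t) = orbit_frac (t + m) + E%:~R.
  elim: m H => [|m IH] H; first by exists 0; rewrite !addn0 !addr0.
  have [j jm|E [Es Et]] := IH; first by apply: H; rewrite ltnW.
  exists (orbit_digit (s + m) + d * E).
  have dst := orbit_letter_inj (H m (ltnSn m)).
  by rewrite /= Es Et !(int_per (em_per Hf)) !orbit_frac_step !addnS dst [(_ + d * E)%:~R]intrD !addrA.
rewrite ler_pdivlMr ?exprn_gt0 // mulrC.
have mm : 0 < mu ^+ m by rewrite exprn_gt0.
apply: (@le_trans _ _ (mu ^+ m * D (orbit_frac s) (orbit_frac t))).
  by rewrite ler_pM2l // (em_ge Hf).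
apply: le_trans (iter_exp Hf _ _ _) _; apply: le_trans (em_le Hf _ _) _.
rewrite -[leRHS]mulr1 ler_wpM2l ?(le_trans ler01) //.
rewrite Es Et opprD addrACA subrr addr0 ler_norml.
have := orbit_frac_itv (s + m); have := orbit_frac_itv (t + m); lra.
Qed.

Lemma sum_orbit_frac : \sum_(i < P) psi (orbit_frac i) = Sum f psi P q.
Proof. by apply: eq_bigr => i _; rewrite /orbit_frac -intrN psiP. Qed.

Definition block_sum m (w : 'I_P) : R := \sum_(j < m) psi (orbit_frac (w + j)).

Lemma sum_block_sum m : \sum_w block_sum m w = m%:R * Sum f psi P q.
Proof.
have P0 : (0 < P)%N by case: Pq.
rewrite exchange_big /= -[m in RHS]card_ord -sum1_card natr_sum mulr_suml.
apply: eq_bigr => j _; rewrite mul1r -sum_orbit_frac [RHS](reindex_inj (@shift_inj P P0 j)) /=.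
by apply: eq_bigr => w _; rewrite orbit_frac_mod.
Qed.

(** The concatenated blocks jump only at block ends, from position [w i + m] to [w i.+1], where the
    next [m] letters agree. *)
Lemma cycle_of_blocks m k (w : nat -> 'I_P) (theta : R) : (0 < m)%N -> (0 < k)%N ->
  (forall i, block_sum m (w i) <= theta) -> w k = w 0%N ->
  (forall i, forall j, (j < m)%N -> orbit_letter (w i + m + j) = orbit_letter (w i.+1 + j)) ->
  exists p, perpt f (k * m) p /\
    Sum f psi (k * m) p <= k%:R * (theta + K * (C / (mu - 1)) * (C / mu ^+ m)).
Proof.
move=> m0 k0 Hth wk Hw.
pose z l := orbit_frac (w (l %/ m)%N + l %% m).
pose dg l := orbit_digit (w (l %/ m)%N + l %% m).
have [||p [pp Hp]] := @closing_mod (k * m)%N z dg.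
- by rewrite muln_gt0 k0.
- by rewrite /z mulnK // modnMl div0n mod0n wk.
exists p; split=> //; apply: le_trans Hp _.
rewrite mulrDr; apply: lerD.
  rewrite (sum_mul (fun l => psi (z l))) mulr_natl -[k in leRHS]card_ord -sumr_const.
  apply: ler_sum => i _; apply: le_trans (Hth i); rewrite /block_sum.
  rewrite le_eqVlt; apply/orP; left; apply/eqP; apply: eq_bigr => j _.
  by rewrite /z divnMDl // modnMDl modn_small // divn_small ?ltn_ord // addn0.
rewrite [leRHS]mulrCA ler_wpM2l //.
  by rewrite mulr_ge0 // divr_ge0 ?(le_trans ler01 C1) // subr_ge0 ltW.
rewrite (sum_mul (fun l => `|f (z l) - (z l.+1 + (dg l)%:~R)|)) mulr_natl -[k in leRHS]card_ord -sumr_const.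
apply: ler_sum => i _; clear p pp Hth; case: m m0 Hw @z @dg => // m _ Hw z dg.
have zE j : (j < m.+1)%N -> z (i * m.+1 + j)%N = orbit_frac (w i + j) /\
    dg (i * m.+1 + j)%N = orbit_digit (w i + j).
  by move=> jm; rewrite /z /dg divnMDl // modnMDl modn_small // divn_small // addn0.
rewrite big_ord_recr big1 ?add0r /=; last first.
  move=> j _; have jm := ltn_ord j.
  have [-> ->] := zE j (ltnW jm); rewrite -addnS.
  by have [-> _] := zE j.+1 jm; rewrite orbit_frac_step addnS subrr normr0.
have [-> ->] := zE m (ltnSn m).
have -> : z (i * m.+1 + m).+1 = orbit_frac (w i.+1).
  by rewrite /z -addnS -mulSnr mulnK // modnMl addn0.
rewrite orbit_frac_step opprD addrACA subrr addr0 -addnS.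
by rewrite add0r; apply: same_word_close; exact: Hw.
Qed.

(* A cycle of good edges between [m]-words has length at most [18 * M], where
   [M] bounds the information density and costs [mu ^- m] per edge. *)
Lemma cycle_exists m (M : R) : (0 < m)%N -> 1 <= M ->
  \sum_(i : 'I_P) (dense_at (word orbit_letter m) (shift (proj1 Pq) m) M i)%:R <= #|'I_P|%:R / 8 :> R ->
  m%:R * Sum f psi P q * mu ^+ m <= P%:R / (16 * M) ->
  exists k p, [/\ (0 < k)%N, k%:R <= 18 * M, perpt f (k * m) p &
    Sum f psi (k * m) p <= k%:R * ((1 + K * (C / (mu - 1)) * C) / mu ^+ m)].
Proof.
move=> m0 M1 Hdense Hsum; have P0 := proj1 Pq.
have mm : 0 < mu ^+ m by rewrite exprn_gt0.
(* The threshold is the size of one jump; Markov's inequality and [Hsum] leave few blocks above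
   it. *)
pose good := [pred w : 'I_P | block_sum m w <= (mu ^+ m)^-1].
have Hbad : \sum_w (~~ good w)%:R <= #|'I_P|%:R / (16 * M) :> R.
  rewrite card_ord; apply: le_trans Hsum; rewrite -sum_block_sum mulr_suml.
  apply: ler_sum => w _; rewrite /= -ltNge.
  have b0 : 0 <= block_sum m w by rewrite sumr_ge0.
  case: ltP => [h|_]; last by rewrite mulr_ge0 // ltW.
  by rewrite -ler_pdivrMr // div1r ltW.
set g := (Num.truncn (8 * M)).+1.
have Hg : 8 * M < g%:R by rewrite truncnS_gt.
have gM : g%:R <= 9 * M.
  rewrite /g -natr1; have : (Num.truncn (8 * M))%:R <= 8 * M.
    have M80 : 0 <= 8 * M by move: M1; lra.
    by have /andP[] := truncn_itv M80.
  by move: M1; lra.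
have W0 : (0 < #|'I_P|)%N by rewrite card_ord.
have [s /andP[cs /andP[s0 sg]]] := short_cycle M1 W0 (@shift_inj P P0 m) Hdense Hbad Hg.
pose k := size s.
have edge i : exists w : 'I_P, [/\ good w,
    word orbit_letter m w = nth (head (word orbit_letter m (Ordinal P0)) s) s (i %% k) &
    word orbit_letter m (shift P0 m w) = nth (head (word orbit_letter m (Ordinal P0)) s) s (i.+1 %% k)].
  set x0 := head _ s.
  have ik : (i %% k < k)%N by rewrite ltn_mod.
  have := cs; case: s {cs sg} s0 @k @x0 ik => // v s _ k x0 /= ik /(pathP v)/(_ (i %% k)%N).
  rewrite size_rcons ik => /(_ isT)/existsP[w /and3P[gw /eqP w1 /eqP w2]].
  exists w; split=> //.
    rewrite w1; case: (i %% k)%N ik => //= j; rewrite ltnS nth_rcons => js.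
    by rewrite js.
  rewrite w2 nth_rcons.
  have [e|ne] := eqVneq (i %% k)%N (size s).
    have -> : (i.+1 %% k = 0)%N.
      by rewrite -addn1 -modnDml e addn1 modnn.
    by rewrite e ltnn.
  have js : (i %% k < size s)%N by rewrite ltn_neqAle ne -ltnS ik.
  have -> : (i.+1 %% k = (i %% k).+1)%N.
    by rewrite -addn1 -modnDml addn1 modn_small.
  by rewrite js.
have [w Hw] := choice edge.
pose w' i := w (i %% k)%N.
have [|||p [pp Hp]] := @cycle_of_blocks m k w' (mu ^+ m)^-1 m0 s0.
- by move=> i; case: (Hw (i %% k)%N).
- by rewrite /w' modnn mod0n.
- move=> i j jm; have [_ _ e1] := Hw (i %% k)%N; have [_ e2 _] := Hw (i.+1 %% k)%N.
  rewrite modn_mod in e2.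
  have e3 : ((i %% k).+1 %% k = i.+1 %% k)%N by rewrite -addn1 modnDml addn1.
  rewrite e3 -e2 in e1.
  have := congr1 (fun t => tnth t (Ordinal jm)) e1; rewrite !tnth_mktuple /= => <-.
  by rewrite -[LHS](periodic_mod orbit_letterP) -[RHS](periodic_mod orbit_letterP) modnDml.
exists k, p; split=> //.
  have : k%:R <= g.*2%:R :> R by rewrite ler_nat.
  by rewrite -mul2n natrM; lra.
apply: le_trans Hp _; rewrite ler_wpM2l // mulrDl mul1r mulrA.
by rewrite -[_ * C / _]mulrA lexx.
Qed.

End Orbit.

Hypothesis psi_small : forall delta, 0 < delta ->
  exists n p, perpt f n p /\ Sum f psi n p <= n%:R * delta.

(** The cycle has period [k * m] with [k <= 18 * M m], and its sum is at most [k * C3 / mu ^+ m].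
    Since [M m] may have any positive exponential rate, [mu ^- m] wins against every power of the
    period. *)
Lemma superpolynomial_approximation (a : nat) (eta : R) : 0 < eta ->
  exists n p, perpt f n p /\ n%:R ^+ a * Sum f psi n p <= eta.
Proof.
move=> eta0.
pose beta := ln mu.
have beta0 : 0 < beta by rewrite ln_gt0.
(* With this value [M m ^+ a.+1] grows like [expR (beta / 2 * m)], the square root of [mu ^+ m]. *)
pose delta := beta / (16 * a.+1%:R).
have a1 : 0 < 16 * a.+1%:R :> R by rewrite mulr_gt0.
have delta0 : 0 < delta by rewrite divr_gt0.
pose M (m : nat) : R := expR (8 * (delta * m%:R + 1)).
have M1 m : 1 <= M m.
  by rewrite -expR0 ler_expR mulr_ge0 // addr_ge0 // mulr_ge0 // ltW.
pose C3 := 1 + K * (C / (mu - 1)) * C.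
have C30 : 0 < C3.
  rewrite ltr_wpDr // !mulr_ge0 //; last by rewrite (le_trans ler01).
    by rewrite (le_trans ler01).
  by rewrite invr_ge0 subr_ge0 ltW.
pose c := 18 ^+ a.+1 * C3 * expR (8 * a.+1%:R).
have c0 : 0 < c by rewrite !mulr_gt0 ?expR_gt0 ?exprn_gt0.
have b20 : 0 < beta / 2 by rewrite divr_gt0.
have [m0 Hm0] := poly_exp_small a b20 c0 eta0.
pose A := 'I_(digit_bound.*2.+1).
have A0 : (0 < #|A|)%N by rewrite card_ord.
pose nn := (Num.truncn (2 * ln #|A|%:R / delta)).+1.
have Hnn : 2 * ln #|A|%:R < delta * nn%:R.
  by rewrite [ltRHS]mulrC -ltr_pdivrMr //; apply: truncnS_gt.
pose mm := (2 ^ (m0 + nn))%N.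
(* The scale [m] is found only after the orbit, so the average is taken small enough for the largest
   candidate [mm]. *)
pose del := (16 * M mm * mm%:R * mu ^+ mm)^-1.
have mmp : (0 < mm)%N by rewrite expn_gt0.
have Mp m : 0 < M m by rewrite expR_gt0.
have del0 : 0 < del by rewrite invr_gt0 !mulr_gt0 ?exprn_gt0 ?ltr0n.
have [P [q [Pq Hq]]] := psi_small del0.
have P0 := proj1 Pq.
have [j [/andP[j1 j2] Hj]] := @low_information_scale R A P (orbit_letter q) P0
  (orbit_letterP Pq) A0 delta m0 nn delta0 Hnn.
set m := (2 ^ j)%N in Hj.
have mp : (0 < m)%N by rewrite expn_gt0.
have mlt : (m <= mm)%N by rewrite leq_exp2l // ltnW.
have W0 : (0 < #|'I_P|)%N by rewrite card_ord.
have dm0 : 0 <= delta * m%:R by rewrite mulr_ge0 // ltW.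
have Hd := information_dense W0 dm0 Hj.
have mum : 0 < mu ^+ m by rewrite exprn_gt0.
have inv_ge : 16 * M m * m%:R * mu ^+ m <= 16 * M mm * mm%:R * mu ^+ mm.
  have h1 : M m <= M mm.
    by rewrite ler_expR ler_pM2l // lerD2r ler_pM2l // ler_nat.
  have h2 : mu ^+ m <= mu ^+ mm by rewrite ler_weXn2l // ltW.
  rewrite ler_pM ?(ltW mum) ?mulr_ge0 ?(ltW (Mp m)) //.
  by rewrite ler_pM ?mulr_ge0 ?(ltW (Mp m)) ?ler_nat // ler_pM2l.
have Hsum : m%:R * Sum f psi P q * mu ^+ m <= P%:R / (16 * M m).
  rewrite ler_pdivlMr ?mulr_gt0 //.
  have -> : m%:R * Sum f psi P q * mu ^+ m * (16 * M m) =
     Sum f psi P q * (16 * M m * m%:R * mu ^+ m) by ring.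
  have S0 : 0 <= Sum f psi P q by rewrite sumr_ge0.
  apply: (le_trans (ler_wpM2l S0 inv_ge)).
  rewrite -ler_pdivlMr ?mulr_gt0 ?exprn_gt0 ?ltr0n //.
have [k [p [k0 kM pp Hp]]] := @cycle_exists P q Pq m (M m) mp (M1 m) Hd Hsum.
exists (k * m)%N, p; split=> //.
apply: (@le_trans _ _ (c * m%:R ^+ a * expR (- (beta / 2 * m%:R)))); last first.
  by apply: Hm0; apply: leq_trans (leq_trans _ j1) (ltnW (ltn_expl _ _)).
apply: (@le_trans _ _ ((18 * M m) ^+ a.+1 * (m%:R ^+ a * (C3 / mu ^+ m)))).
  apply: (@le_trans _ _ ((k * m)%:R ^+ a * (k%:R * (C3 / mu ^+ m)))).
    by rewrite ler_wpM2l // exprn_ge0.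
  have -> : (k * m)%:R ^+ a * (k%:R * (C3 / mu ^+ m)) =
     k%:R ^+ a.+1 * (m%:R ^+ a * (C3 / mu ^+ m)) by rewrite natrM exprMn exprSr; ring.
  rewrite ler_wpM2r ?mulr_ge0 ?exprn_ge0 ?(ltW C30) ?invr_ge0 ?(ltW mum) //.
  by apply: lerXn2r; rewrite ?nnegrE ?mulr_ge0 ?(ltW (Mp m)).
have -> : (mu ^+ m)^-1 = expR (- (beta * m%:R)).
  rewrite expRN; congr _^-1.
  by rewrite expRM_natr /beta lnK.
rewrite exprMn.
have -> : M m ^+ a.+1 = expR (8 * a.+1%:R) * expR (beta / 2 * m%:R).
  rewrite -expRD /M -expRM_natr; congr expR.
  have aN : a.+1%:R != 0 :> R by rewrite pnatr_eq0.
  by rewrite /delta; move: (a.+1%:R : R) aN => N aN; field.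
have -> : expR (- (beta / 2 * m%:R)) = expR (beta / 2 * m%:R) * expR (- (beta * m%:R)).
  by rewrite -expRD; congr expR; field.
rewrite /c le_eqVlt; apply/orP; left; apply/eqP; ring.
Qed.
End Coding.

(** * Periodic orbits with large gap *)

Section Gap.
Variable R : realType.
Variables (f : R -> R) (d : int) (L mu C : R) (D : R -> R -> R).
Hypothesis Hf : expmap f d L mu C D.
Variables (K : R) (psi : R -> R).
Hypothesis K0 : 0 <= K.
Hypothesis psiL : lipschitz_with K psi.
Hypothesis psiP : int_periodic psi.
Hypothesis psi0 : forall x, 0 <= psi x.

Definition gap_at_least (n : nat) (p gam : R) :=
  forall (i j : nat) (k : int), (i < j)%N -> (j < n)%N ->
    gam <= `|iter i f p - iter j f p - k%:~R|.

Let Sum_ge0 n x : 0 <= Sum f psi n x.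
Proof. exact: sumr_ge0. Qed.

(* Cutting an orbit at a close pair gives two pseudo-orbits, the shorter of
   which has at most half the length; if [n ^ a * s] is small to begin with, a
   constant factor lost on [s] at each step is paid for by the halving of [n]. *)
Lemma gap_descent (eta : R) (a : nat) : 0 < eta ->
  1 + K * (C / (mu - 1)) / eta <= 2 ^+ a ->
  forall n p s, perpt f n p -> 0 < s -> Sum f psi n p <= s -> n%:R ^+ a * s <= eta ->
  exists n p s, [/\ perpt f n p, 0 < s <= eta, Sum f psi n p <= s &
    gap_at_least n p (s / eta)].
Proof.
move=> eta0 Ha n; elim/ltn_ind: n => n IH p s np s0 Hs Hn.
have se : s <= eta.
  apply: le_trans Hn; rewrite ler_peMl ?(ltW s0) // exprn_ege1 // ler1n; by case: np.
have [gap|] := pselect (gap_at_least n p (s / eta)).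
  by exists n, p, s; rewrite s0.
move=> /existsNP[i /existsNP[j /existsNP[k /not_implyP[ij /not_implyP[jn /negP]]]]].
rewrite -ltNge => close.
set A := 1 + K * (C / (mu - 1)) / eta in Ha.
have KC0 : 0 <= K * (C / (mu - 1)).
  by rewrite mulr_ge0 // divr_ge0 ?(le_trans ler01 (em_C_ge1 Hf)) // subr_ge0 ltW // (em_mu Hf).
(* The close pair cuts the period into the arc from [i] to [j] and the arc from [j] around to [i].
   Either ends within [s / eta] of its start modulo 1; the shorter one is kept. *)
have [len [x [k' [l0 l2 Hx Hc]]]] : exists len x (k' : int), [/\ (0 < len)%N, (len.*2 <= n)%N,
    Sum f psi len x <= s & `|iter len f x - (x + k'%:~R)| <= s / eta].
  have [n0 [k0 ek]] := np.
  have [short|long] := leqP (j - i).*2 n.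
    exists (j - i)%N, (iter i f p), (- k); split => //; first by rewrite subn_gt0.
      apply: le_trans Hs; have -> : n = (i + (j - i) + (n - j))%N by lia.
      rewrite !SumD; have := Sum_ge0 i p.
      by have := Sum_ge0 (n - j) (iter (i + (j - i)) f p); lra.
    rewrite -iterD subnK ?(ltnW ij) // intrN; apply: ltW; move: close.
    by rewrite -[X in X < _ -> _]normrN; congr (`| _ | < _); ring.
  exists (n - (j - i))%N, (iter j f p), (k + d ^+ i * k0); split.
  - by lia.
  - by lia.
  - apply: le_trans Hs; have -> : n = (i + (j - i) + (n - j))%N by lia.
    have -> : (i + (j - i) + (n - j) - (j - i) = (n - j) + i)%N by lia.
    rewrite !SumD -!iterD (_ : n - j + j = n)%N; last by lia.
    rewrite ek (Sum_per Hf) // (_ : (i + (j - i)) = j)%N; last by lia.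
    by have := Sum_ge0 (j - i) (iter i f p); lra.
  - rewrite -iterD (_ : n - (j - i) + j = i + n)%N; last by lia.
    rewrite iterD ek (iter_per (em_per Hf)) intrD.
    apply: ltW; move: close; congr (`| _ | < _); ring.
have [p' [pk' Hp']] := closing_orbit Hf x k' K0 psiL l0.
apply: (IH len _ p' (A * s)).
- by lia.
- by split=> //; exists k'.
- by rewrite mulr_gt0 // ltr_wpDr // divr_ge0 // ltW.
- have h : K * (C / (mu - 1)) * `|iter len f x - (x + k'%:~R)| <= K * (C / (mu - 1)) * (s / eta).
    by rewrite ler_wpM2l.
  have -> : A * s = s + K * (C / (mu - 1)) * (s / eta) by rewrite /A; ring.
  by move: Hp'; rewrite ler_norml => /andP[_]; lra.
- apply: le_trans Hn; rewrite mulrA ler_pM2r //.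
  apply: (@le_trans _ _ (len%:R ^+ a * 2 ^+ a)); first by rewrite ler_wpM2l // exprn_ge0.
  by rewrite -exprMn; apply: lerXn2r; rewrite ?nnegrE ?mulr_ge0 // -natrM muln2 ler_nat.
Qed.

Hypothesis psi_small : forall delta, 0 < delta ->
  exists n p, perpt f n p /\ Sum f psi n p <= n%:R * delta.

Lemma good_gap_orbit (eta : R) : 0 < eta ->
  exists n p s, [/\ perpt f n p, 0 < s <= eta, Sum f psi n p <= s &
    gap_at_least n p (s / eta)].
Proof.
move=> eta0.
have h12 : 1 < 2 :> R by rewrite ltr1n.
have [a Ha] := exp_unbounded (1 + K * (C / (mu - 1)) / eta) h12.
have [n [p [np Hp]]] := superpolynomial_approximation Hf K0 psiL psiP psi0 psi_small a (divr_gt0 eta0 (lt_trans ltr01 h12)).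
have n0 : 0 < n%:R ^+ a :> R by rewrite exprn_gt0 // ltr0n; case: np.
(* The sum itself may vanish; the added term keeps [s], and with it the gap [s / eta], positive. *)
apply: (gap_descent eta0 (ltW Ha) np (s := Sum f psi n p + eta / 2 / n%:R ^+ a)).
- by rewrite ltr_wpDl // !divr_gt0.
- by rewrite lerDl !divr_ge0 // ?(ltW eta0) // ltW.
- rewrite mulrDr mulrCA mulfV ?gt_eqF // mulr1; move: Hp; lra.
Qed.
End Gap.

(** * Smooth circle maps *)

Section Smooth.
Variable R : realType.
Implicit Types (f g h : R -> R) (x y : R) (d : int).

Record C2lift (f f1 f2 : R -> R) d : Prop := C2Lift {
  c2_per : forall x, f (x + 1) = f x + d%:~R;
  c2_d1 : forall x, is_derive x 1 f (f1 x);
  c2_d2 : forall x, is_derive x 1 f1 (f2 x);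
  c2_cont : continuous f2 }.

Lemma derive1_fun f (f1 : R -> R) : (forall x, is_derive x 1 f (f1 x)) -> (f^`())%classic = f1.
Proof. by move=> H; apply/funext => x; rewrite derive1E; apply: derive_val. Qed.

Lemma C2lift_E f (f1 f2 : R -> R) d : C2lift f f1 f2 d ->
  [/\ is_C2_circle_lift f, (f^`())%classic = f1 & (f^`(2))%classic = f2].
Proof.
move=> H; have e1 := derive1_fun (c2_d1 H).
have e2 : (f^`(2))%classic = f2 by rewrite /derive1n /= e1; exact: derive1_fun (c2_d2 H).
split=> //; split; first by exists d; exact: c2_per H.
split; first by move=> x; case: (c2_d1 H x).
split; last by rewrite e2; exact: c2_cont H.
by move=> x; rewrite e1; case: (c2_d2 H x).
Qed.

Lemma C2liftP f : is_C2_circle_lift f ->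
  exists d, C2lift f (f^`())%classic (f^`(2))%classic d.
Proof.
move=> [[d dP] [d1 [d2 c2]]]; exists d; split.
- exact: dP.
- by move=> x; apply: DeriveDef; [exact: d1 | rewrite derive1E].
- by move=> x; apply: DeriveDef; [exact: d2 | rewrite -derive1E].
- exact: c2.
Qed.

Lemma is_derive_continuous f (f1 : R -> R) : (forall x, is_derive x 1 f (f1 x)) -> continuous f.
Proof.
move=> H x; apply/differentiable_continuous/derivable1_diffP.
by case: (H x).
Qed.

Lemma mean_value f (f1 : R -> R) : (forall x, is_derive x 1 f (f1 x)) ->
  forall x y, exists c, f x - f y = f1 c * (x - y).
Proof.
move=> H; have lt x y : x < y -> exists c, f y - f x = f1 c * (y - x).
  move=> xy; have [|c _ e] := MVT xy (fun z _ => H z); last by exists c.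
  exact/continuous_subspaceT/(is_derive_continuous H).
move=> x y; case: (ltgtP x y) => [/lt[c e]|/lt[c e]|->].
- by exists c; rewrite -[LHS]opprB e -mulrN opprB.
- by exists c.
- by exists 0; rewrite !subrr mulr0.
Qed.

Lemma lipschitz_of_derive f (f1 : R -> R) (L : R) : (forall x, is_derive x 1 f (f1 x)) ->
  (forall x, `|f1 x| <= L) -> lipschitz_with L f.
Proof.
move=> H HL x y; have [c ->] := mean_value H x y.
by rewrite normrM ler_wpM2r.
Qed.

Lemma expansion_of_derive f (f1 : R -> R) (m : R) : (forall x, is_derive x 1 f (f1 x)) ->
  (forall x, m <= `|f1 x|) -> forall x y, m * `|x - y| <= `|f x - f y|.
Proof.
move=> H HL x y; have [c ->] := mean_value H x y.
by rewrite normrM ler_wpM2r.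
Qed.

Lemma derive_lower_bound f (f1 : R -> R) (m : R) : (forall x, is_derive x 1 f (f1 x)) ->
  (forall x y, m * `|x - y| <= `|f x - f y|) -> forall x, m <= `|f1 x|.
Proof.
move=> H Hm x; have [dx <-] := H x.
have cv : h^-1 *: (f (h *: (1 : R) + x) - f x) @[h --> 0^'] --> 'D_1 f x := dx.
have cn : `|h^-1 *: (f (h *: (1 : R) + x) - f x)| @[h --> 0^'] --> `|'D_1 f x|.
  exact: cvg_norm.
rewrite -(cvg_lim _ cn) //.
apply: limr_ge; first by apply/cvg_ex; exists `|'D_1 f x|; exact: cn.
near=> h; have h0 : h != 0 by near: h; exact: nbhs_dnbhs_neq.
rewrite normrZ normfV ler_pdivlMl ?normr_gt0 // mulrC.
by have := Hm (h *: (1 : R) + x) x; rewrite addrK /GRing.scale /= mulr1.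
Unshelve. all: by end_near. Qed.

Lemma derive1_periodic f (f1 : R -> R) (c : R) : (forall x, is_derive x 1 f (f1 x)) ->
  (forall x, f (x + 1) = f x + c) -> forall x, f1 (x + 1) = f1 x.
Proof.
move=> H fp x.
have h : is_derive x (1 : R) (fun y : R => y + 1) 1.
  have -> : (fun y : R => y + 1) = id + cst 1 by [].
  by rewrite -[X in is_derive _ _ _ X]addr0; exact: is_deriveD.
have h1 : is_derive x (1 : R) (f \o (fun y => y + 1)) (f1 (x + 1) * 1).
  exact: (@is_derive1_comp _ f (fun y => y + 1) x (f1 (x + 1)) 1).
have h2 : is_derive x 1 (f \o (fun y => y + 1)) (f1 x).
  have -> : f \o (fun y => y + 1) = f + cst c by apply/funext => y; rewrite /= fp.
  by rewrite -[X in is_derive _ _ _ X]addr0; apply: is_deriveD; exact: H.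
by have [_ e1] := h1; have [_ e2] := h2; rewrite mulr1 in e1; rewrite -e1 -e2.
Qed.

Lemma nat_periodic (T : Type) (g : R -> T) : (forall x, g (x + 1) = g x) ->
  forall x (k : int), g (x + k%:~R) = g x.
Proof.
move=> gp x k.
have nat_per n y : g (y + n%:R) = g y.
  by elim: n => [|n IH]; rewrite ?addr0 // -natr1 addrA gp IH.
case: k => n; first exact: nat_per.
by have := nat_per n.+1 (x - n.+1%:R); rewrite subrK => ->; rewrite NegzE intrN.
Qed.

Lemma continuous_periodic_bounded g : continuous g -> (forall x, g (x + 1) = g x) ->
  exists2 B, 0 < B & forall x, `|g x| <= B.
Proof.
move=> cg gp.
have cn : {within `[0 : R, 1], continuous (fun x => `|g x|)}.
  by apply: continuous_subspaceT => x; apply: cvg_norm; exact: cg.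
have [c _ Hc] := EVT_max ler01 cn.
exists (`|g c| + 1); first by rewrite ltr_wpDl.
move=> x; have [k kx] := frac_exists x.
have -> : g x = g (x - k%:~R) by rewrite -intrN nat_periodic.
apply: (@le_trans _ _ `|g c|); last by rewrite lerDl.
by apply: Hc; rewrite in_itv /=; lra.
Qed.

Lemma iter_derive f (f1 : R -> R) : (forall x, is_derive x 1 f (f1 x)) ->
  forall n x, is_derive x 1 (iter n f) (\prod_(i < n) f1 (iter i f x)).
Proof.
move=> H; elim=> [|n IH] x; first by rewrite big_ord0; apply: is_derive_id.
rewrite big_ord_recr /= mulrC.
have -> : iter n.+1 f = f \o iter n f by [].
exact: is_derive1_comp.
Qed.

Lemma ln_lipschitz (m a b : R) : 0 < m -> m <= a -> m <= b -> `|ln a - ln b| <= m^-1 * `|a - b|.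
Proof.
move=> m0.
have le u v : m <= u -> m <= v -> ln u - ln v <= m^-1 * `|u - v|.
  move=> mu mv; have u0 := lt_le_trans m0 mu; have v0 := lt_le_trans m0 mv.
  rewrite -ln_div ?posrE //; apply: (le_trans (ln_sub1 (divr_gt0 u0 v0))).
  have -> : u / v - 1 = v^-1 * (u - v) by field; rewrite gt_eqF.
  apply: (@le_trans _ _ (v^-1 * `|u - v|)).
    by rewrite ler_wpM2l ?invr_ge0 ?(ltW v0) // ler_norm.
  by rewrite ler_wpM2r // lef_pV2 ?posrE.
move=> ma mb; rewrite ler_norml le // andbT lerNl opprB distrC; exact: le.
Qed.

(* Mather's adapted metric. *)
Definition Dist f (mu : R) (N : nat) x y : R :=
  \sum_(i < N) `|iter i f x - iter i f y| / mu ^+ i.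

(** Multiplied by [mu], every term of [Dist x y] but the first becomes a term of [Dist (f x) (f y)];
    the first is dominated by the remaining last term, by expansion over [N] steps. *)
Lemma Dist_expmap f d (L mu : R) (N : nat) : (0 < N)%N -> 1 < mu -> 0 <= L ->
  (forall x, f (x + 1) = f x + d%:~R) -> lipschitz_with L f ->
  (forall x y, mu ^+ N * `|x - y| <= `|iter N f x - iter N f y|) ->
  expmap f d L mu (\sum_(i < N) (L / mu) ^+ i) (Dist f mu N).
Proof.
move=> N0 mu1 L0 fp fl fN.
have mu0 : 0 < mu by rewrite (lt_trans ltr01).
have mui i : 0 < mu ^+ i by rewrite exprn_gt0.
have t0 i x y : 0 <= `|iter i f x - iter i f y| / mu ^+ i by rewrite divr_ge0 // ltW.
split => //.
- move=> x y; rewrite /Dist; case: N N0 fN => // N _ _; rewrite big_ord_recl /= divr1.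
  by rewrite lerDl; apply: sumr_ge0 => i _; rewrite divr_ge0 // ltW.
- move=> x y; rewrite mulr_suml; apply: ler_sum => i _.
  rewrite ler_pdivrMr // expr_div_n mulrAC divfK ?gt_eqF //.
  elim: (i : nat) => [|j IH]; first by rewrite mul1r.
  by rewrite /= exprS -mulrA (le_trans (fl _ _)) // ler_wpM2l.
- move=> x y z; rewrite -big_split; apply: ler_sum => i _ /=.
  rewrite -mulrDl ler_wpM2r ?invr_ge0 ?(ltW (mui _)) //.
  by rewrite -[X in X <= _](_ : `|(iter i f x - iter i f y) + (iter i f y - iter i f z)| = _) ?ler_normD // addrA subrK.
- by move=> x y; apply: eq_bigr => i _; rewrite distrC.
- move=> x y k; apply: eq_bigr => i _; rewrite !(iter_per fp); congr (`| _ | / _); ring.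
- move=> x y; rewrite /Dist; case: N N0 fN => // N _ fN.
  rewrite big_ord_recl [leRHS]big_ord_recr /= divr1 mulrDr addrC.
  have -> : mu * \sum_(i < N) `|iter (bump 0 i) f x - iter (bump 0 i) f y| / mu ^+ bump 0 i =
     \sum_(i < N) `|iter i f (f x) - iter i f (f y)| / mu ^+ i.
    rewrite mulr_sumr; apply: eq_bigr => i _; rewrite /bump add1n -!iterSr exprS.
    have m0 : mu != 0 by rewrite gt_eqF.
    have mi : mu ^+ i != 0 by rewrite gt_eqF.
    by field; rewrite m0 mi.
  by rewrite lerD2r ler_pdivlMr // mulrAC -exprS -!iterSr; exact: fN.
Qed.
End Smooth.

(** * Expansion constants valid on a whole C^2 neighbourhood *)

Section Uniform.
Variable R : realType.
Implicit Types (f g h : R -> R) (x y : R) (d : int).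

Lemma bernoulli_sub (t : R) n : 0 <= t <= 1 -> 1 - n%:R * t <= (1 - t) ^+ n.
Proof.
move=> /andP[t0 t1]; elim: n => [|n IH]; first by rewrite mul0r subr0.
have t1' : 0 <= 1 - t by lra.
rewrite exprS; apply: le_trans (ler_wpM2l t1' IH).
have -> : n.+1%:R = n%:R + 1 :> R by rewrite natr1.
have : 0 <= n%:R * t ^+ 2 by rewrite mulr_ge0 // sqr_ge0.
by nra.
Qed.

(** Gives [f], its perturbation and all maps near that the same constants, hence adapted metrics
    with the same [mu] and [C], before any perturbation is chosen. *)
Lemma uniform_expansion f (f1 f2 : R -> R) d : C2lift f f1 f2 d -> expanding f ->
  exists (N : nat) (mu c0 L L2 kap : R),
    [/\ (0 < N)%N, 1 < mu, 0 < c0, 0 < kap & 1 <= L] /\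
    forall h (h1 h2 : R -> R), C2lift h h1 h2 d ->
      (forall x, `|h x - f x| <= kap) -> (forall x, `|h1 x - f1 x| <= kap) ->
      (forall x, `|h2 x - f2 x| <= kap) ->
      [/\ forall x, c0 <= `|h1 x|, forall x, `|h1 x| <= L, forall x, `|h2 x| <= L2 &
          forall x y, mu ^+ N * `|x - y| <= `|iter N h x - iter N h y|].
Proof.
move=> Hf [C [lam [C0 [lam1 Hexp]]]].
have f1p := derive1_periodic (c2_d1 Hf) (c2_per Hf).
have f2p : forall x, f2 (x + 1) = f2 x.
  by apply: (derive1_periodic (c2_d2 Hf) (c := 0)) => x; rewrite addr0.
have [B1 B10 HB1] := continuous_periodic_bounded (is_derive_continuous (c2_d2 Hf)) f1p.
have [B2 B20 HB2] := continuous_periodic_bounded (c2_cont Hf) f2p.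
have prodE n x : C * lam ^+ n.+1 <= \prod_(i < n.+1) `|f1 (iter i f x)|.
  have := Hexp n.+1 x (ltn0Sn n).
  by rewrite (derive1_fun (iter_derive (c2_d1 Hf) n.+1)) normr_prod.
pose c := C * lam; have c_gt0 : 0 < c by rewrite mulr_gt0 // (lt_trans ltr01).
have f1c x : c <= `|f1 x|.
  by have := prodE 0%N x; rewrite big_ord_recl big_ord0 mulr1.
pose mu := (1 + lam) / 2.
have mu1 : 1 < mu by rewrite /mu; lra.
have mu0 : 0 < mu by lra.
have mulam : 1 < lam / mu by rewrite ltr_pdivlMr // /mu; lra.
have [N0 HN0] := exp_unbounded (2 / C) mulam.
pose N := N0.+1.
(* The factor 2 pays for the loss [(1 - kap * G) ^+ N >= 1 / 2] below. *)
have HN : 2 * mu ^+ N <= C * lam ^+ N.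
  have : 2 / C <= (lam / mu) ^+ N.
    by apply: le_trans (ltW HN0) _; rewrite ler_weXn2l // ltW.
  rewrite ler_pdivrMr // expr_div_n mulrAC ler_pdivlMr ?exprn_gt0 //; lra.
(* After [n] steps the orbits of [x] under [h] and [f] are at most [kap * E n] apart. *)
pose E := fix E n : R := if n is m.+1 then 1 + B1 * E m else 0.
have E0 n : 0 <= E n.
  by elim: n => [|n IH]; [exact: lexx | rewrite /= addr_ge0 // mulr_ge0 // ltW].
have EB n : 0 <= 1 + B2 * E n by rewrite addr_ge0 // mulr_ge0 // ltW.
(* [kap * G] bounds the relative error of [h1] against [f1] at each of the first [N] points. *)
pose G := \sum_(i < N) (1 + B2 * E i) / c.
have G0 : 0 <= G by apply: sumr_ge0 => i _; rewrite divr_ge0 ?(ltW c_gt0).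
have HG (i : 'I_N) : 1 + B2 * E i <= G * c.
  rewrite -ler_pdivrMr // /G (bigD1 i) //= lerDl sumr_ge0 // => j _.
  by rewrite divr_ge0 ?(ltW c_gt0).
pose kap := Num.min (Num.min 1 (c / 2)) (2 * N%:R * (G + 1))^-1.
have NG : 0 < 2 * N%:R * (G + 1) by rewrite !mulr_gt0 // ltr_wpDl.
have kap0 : 0 < kap by rewrite !lt_min ltr01 invr_gt0 NG divr_gt0.
have kap1 : kap <= 1 by rewrite /kap !ge_min lexx.
have kapc : kap <= c / 2 by rewrite /kap !ge_min lexx orbT.
have kapG : N%:R * (kap * G) <= 1 / 2.
  have : kap <= (2 * N%:R * (G + 1))^-1 by rewrite /kap !ge_min lexx !orbT.
  rewrite -[_^-1]div1r ler_pdivlMr // => h.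
  have : 0 <= kap * N%:R by rewrite mulr_ge0 // ltW.
  by nra.
exists N, mu, (c / 2), (B1 + 1), (B2 + 1), kap.
split; first by split; rewrite ?divr_gt0 ?lerDr ?(ltW B10).
move=> h h1 h2 Hh H0 H1 H2; split.
- move=> x; have := H1 x; have := f1c x; have := ler_distD (h1 x) (f1 x) 0.
  by rewrite !subr0 [`|f1 x - _|]distrC; lra.
- move=> x; have := H1 x; have := HB1 x; have := ler_distD (f1 x) (h1 x) 0.
  by rewrite !subr0; lra.
- move=> x; have := H2 x; have := HB2 x; have := ler_distD (f2 x) (h2 x) 0.
  by rewrite !subr0; lra.
apply: (expansion_of_derive (iter_derive (c2_d1 Hh) N)) => x.
have dist n : `|iter n h x - iter n f x| <= kap * E n.
  elim: n => [|n IH]; first by rewrite subrr normr0 mulr0.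
  rewrite /= ; apply: le_trans (ler_distD (f (iter n h x)) _ _) _.
  have h3 := lipschitz_of_derive (c2_d1 Hf) HB1 (iter n h x) (iter n f x).
  have : B1 * `|iter n h x - iter n f x| <= B1 * (kap * E n) by rewrite ler_pM2l.
  by have := H0 (iter n h x); lra.
have tG : 0 <= kap * G <= 1.
  rewrite mulr_ge0 ?(ltW kap0) //=.
  have : kap * G <= N%:R * (kap * G) by rewrite ler_peMl ?mulr_ge0 ?(ltW kap0) // ler1n.
  by lra.
rewrite normr_prod.
apply: (@le_trans _ _ (\prod_(i < N) (`|f1 (iter i f x)| * (1 - kap * G)))).
  rewrite big_split /= prodr_const card_ord.
  have bern := bernoulli_sub N tG.
  apply: (@le_trans _ _ (2 * mu ^+ N * (1 - kap * G) ^+ N)).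
    rewrite mulrAC ler_peMl ?exprn_ge0 ?(ltW mu0) //; lra.
  rewrite ler_wpM2r ?exprn_ge0 //; first by lra.
  exact: le_trans HN (prodE N0 x).
apply: ler_prod => i _; rewrite mulr_ge0 //=; last by lra.
have hh : `|f1 (iter i h x) - f1 (iter i f x)| <= B2 * (kap * E i).
  by apply: le_trans (lipschitz_of_derive (c2_d2 Hf) HB2 _ _) _; rewrite ler_pM2l.
have h4 := H1 (iter i h x).
have h5 : kap * (1 + B2 * E i) <= kap * (G * c) by rewrite ler_pM2l.
have h6 : kap * G * c <= kap * G * `|f1 (iter i f x)|.
  by rewrite ler_wpM2l // mulr_ge0 // ltW.
have h7 : `|f1 (iter i f x)| <= `|f1 (iter i h x) - f1 (iter i f x)| +
   `|h1 (iter i h x) - f1 (iter i h x)| + `|h1 (iter i h x)|.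
  have := ler_distD (f1 (iter i h x)) (f1 (iter i f x)) 0.
  have := ler_distD (h1 (iter i h x)) (f1 (iter i h x)) 0.
  rewrite !subr0 [`|f1 (iter i f x) - _|]distrC [`|f1 (iter i h x) - h1 _|]distrC; lra.
by lra.
Qed.

Definition log_deriv (f1 : R -> R) (x : R) : R := ln `|f1 x|.

Lemma log_deriv_lip (h1 h2 : R -> R) (c0 L2 : R) : 0 < c0 -> (forall x, is_derive x 1 h1 (h2 x)) ->
  (forall x, c0 <= `|h1 x|) -> (forall x, `|h2 x| <= L2) ->
  lipschitz_with (c0^-1 * L2) (log_deriv h1).
Proof.
move=> c00 H2 Hc HL x y; apply: le_trans (ln_lipschitz c00 (Hc x) (Hc y)) _.
rewrite -mulrA ler_wpM2l ?invr_ge0 ?(ltW c00) //.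
apply: le_trans (ler_dist_dist _ _) _.
exact: lipschitz_of_derive H2 HL x y.
Qed.

Lemma expmap_expanding h (h1 : R -> R) d (L mu C : R) (D : R -> R -> R) :
  (forall x, is_derive x 1 h (h1 x)) -> expmap h d L mu C D -> expanding h.
Proof.
move=> H1 Hh; have C1 := em_C_ge1 Hh.
exists C^-1, mu; rewrite invr_gt0 (lt_le_trans ltr01 C1); split=> //.
split; first exact: em_mu Hh.
move=> n x _; rewrite (derive1_fun (iter_derive H1 n)).
apply: (derive_lower_bound (iter_derive H1 n)) => {}x y.
rewrite -mulrA ler_pdivrMl ?(lt_le_trans ltr01 C1) //.
apply: le_trans (em_le Hh _ _); apply: le_trans (iter_exp Hh _ _ _).
rewrite ler_wpM2l ?(em_ge Hh) // exprn_ge0 // ltW // (lt_trans ltr01) //.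
exact: em_mu Hh.
Qed.
End Uniform.

(** * The perturbation *)

Section Bump.
Variable R : realType.
Implicit Types (x y t : R).

Lemma is_derive_quadratic (g : R -> R) x (a M : R) :
  (forall y, `|y - x| <= 1 -> `|g y - g x - a * (y - x)| <= M * (y - x) ^+ 2) ->
  is_derive x 1 g a.
Proof.
move=> H.
have cv : h^-1 *: (g (h *: (1 : R) + x) - g x) @[h --> 0^'] --> a.
  apply/cvgrPdist_le => e e0.
  have M0 : 0 < `|M| + 1 by rewrite ltr_wpDl.
  near=> h.
  have h0 : h != 0 by near: h; exact: nbhs_dnbhs_neq.
  have h1 : `|h| <= 1.
    by near: h; apply: dnbhs0_le.
  have h2 : `|h| <= e / (`|M| + 1).
    by near: h; apply: dnbhs0_le; rewrite divr_gt0.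
  have := H (h + x); rewrite addrK => /(_ h1) Hh.
  rewrite /GRing.scale /= mulr1 distrC.
  have -> : h^-1 * (g (h + x) - g x) - a = h^-1 * (g (h + x) - g x - a * h) by field.
  rewrite normrM normfV ler_pdivrMl ?normr_gt0 //; apply: le_trans Hh _.
  rewrite -real_normK ?num_real // expr2 [`|h| * e]mulrC mulrA ler_wpM2r //.
  rewrite ler_pdivlMr // in h2; apply: le_trans h2; rewrite mulrC ler_wpM2l //.
  by rewrite (le_trans (ler_norm _)) // lerDl.
apply: DeriveDef; last by rewrite /derive; exact: cvg_lim cv.
by apply/cvg_ex; exists a.
Unshelve. all: by end_near. Qed.

Definition pos (t : R) : R := Num.max t 0.

Lemma pos_ge0 t : 0 <= pos t. Proof. by rewrite le_max lexx orbT. Qed.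

Lemma is_derive_pos2 x : is_derive x 1 (fun y => pos y ^+ 2) (2 * pos x).
Proof.
apply: (@is_derive_quadratic _ _ _ 1) => y _; rewrite mul1r /pos ler_norml.
have s1 := sqr_ge0 (y - x); have s2 := sqr_ge0 x; have s3 := sqr_ge0 y.
case: (lerP x 0) => hx; case: (lerP y 0) => hy.
- by apply/andP; split; lra.
- have h : 0 <= y * - x by rewrite mulr_ge0 ?oppr_ge0 // ltW.
  apply/andP; split; lra.
- have h : 0 <= x * - y by rewrite mulr_ge0 ?oppr_ge0 // ltW.
  apply/andP; split; lra.
- by apply/andP; split; lra.
Qed.

Lemma is_derive_pos3 x : is_derive x 1 (fun y => pos y ^+ 3) (3 * pos x ^+ 2).
Proof.
apply: (@is_derive_quadratic _ _ _ (3 * `|x| + 1)) => y; rewrite /pos !ler_norml => /andP[h1 h2].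
case: (lerP x 0) => hx; case: (lerP y 0) => hy.
- by rewrite !expr0n /=; have := sqr_ge0 (y - x); have := normr_ge0 x => ? ?; apply/andP; split; nra.
- rewrite (ler0_norm hx).
  have : 0 <= (y - x) ^+ 2 - y ^+ 2 by nra.
  have : 0 <= 1 - y by lra.
  have : 0 <= y ^+ 2 by nra.
  move=> a b e; have := mulr_ge0 a b; have : 0 <= y ^+ 3 by rewrite exprn_ge0 // ltW.
  by move=> *; apply/andP; split; nra.
- rewrite (gtr0_norm hx).
  have a : 0 <= - y by lra.
  have b : 0 <= x ^+ 2 * - y by rewrite mulr_ge0 // sqr_ge0.
  have e : 0 <= x * y ^+ 2 by rewrite mulr_ge0 ?sqr_ge0 ?ltW.
  have k : 0 <= x ^+ 3 by rewrite exprn_ge0 // ltW.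
  by apply/andP; split; nra.
- rewrite (gtr0_norm hx).
  have -> : y ^+ 3 - x ^+ 3 - 3 * x ^+ 2 * (y - x) = (y + 2 * x) * (y - x) ^+ 2 by ring.
  have := sqr_ge0 (y - x) => s.
  by apply/andP; split; [rewrite -mulNr|]; apply: ler_wpM2r => //; lra.
Qed.

Section Local.
Variables (c rho : R).
Hypotheses (c0 : 0 < c) (rho0 : 0 < rho).

(** Odd, of slope [- c] at 0, vanishing outside ]- rho, rho[; the cube is the least power that makes
    it C^2 at the ends. *)
Definition bump t : R := - c * (t * pos (1 - (t / rho) ^+ 2) ^+ 3).
Definition bump1 t : R := - c * (pos (1 - (t / rho) ^+ 2) ^+ 2 * (1 - 7 * (t / rho) ^+ 2)).
Definition bump2 t : R := 6 * c / rho ^+ 2 * (t * (pos (1 - (t / rho) ^+ 2) * (3 - 7 * (t / rho) ^+ 2))).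

Lemma pos_out t : rho <= `|t| -> pos (1 - (t / rho) ^+ 2) = 0.
Proof.
move=> h; apply: max_r; rewrite subr_le0 -real_normK ?num_real // exprn_ege1 //.
by rewrite normrM normfV (gtr0_norm rho0) ler_pdivlMr // mul1r.
Qed.

Lemma pos_le1 t : pos (1 - (t / rho) ^+ 2) <= 1.
Proof. by rewrite ge_max ler01 andbT gerBl sqr_ge0. Qed.

Lemma bump_out t : rho <= `|t| -> bump t = 0.
Proof. by move=> h; rewrite /bump pos_out // expr0n /= !mulr0. Qed.

Lemma bump1_out t : rho <= `|t| -> bump1 t = 0.
Proof. by move=> h; rewrite /bump1 pos_out // expr0n /= mul0r mulr0. Qed.

Lemma bump2_out t : rho <= `|t| -> bump2 t = 0.
Proof. by move=> h; rewrite /bump2 pos_out // mul0r !mulr0. Qed.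

Lemma bump_le t : `|bump t| <= c * `|t|.
Proof.
rewrite /bump normrM normrN (gtr0_norm c0) ler_pM2l // normrM ler_piMr //.
by rewrite ger0_norm ?exprn_ge0 ?exprn_ile1 ?pos_ge0 ?pos_le1.
Qed.

Lemma bump_bound t : `|bump t| <= c * rho.
Proof.
case: (lerP rho `|t|) => h; first by rewrite bump_out // normr0 mulr_ge0 // ltW.
by apply: le_trans (bump_le t) _; rewrite ler_pM2l // ltW.
Qed.

Lemma sq_lt1 t : `|t| < rho -> 0 <= (t / rho) ^+ 2 <= 1.
Proof.
move=> h; rewrite sqr_ge0 /= -real_normK ?num_real // exprn_ile1 //.
by rewrite normrM normfV (gtr0_norm rho0) ler_pdivrMr // mul1r ltW.
Qed.

Lemma bump1_bound t : `|bump1 t| <= 6 * c.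
Proof.
case: (lerP rho `|t|) => h; first by rewrite bump1_out // normr0 mulr_ge0 // ltW.
rewrite /bump1 normrM normrN (gtr0_norm c0) mulrC ler_pM2r // normrM.
have /andP[y0 y1] := sq_lt1 h; rewrite -[leRHS]mul1r ler_pM //.
  by rewrite ger0_norm ?exprn_ge0 ?exprn_ile1 ?pos_ge0 ?pos_le1.
by rewrite ler_norml; apply/andP; split; lra.
Qed.

Lemma bump2_bound t : `|bump2 t| <= 24 * (c / rho).
Proof.
have cr : 0 <= c / rho by rewrite divr_ge0 // ltW.
case: (lerP rho `|t|) => h; first by rewrite bump2_out // normr0 mulr_ge0.
have /andP[y0 y1] := sq_lt1 h.
have -> : bump2 t = 6 * (c / rho) * ((t / rho) * (pos (1 - (t / rho) ^+ 2) * (3 - 7 * (t / rho) ^+ 2))).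
  by rewrite /bump2; field; rewrite gt_eqF.
have -> : 24 * (c / rho) = 6 * (c / rho) * 4 by ring.
have cr6 : 0 <= 6 * (c / rho) by rewrite mulr_ge0.
rewrite normrM (ger0_norm cr6); apply: ler_wpM2l => //.
rewrite normrM -[leRHS]mul1r ler_pM //.
  by rewrite normrM normfV (gtr0_norm rho0) ler_pdivrMr // mul1r ltW.
rewrite normrM -[leRHS]mul1r ler_pM //.
  by rewrite ger0_norm ?pos_ge0 ?pos_le1.
by rewrite ler_norml; apply/andP; split; lra.
Qed.

(** The slope recovers from [- c] at least quadratically in [t / rho]: with [y] the square of
    [t / rho], [(1 - y) ^+ 2 * (1 - 7 * y) <= 1 - y] on [0,1]. *)
Lemma bump1_lower t (z : R) : 0 <= z <= 1 -> z <= (t / rho) ^+ 2 -> - c * (1 - z) <= bump1 t.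
Proof.
move=> /andP[z0 z1] zt.
case: (lerP rho `|t|) => h; first by rewrite bump1_out // mulNr oppr_le0 mulr_ge0 ?(ltW c0) //; lra.
have /andP[y0 y1] := sq_lt1 h.
rewrite /bump1 ler_nM2l ?oppr_lt0 // /pos max_l; last by lra.
move: ((t / rho) ^+ 2) zt y0 y1 => y zy y0 y1.
have : 0 <= (1 - y) * y * (8 - 7 * y) by rewrite !mulr_ge0 //; lra.
have -> : (1 - y) * y * (8 - 7 * y) = (1 - y) - (1 - y) ^+ 2 * (1 - 7 * y) by ring.
lra.
Qed.

Lemma bump0 : bump 0 = 0. Proof. by rewrite /bump mul0r mulr0. Qed.

Lemma bump10 : bump1 0 = - c.
Proof.
rewrite /bump1 mul0r expr0n /= mulr0 !subr0 mulr1 /pos max_l ?ler01 //.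
by rewrite expr1n mulr1.
Qed.

Let P t : R := 1 - (t / rho) ^+ 2.

Let is_derive_P t : is_derive t 1 P (- (2 * t / rho ^+ 2)).
Proof.
apply: (@is_derive_quadratic _ _ _ (rho ^+ 2)^-1) => y _.
have -> : P y - P t - - (2 * t / rho ^+ 2) * (y - t) = - ((rho ^+ 2)^-1 * (y - t) ^+ 2).
  by rewrite /P; field; rewrite gt_eqF.
by rewrite normrN ger0_norm // mulr_ge0 ?sqr_ge0 // invr_ge0 sqr_ge0.
Qed.

Lemma is_derive_mul (u v : R -> R) t (a b e : R) : is_derive t 1 u a -> is_derive t 1 v b ->
  e = u t * b + v t * a -> is_derive t 1 (fun s => u s * v s) e.
Proof. by move=> hu hv ->; exact: is_deriveM. Qed.

Lemma is_derive_chain (u v : R -> R) t (a b e : R) : is_derive (v t) 1 u a -> is_derive t 1 v b ->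
  e = a * b -> is_derive t 1 (fun s => u (v s)) e.
Proof. by move=> hu hv ->; exact: is_derive1_comp. Qed.

Let is_derive_cst' t (a : R) : is_derive t 1 (fun=> a) 0.
Proof. exact: is_derive_cst. Qed.

Let is_derive_id' t : is_derive t 1 (fun s : R => s) 1.
Proof. exact: is_derive_id. Qed.

Lemma is_derive_bump t : is_derive t 1 bump (bump1 t).
Proof.
have h3 := is_derive_chain (is_derive_pos3 (P t)) (is_derive_P t) erefl.
have h4 := is_derive_mul (is_derive_id' t) h3 erefl.
apply: (is_derive_mul (is_derive_cst' t (- c)) h4).
rewrite mulr0 addr0 /bump1 -/(P t); congr (_ * _).
have -> : pos (P t) ^+ 3 = pos (P t) ^+ 2 * P t.
  rewrite exprSr; case: (lerP (P t) 0) => h; first by rewrite /pos max_r // expr0n /= !mul0r.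
  by rewrite /pos max_l // ltW.
by rewrite /P; field; rewrite gt_eqF.
Qed.

Lemma is_derive_bump1 t : is_derive t 1 bump1 (bump2 t).
Proof.
have h2 := is_derive_chain (is_derive_pos2 (P t)) (is_derive_P t) erefl.
have h7 : is_derive t 1 (fun s => 1 - 7 * (s / rho) ^+ 2) (- (14 * t / rho ^+ 2)).
  have -> : (fun s => 1 - 7 * (s / rho) ^+ 2) = (fun s => 7 * P s + -6).
    by apply/funext => s; rewrite /P; ring.
  have h := is_derive_mul (is_derive_cst' t 7) (is_derive_P t) erefl.
  have := is_deriveD h (is_derive_cst' t (-6)).
  by rewrite mulr0 !addr0 (_ : 7 * _ = - (14 * t / rho ^+ 2)) //; field; rewrite gt_eqF.
have h4 := is_derive_mul h2 h7 erefl.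
apply: (is_derive_mul (is_derive_cst' t (- c)) h4).
rewrite mulr0 addr0 /bump2 -/(P t).
have -> : pos (P t) ^+ 2 = pos (P t) * P t.
  rewrite expr2; case: (lerP (P t) 0) => h; first by rewrite /pos max_r // !mul0r.
  by rewrite /pos max_l // ltW.
by rewrite /P; field; rewrite gt_eqF.
Qed.

Lemma bump2_continuous : continuous bump2.
Proof.
have cP : continuous P by apply: is_derive_continuous is_derive_P.
have cpos : continuous pos.
  apply: (@lipschitz_continuous _ 1) => x y; rewrite mul1r /pos ler_norml.
  have := ler_norm (x - y); have := ler_norm (y - x); rewrite distrC.
  by case: (lerP x 0) => hx; case: (lerP y 0) => hy h1 h2; apply/andP; split; lra.
have cq : continuous (fun t => 3 - 7 * (t / rho) ^+ 2).
  have -> : (fun s => 3 - 7 * (s / rho) ^+ 2) = (fun s => 7 * P s + -4).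
    by apply/funext => s; rewrite /P; ring.
  by move=> t; apply: cvgD; [apply: cvgMr; exact: cP | exact: cvg_cst].
move=> t; apply: cvgMr; apply: cvgM; first exact: cvg_id.
apply: cvgM; last exact: cq.
by apply: (continuous_comp (cP t)); exact: cpos.
Qed.

End Local.
End Bump.

(** * Copies of a bump around all points of a separated set *)

Section Spread.
Variable R : realType.
Implicit Types (x t : R).
Variables (O : set R) (gam rho : R).
Hypothesis sep : forall p q, O p -> O q -> p <> q -> gam <= `|p - q|.
Hypothesis shiftO : forall p (k : int), O p -> O (p + k%:~R).
Hypothesis rho0 : 0 < rho.
Hypothesis rhogam : 4 * rho <= gam.

(* Far from [O] the value is chosen so that [x - nearest x] lies outside the
   support of functions supported in ]- rho, rho[. *)
Definition nearest (x : R) : R :=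
  match pselect (exists p, O p /\ `|x - p| < gam / 2) with
  | left e => projT1 (cid e)
  | right _ => x - rho
  end.

Lemma nearest_in p x : O p -> `|x - p| < gam / 2 -> nearest x = p.
Proof.
move=> Op xp; rewrite /nearest; case: pselect => [e|]; last by case; exists p.
case: (cid e) => q /= [Oq xq]; apply: contrapT => qp.
have := sep Oq Op qp; have := ler_distD x q p; rewrite [`|q - x|]distrC; move: xp xq; lra.
Qed.

Lemma nearestP x : O (nearest x) \/ nearest x = x - rho.
Proof.
rewrite /nearest; case: pselect => [e|]; last by right.
by left; case: (cid e) => q /= [].
Qed.

Lemma far_nearest x : (forall p, O p -> rho <= `|x - p|) -> rho <= `|x - nearest x|.
Proof.
move=> H; case: (nearestP x) => [/H//|->].
by rewrite opprB addrCA subrr addr0 ger0_norm // ltW.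
Qed.

Lemma nearest_shift x (k : int) : x + k%:~R - nearest (x + k%:~R) = x - nearest x.
Proof.
have [[p [Op xp]]|ne] := pselect (exists p, O p /\ `|x - p| < gam / 2).
  rewrite (nearest_in Op xp) (nearest_in (shiftO k Op)) //; first by ring.
  by rewrite opprD addrACA subrr addr0.
rewrite /nearest; case: pselect => [[p [Op xp]]|_].
  case: ne; exists (p - k%:~R); split; first by rewrite -intrN; exact: shiftO.
  by rewrite opprB addrA.
by case: pselect => // _; ring.
Qed.

Lemma near_dist (x0 del : R) (P : set R) : 0 < del -> (forall x, `|x - x0| < del -> P x) ->
  \forall x \near x0, P x.
Proof.
move=> d0 H; apply/nbhs_ballP; exists del => //= y.
by rewrite /ball /= distrC; exact: H.
Qed.

(** Near any point a spread function is either one translate of the bump or identically 0, so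
    smoothness passes to it. *)
Lemma nearest_local (x0 : R) :
  (exists2 p, O p & \forall x \near x0, nearest x = p) \/
  (\forall x \near x0, rho <= `|x - nearest x|).
Proof.
have [[p [Op xp]]|ne] := pselect (exists p, O p /\ `|x0 - p| < gam / 2).
  left; exists p => //; apply: (near_dist (del := gam / 2 - `|x0 - p|)); first by rewrite subr_gt0.
  move=> x hx; apply: nearest_in => //.
  by apply: le_lt_trans (ler_distD x0 _ _) _; lra.
right; apply: (near_dist (del := rho)) => // x hx; apply: far_nearest => p Op.
rewrite leNgt; apply/negP => xp; apply: ne; exists p; split=> //.
have := ler_distD x x0 p; rewrite [`|x0 - x|]distrC; move: rhogam hx xp; lra.
Qed.

Definition spread (b : R -> R) (x : R) : R := b (x - nearest x).

Lemma spread_shift b x (k : int) : spread b (x + k%:~R) = spread b x.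
Proof. by rewrite /spread nearest_shift. Qed.

Lemma spread_at b p : O p -> spread b p = b 0.
Proof.
move=> Op; rewrite /spread (nearest_in Op) subrr // normr0.
by move: rho0 rhogam; lra.
Qed.

Lemma spread_is_derive (b b1 : R -> R) : (forall t, is_derive t 1 b (b1 t)) ->
  (forall t, rho <= `|t| -> b t = 0) -> (forall t, rho <= `|t| -> b1 t = 0) ->
  forall x, is_derive x 1 (spread b) (spread b1 x).
Proof.
move=> Hb b0 b10 x.
case: (nearest_local x) => [[p Op Hp]|Hp].
  have e : spread b1 x = b1 (x - p) by rewrite /spread (nbhs_singleton Hp).
  apply: (@near_eq_is_derive _ _ _ (fun y => b (y - p))).
    by apply: filterS Hp => y; rewrite /spread => ->.
  apply: (@is_derive_chain R b (fun y => y - p) x (b1 (x - p)) 1 _ (Hb (x - p))); last by rewrite e mulr1.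
  have -> : (fun y : R => y - p) = id + cst (- p) by [].
  by rewrite -[X in is_derive _ _ _ X]addr0; exact: is_deriveD.
apply: (@near_eq_is_derive _ _ _ (cst 0)).
  by apply: filterS Hp => y /b0; rewrite /spread => ->.
by rewrite /spread b10 ?(nbhs_singleton Hp) //; exact: is_derive_cst.
Qed.

Lemma spread_continuous (b : R -> R) : continuous b ->
  (forall t, rho <= `|t| -> b t = 0) -> continuous (spread b).
Proof.
move=> cb b0 x.
case: (nearest_local x) => [[p Op Hp]|Hp].
  rewrite /continuous_at /spread (nbhs_singleton Hp).
  apply: (@cvg_trans _ (b (y - p) @[y --> x])).
    by apply: near_eq_cvg; apply: filterS Hp => y ->.
  apply: (@continuous_comp _ _ _ (fun y : R => y - p) b); last exact: cb.
  by apply: cvgB; [exact: cvg_id | exact: cvg_cst].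
rewrite /continuous_at /spread b0 ?(nbhs_singleton Hp) //.
have h : (fun _ : R => 0 : R) y @[y --> x] --> (0 : R) by exact: cvg_cst.
apply: cvg_trans h.
by apply: near_eq_cvg; apply: filterS Hp => y /b0 ->.
Qed.
End Spread.

(** * The perturbed map and its C^2 distance to [f] *)

Section Perturbation.
Variable R : realType.
Variables (O : set R) (gam rho c : R).
Hypothesis sep : forall p q, O p -> O q -> p <> q -> gam <= `|p - q|.
Hypothesis shiftO : forall p (k : int), O p -> O (p + k%:~R).
Hypothesis rho0 : 0 < rho.
Hypothesis rhogam : 4 * rho <= gam.
Hypothesis c0 : 0 < c.

Let W := spread O gam rho (bump c rho).
Let W1 := spread O gam rho (bump1 c rho).
Let W2 := spread O gam rho (bump2 c rho).

Variables (f f1 f2 : R -> R) (d : int) (L L2 : R).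
Hypothesis Hf : C2lift f f1 f2 d.
Hypothesis HL : forall x, `|f1 x| <= L.
Hypothesis HL2 : forall x, `|f2 x| <= L2.

Definition perturb (x : R) : R := f x + W (f x).
Definition perturb1 (x : R) : R := f1 x * (1 + W1 (f x)).
Definition perturb2 (x : R) : R := f1 x * (f1 x * W2 (f x)) + (1 + W1 (f x)) * f2 x.

Lemma perturb_C2lift : C2lift perturb perturb1 perturb2 d.
Proof.
have dW : forall x : R, is_derive x 1 W (W1 x).
  apply: (spread_is_derive sep rho0 rhogam (@is_derive_bump R c rho rho0)).
    exact: bump_out.
  exact: bump1_out.
have dW1 : forall x : R, is_derive x 1 W1 (W2 x).
  apply: (spread_is_derive sep rho0 rhogam (@is_derive_bump1 R c rho rho0)).
    exact: bump1_out.
  exact: bump2_out.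
have cW2 : continuous W2.
  apply: (spread_continuous sep rho0 rhogam (@bump2_continuous R c rho rho0)).
  exact: bump2_out.
have df := c2_d1 Hf; have df1 := c2_d2 Hf; have cf := is_derive_continuous df.
have cf1 := is_derive_continuous df1; have cf2 := c2_cont Hf.
have cW1 := is_derive_continuous dW1.
have dWf x := @is_derive_chain R W f x _ _ _ (dW (f x)) (df x) erefl.
have dW1f x := @is_derive_chain R W1 f x _ _ _ (dW1 (f x)) (df x) erefl.
split.
- move=> x; rewrite /perturb (c2_per Hf) /W spread_shift //; ring.
- move=> x; have := is_deriveD (df x) (dWf x).
  by rewrite /perturb1 mulrDr mulr1 [W1 _ * _]mulrC.
- move=> x; have h := is_deriveD (is_derive_cst (1 : R) x 1) (dW1f x).
  apply: (is_derive_mul (df1 x) h).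
  by rewrite /perturb2 /= add0r [W2 _ * _]mulrC.
- move=> x; apply: cvgD; apply: cvgM.
  + exact: cf1.
  + apply: cvgM; first exact: cf1.
    by apply: (continuous_comp (cf x)); exact: cW2.
  + apply: cvgD; first exact: cvg_cst.
    by apply: (continuous_comp (cf x)); exact: cW1.
  + exact: cf2.
Qed.

Let L0 : 0 <= L. Proof. exact: le_trans (HL 0). Qed.

Lemma perturb_dist x : `|perturb x - f x| <= c * rho.
Proof. by rewrite /perturb addrAC subrr add0r; exact: bump_bound. Qed.

Lemma perturb1_dist x : `|perturb1 x - f1 x| <= 6 * c * L.
Proof.
rewrite /perturb1 mulrDr mulr1 addrAC subrr add0r normrM mulrC ler_pM //.
exact: bump1_bound.
Qed.

Lemma perturb2_dist x : `|perturb2 x - f2 x| <= 24 * (c / rho) * L ^+ 2 + 6 * c * L2.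
Proof.
have -> : perturb2 x - f2 x = W2 (f x) * f1 x ^+ 2 + W1 (f x) * f2 x by rewrite /perturb2; ring.
apply: le_trans (ler_normD _ _) _; rewrite [`|W2 _ * _|]normrM [`|W1 _ * _|]normrM; apply: lerD; apply: ler_pM => //.
- exact: bump2_bound.
- by rewrite normrX lerXn2r ?nnegrE.
- exact: bump1_bound.
Qed.

Lemma perturb_fixed x : O (f x) -> perturb x = f x /\ perturb1 x = f1 x * (1 - c).
Proof.
move=> Ofx; rewrite /perturb /perturb1 /W /W1 !(spread_at sep rho0 rhogam) //.
by rewrite bump0 bump10 // addr0.
Qed.

End Perturbation.

(** * The dominating potential *)

Section Domination.
Variable R : realType.
Variables (T : R -> R) (d : int) (L mu C : R) (D : R -> R -> R).
Hypothesis HT : expmap T d L mu C D.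
Variables (F : R -> R) (K : R) (O : set R).
Hypothesis K0 : 0 <= K.
Hypothesis FL : lipschitz_with K F.
Hypothesis OT : forall q, O q -> O (T q).

Section Transfer.
Variables (n : nat) (sigma : R).
Hypothesis n0 : (0 < n)%N.
Hypothesis FP : int_periodic F.
Hypothesis Oper : forall q, O q -> exists k : int, iter n T q = q + k%:~R.
Hypothesis Osum : forall q, O q -> Sum T F n q = 0.
Hypothesis Olow : forall q, O q -> - sigma <= n%:R * F q.

Definition orbit_potential (q : R) : R := sup [set a | exists l, a = Sum T F l q].

Lemma orbit_iter l q : O q -> O (iter l T q).
Proof. by move=> Oq; elim: l => //= l; exact: OT. Qed.

Lemma Sum_orbit_mod l q : O q -> Sum T F (n + l) q = Sum T F l q.
Proof.
move=> Oq; rewrite SumD Osum // add0r; have [k ->] := Oper Oq.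
by rewrite (Sum_per HT).
Qed.

Lemma Sum_orbit_low l q : O q -> (l <= n)%N -> 0 <= sigma -> - sigma <= Sum T F l q.
Proof.
move=> Oq ln s0; have nR : 0 < n%:R :> R by rewrite ltr0n.
have : \sum_(i < l) (- (sigma / n%:R)) <= Sum T F l q.
  apply: ler_sum => i _; have := Olow (orbit_iter i Oq).
  by rewrite -mulNr ler_pdivrMr // mulrC.
apply: le_trans; rewrite sumr_const card_ord -[_ *+ l]mulr_natl mulrN lerN2.
rewrite mulrCA ler_piMr // ler_pdivrMr // mul1r ler_nat //.
Qed.

(** The full sum is 0, so an upper bound on an arc is the lower bound on the complementary arc. *)
Lemma Sum_orbit_le l q : O q -> 0 <= sigma -> Sum T F l q <= sigma.
Proof.
move=> Oq s0; elim/ltn_ind: l => l IH.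
case: (leqP l n) => ln; last first.
  by rewrite -(subnKC (ltnW ln)) Sum_orbit_mod // IH // ltn_subrL n0 (leq_ltn_trans _ ln).
have := Osum Oq; rewrite -(subnKC ln) SumD => e.
have := Sum_orbit_low (l := (n - l)%N) (orbit_iter l Oq) (leq_subr _ _) s0.
by move: e; lra.
Qed.

Lemma orbit_potential_has_sup q : O q -> 0 <= sigma -> has_sup [set a | exists l, a = Sum T F l q].
Proof.
move=> Oq s0; split; first by exists (Sum T F 0 q); exists 0%N.
by exists sigma => _ [l ->]; exact: Sum_orbit_le.
Qed.

Lemma orbit_potential_ge q l : O q -> 0 <= sigma -> Sum T F l q <= orbit_potential q.
Proof.
move=> Oq s0; apply: ub_le_sup; first by case: (orbit_potential_has_sup Oq s0).
by exists l.
Qed.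

Lemma orbit_potential_le q b : O q -> 0 <= sigma -> (forall l, Sum T F l q <= b) ->
  orbit_potential q <= b.
Proof.
move=> Oq s0 H; apply: ge_sup; first by case: (orbit_potential_has_sup Oq s0).
by move=> _ [l ->].
Qed.

Lemma orbit_potential_itv q : O q -> 0 <= sigma -> 0 <= orbit_potential q <= sigma.
Proof.
move=> Oq s0; apply/andP; split.
  by have := orbit_potential_ge 0 Oq s0; rewrite /Sum big_ord0.
by apply: orbit_potential_le => // l; exact: Sum_orbit_le.
Qed.

(** Passing from [q] to [T q] drops the empty sum from the supremum, which loses nothing: the sum
    over a full period is 0 as well. *)
Lemma orbit_potential_step q : O q -> 0 <= sigma ->
  orbit_potential (T q) = orbit_potential q - F q.
Proof.
move=> Oq s0.
have SS l : Sum T F l (T q) = Sum T F l.+1 q - F q.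
  by rewrite -add1n SumD /Sum big_ord1 /= addrAC subrr add0r.
apply/eqP; rewrite eq_le; apply/andP; split.
  apply: orbit_potential_le => //; first exact: OT.
  by move=> l; rewrite SS lerD2r; exact: orbit_potential_ge.
rewrite lerBlDr; apply: orbit_potential_le => // l.
have := orbit_potential_ge (n + l).-1 (OT Oq) s0.
rewrite SS prednK ?addn_gt0 ?n0 // Sum_orbit_mod //; lra.
Qed.
End Transfer.

Variables (w : R -> R) (sep r Rr sigma sigma' delta delta1 G : R).
Hypothesis Osep : forall q q', O q -> O q' -> q <> q' -> sep <= D q q'.
Hypothesis w_itv : forall q, O q -> 0 <= w q <= sigma.
Hypothesis w_step : forall q, O q -> w (T q) = w q - F q.
Hypothesis F_le : forall q, O q -> F q <= sigma.
Hypothesis r0 : 0 < r.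
Hypothesis rR : r <= Rr.
Hypothesis Rsep : (1 + C * L) * Rr <= sep.
Hypothesis Rsep2 : 2 * Rr <= sep.
Hypothesis sigma0 : 0 <= sigma.
Hypothesis sigma'0 : 0 <= sigma'.
Hypothesis delta0 : 0 <= delta.

Let A := K / (mu - 1).
Definition far_from (rr x : R) : Prop := forall q, O q -> rr <= D x q.

Hypothesis F_low : forall x, - sigma' <= F x.
Hypothesis F_far_r : forall x, far_from r (T x) -> delta1 <= F x.
Hypothesis F_far_R : forall x, far_from Rr (T x) -> G <= F x.
Hypothesis Hdelta1 : sigma + delta <= delta1.
Hypothesis HG : sigma' + sigma + A * r + 2 * delta <= G.

Let A0 : 0 <= A.
Proof. by rewrite divr_ge0 // subr_ge0 ltW // (em_mu HT). Qed.

(** Near [O]: the solution [w] on the orbit plus a cone of slope [A], cut at height [A * r].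
    Elsewhere: a constant so low that returning to the neighbourhood of [O] is paid by [F_low]
    alone. *)
Definition potential (x : R) : R :=
  match pselect (exists q, O q /\ D x q < Rr) with
  | left e => w (projT1 (cid e)) + A * Num.min (D x (projT1 (cid e))) r
  | right _ => - sigma' - delta
  end.

Lemma close_unique x q q' : O q -> O q' -> D x q < Rr -> D x q' < Rr -> q = q'.
Proof.
move=> Oq Oq' h h'; apply: contrapT => /(Osep Oq Oq').
have := em_tri HT q x q'; rewrite (em_sym HT q x); move: Rsep2 h h'; lra.
Qed.

Lemma close_step x q q' : O q -> D x q < Rr -> O q' -> D (T x) q' < Rr -> q' = T q.
Proof.
move=> Oq h Oq' h'; apply: contrapT => /(Osep Oq' (OT Oq)).
have := em_tri HT q' (T x) (T q); rewrite (em_sym HT q' (T x)).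
have CL : 0 <= C * L by rewrite mulr_ge0 ?(em_L_ge0 HT) // (le_trans ler01) // (em_C_ge1 HT).
have : D (T x) (T q) <= C * L * D x q.
  apply: le_trans (em_le HT _ _) _; rewrite -mulrA ler_wpM2l //.
    exact: le_trans (em_C_ge1 HT).
  apply: le_trans (em_lip HT _ _) _; rewrite ler_wpM2l ?(em_L_ge0 HT) //.
  exact: em_ge HT _ _.
have : C * L * D x q <= C * L * Rr by rewrite ler_wpM2l // ltW.
move: Rsep h'; lra.
Qed.

Lemma not_far x : ~ far_from r x -> exists q, O q /\ D x q < r.
Proof.
by move=> /existsNP[q /not_implyP[Oq /negP]]; rewrite -ltNge => h; exists q.
Qed.

(** By [close_step] such a point follows a single orbit in [O] forever, and expansion then forces
    their distance to be 0. *)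
Lemma stays_near x : (forall i, ~ far_from r (iter i T x)) -> O x.
Proof.
move=> H; have [q [Oq hq]] := not_far (H 0%N).
have Oi i : O (iter i T q) by elim: i => //= i; exact: OT.
have close i : D (iter i T x) (iter i T q) < r.
  elim: i => // i IH; have [q' [Oq' h']] := not_far (H i.+1).
  by rewrite -[iter i.+1 T q](close_step (Oi i) (lt_le_trans IH rR) Oq' (lt_le_trans h' rR)).
have [D0|Dn0] := eqVneq (D x q) 0.
  suff -> : x = q by [].
  by apply/eqP; rewrite -subr_eq0 -normr_le0 -D0 (em_ge HT).
have Dp : 0 < D x q by rewrite lt_neqAle eq_sym Dn0 (metric_ge0 HT).
have [i Hi] := exp_unbounded (r / D x q) (em_mu HT).
have := iter_exp HT i x q; have := close i.
rewrite ltr_pdivrMr // in Hi; lra.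
Qed.

Lemma potential_in x q : O q -> D x q < Rr -> potential x = w q + A * Num.min (D x q) r.
Proof.
move=> Oq h; rewrite /potential; case: pselect => [e|]; last by case; exists q.
by case: (cid e) => q' /= [Oq' h']; rewrite (close_unique Oq Oq' h h').
Qed.

Lemma potential_out x : ~ (exists q, O q /\ D x q < Rr) -> potential x = - sigma' - delta.
Proof. by move=> h; rewrite /potential; case: pselect. Qed.

Lemma far_out x : ~ (exists q, O q /\ D x q < Rr) -> far_from Rr x.
Proof. by move=> h q Oq; rewrite leNgt; apply/negP => hq; apply: h; exists q. Qed.

Lemma potential_bound x : `|potential x| <= sigma + A * r + sigma' + delta.
Proof.
have Ar : 0 <= A * r by rewrite mulr_ge0 ?(ltW r0).
move: sigma0 sigma'0 delta0 => s0 s0' d0.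
have [[q [Oq h]]|h] := pselect (exists q, O q /\ D x q < Rr); last first.
  by rewrite potential_out // ler_norml; apply/andP; split; lra.
rewrite (potential_in Oq h) ler_norml; have /andP[w0 w1] := w_itv Oq.
have m0 : 0 <= Num.min (D x q) r by rewrite le_min (metric_ge0 HT) ltW.
have m1 : A * Num.min (D x q) r <= A * r by rewrite ler_wpM2l // ge_min lexx orbT.
have m2 : 0 <= A * Num.min (D x q) r by rewrite mulr_ge0.
by apply/andP; split; lra.
Qed.

Lemma far_weaken x : far_from Rr x -> far_from r x.
Proof. by move=> h q Oq; apply: le_trans rR _; exact: h. Qed.

Definition far_ind (x : R) : R := (`[< far_from r x >])%:R.

Let far_ind_le1 x : delta * far_ind x <= delta.
Proof. by rewrite ler_piMr // lern1 leq_b1. Qed.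

Lemma potential_step x :
  potential x - potential (T x) <= F x - delta * far_ind (T x).
Proof.
have fi := far_ind_le1 (T x).
move: sigma0 sigma'0 delta0 Hdelta1 HG => s0 s0' d0 d1 hG.
have Fl := F_low x.
have [[q [Oq h]]|h] := pselect (exists q, O q /\ D x q < Rr).
- have /andP[wq0 wq1] := w_itv Oq.
  have ml : A * Num.min (D x q) r <= A * r by rewrite ler_wpM2l // ge_min lexx orbT.
  have [[q' [Oq' h']]|h'] := pselect (exists q, O q /\ D (T x) q < Rr); last first.
    (* Leaving the neighbourhood: the whole drop of the potential is paid by [G]. *)
    rewrite (potential_in Oq h) (potential_out h').
    have := F_far_R (far_out h'); lra.
  have qq x' : O x' -> D (T x) x' < Rr -> x' = T q by move=> Ox'; exact: close_step Oq h Ox'.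
  have hT : D (T x) (T q) < Rr by rewrite -(qq _ Oq' h').
  rewrite (potential_in Oq h) (potential_in (OT Oq) hT) (w_step Oq).
  have [hr|hr] := ltP (D (T x) (T q)) r.
    have -> : far_ind (T x) = 0.
      rewrite /far_ind; case: asboolP => // /(_ _ (OT Oq)); lra.
    have e := em_exp HT x q.
    have mu1 := em_mu HT.
    have D0 := metric_ge0 HT x q.
    have hx : D x q < r by apply: le_lt_trans hr; apply: le_trans e; rewrite ler_peMl // ltW.
    have -> : Num.min (D x q) r = D x q by apply: min_l; exact: ltW.
    rewrite mulr0 subr0.
    have h1 : F q - F x <= K * D x q.
      apply: le_trans (ler_norm _) _; rewrite distrC; apply: le_trans (FL _ _) _.
      by rewrite ler_wpM2l // (em_ge HT).
    have h2 : A * (mu * D x q) <= A * D (T x) (T q) by rewrite ler_wpM2l.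
    (* Origin of the slope [A]: the growth of the cone under expansion pays exactly for the
       Lipschitz variation of [F]. *)
    have h3 : K * D x q = A * (mu * D x q) - A * D x q.
      by rewrite /A; field; rewrite subr_eq0 gt_eqF.
    by lra.
  (* In the annulus between [r] and [Rr] the cone is saturated at [T x], and [delta1] pays for both
     [F q] and [delta]. *)
  have ff : far_from r (T x).
    move=> q2 Oq2; rewrite leNgt; apply/negP => h2.
    move: (h2); rewrite (qq _ Oq2 (lt_le_trans h2 rR)) => h3; lra.
  have := F_far_r ff; have := F_le Oq; lra.
- rewrite (potential_out h).
  have [[q' [Oq' h']]|h'] := pselect (exists q, O q /\ D (T x) q < Rr); last first.
    rewrite (potential_out h').
    have := F_far_r (far_weaken (far_out h')); lra.
  rewrite (potential_in Oq' h'); have /andP[wq0 wq1] := w_itv Oq'.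
  have : 0 <= A * Num.min (D (T x) q') r by rewrite mulr_ge0 // le_min (metric_ge0 HT) ltW.
  by lra.
Qed.

Lemma domination : exists B, forall m x,
  - B <= \sum_(i < m) (F (iter i T x) - delta * far_ind (iter i.+1 T x)).
Proof.
exists ((sigma + A * r + sigma' + delta) *+ 2) => m x.
have : potential x - potential (iter m T x) <=
    \sum_(i < m) (F (iter i T x) - delta * far_ind (iter i.+1 T x)).
  elim: m => [|m IH]; first by rewrite big_ord0 subrr.
  by rewrite big_ord_recr /=; have := potential_step (iter m T x); move: IH; lra.
apply: le_trans; rewrite mulr2n.
have := potential_bound x; have := potential_bound (iter m T x).
rewrite !ler_norml => /andP[_ h1] /andP[h2 _]; lra.
Qed.
End Domination.

(** * Gain of the logarithmic derivative away from the orbit *)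

Section Gain.
Variable R : realType.
Variables (O : set R) (gam rho c Ku : R).
Hypothesis rho0 : 0 < rho.
Hypothesis c0 : 0 < c.
Hypothesis c2 : c <= 1 / 2.
Hypothesis Ku0 : 0 <= Ku.

Let W := spread O gam rho (bump c rho).
Let W1 := spread O gam rho (bump1 c rho).

Lemma ln_gain (a v s : R) : 0 < a -> 0 <= s <= 1 -> a * (1 + s) <= v -> s / 2 <= ln v - ln a.
Proof.
move=> a0 /andP[s0 s1] hv.
have as0 : 0 < a * (1 + s) by rewrite mulr_gt0 //; lra.
have v0 := lt_le_trans as0 hv.
have e : ln (a * (1 + s)) <= ln v by rewrite ler_ln ?posrE.
have s10 : 0 < 1 + s by lra.
rewrite lnM ?posrE // in e.
have i0 : 0 < (1 + s)^-1 by rewrite invr_gt0.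
have := ln_sub1 i0; rewrite lnV ?posrE // => h.
have : (1 + s)^-1 <= 1 - s / 2.
  rewrite -[_^-1]div1r ler_pdivrMr //; nra.
lra.
Qed.

(** Excess over the change [ln (1 - c)] on the orbit, less the cost of moving the argument of a
    [Ku]-Lipschitz subaction by [W y]. *)
Definition gain (y : R) : R := ln (1 + W1 y) - ln (1 - c) - Ku * `|W y|.

Lemma W1_low y (z : R) : 0 <= z <= 1 -> z <= ((y - nearest O gam rho y) / rho) ^+ 2 ->
  - c * (1 - z) <= W1 y.
Proof. exact: bump1_lower. Qed.

Lemma W1_pos y : 0 < 1 + W1 y.
Proof.
have z01 : 0 <= (0 : R) <= 1 by rewrite lexx ler01.
have := @W1_low y 0 z01 (sqr_ge0 _).
by move: c2 c0; rewrite subr0 mulr1; lra.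
Qed.

Lemma gain_low y : - (Ku * (c * rho)) <= gain y.
Proof.
have z01 : 0 <= (0 : R) <= 1 by rewrite lexx ler01.
have h := @W1_low y 0 z01 (sqr_ge0 _).
have h1 : ln (1 - c) <= ln (1 + W1 y).
  by move: c2 c0 h => ? ? h; rewrite ler_ln ?posrE ?W1_pos //; lra.
have h2 : Ku * `|W y| <= Ku * (c * rho).
  by rewrite ler_wpM2l //; exact: bump_bound.
by rewrite /gain; lra.
Qed.

(** Because [1 - c * (1 - z) >= (1 - c) * (1 + c * z)]. *)
Lemma gain_aux y (z : R) : 0 <= z <= 1 -> z <= ((y - nearest O gam rho y) / rho) ^+ 2 ->
  c * z / 2 <= ln (1 + W1 y) - ln (1 - c).
Proof.
move=> /andP[z0 z1] hz; move: c2 c0 => c2' c0'; apply: ln_gain; first by lra.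
  by apply/andP; split; nra.
have := W1_low (introT andP (conj z0 z1)) hz.
have : 0 <= c ^+ 2 * z by rewrite mulr_ge0 // sqr_ge0.
nra.
Qed.

Lemma nearest_far y (a : R) : a <= rho -> (forall p, O p -> a <= `|y - p|) ->
  a <= `|y - nearest O gam rho y|.
Proof.
move=> ar H; case: (nearestP O gam rho y) => [/H//|->].
by rewrite opprB addrCA subrr addr0 ger0_norm // ltW.
Qed.

(** The loss [Ku * |W y|] is linear in the distance and the logarithmic gain quadratic; beyond
    [xi * rho] the loss eats at most half of the gain. *)
Lemma gain_far y (xi : R) : 0 < xi <= 1 -> 4 * Ku * rho <= xi ->
  (forall p, O p -> xi * rho <= `|y - p|) -> c * xi ^+ 2 / 4 <= gain y.
Proof.
move=> /andP[xi0 xi1] hK H.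
have xr : xi * rho <= rho by rewrite ler_piMl // ltW.
have ht := nearest_far xr H.
set t := y - nearest O gam rho y in ht.
have [hr|hr] := lerP rho `|t|.
  have W0 : W y = 0 by apply: bump_out.
  have z01 : 0 <= (1 : R) <= 1 by rewrite lexx ler01.
  have h1 : 1 <= (t / rho) ^+ 2.
    rewrite -real_normK ?num_real // exprn_ege1 //.
    by rewrite normrM normfV (gtr0_norm rho0) ler_pdivlMr // mul1r.
  have := gain_aux z01 h1; rewrite /gain W0 normr0 mulr0.
  have : c * xi ^+ 2 <= c * 1 by rewrite ler_wpM2l ?(ltW c0) // exprn_ile1 // ltW.
  by move: c0; lra.
have /andP[y0 y1] := sq_lt1 rho0 hr.
have := gain_aux (introT andP (conj y0 y1)) (lexx _).
have Wb : `|W y| <= c * `|t| by exact: bump_le.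
have h2 : Ku * `|W y| <= Ku * (c * `|t|) by rewrite ler_wpM2l.
have tE : `|t| = `|t / rho| * rho.
  by rewrite normrM normfV (gtr0_norm rho0) divfK // gt_eqF.
have xt : xi <= `|t / rho|.
  by rewrite normrM normfV (gtr0_norm rho0) ler_pdivlMr.
have h3 : Ku * (c * `|t|) <= c / 4 * (t / rho) ^+ 2.
  rewrite tE -[(t / rho) ^+ 2]real_normK ?num_real //.
  have -> : Ku * (c * (`|t / rho| * rho)) = c / 4 * (4 * Ku * rho * `|t / rho|) by field.
  by rewrite ler_wpM2l ?divr_ge0 ?(ltW c0) // expr2 ler_wpM2r // (le_trans hK).
have h4 : c / 4 * xi ^+ 2 <= c / 4 * (t / rho) ^+ 2.
  rewrite ler_wpM2l ?divr_ge0 ?(ltW c0) // -[(t / rho) ^+ 2]real_normK ?num_real //.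
  by rewrite lerXn2r ?nnegrE // ltW.
by rewrite /gain; lra.
Qed.

Lemma gain_out y : (forall p, O p -> rho <= `|y - p|) -> c / 2 <= gain y.
Proof.
move=> H; have ht := nearest_far (lexx rho) H.
have W0 : W y = 0 by apply: bump_out.
have z01 : 0 <= (1 : R) <= 1 by rewrite lexx ler01.
have h1 : 1 <= ((y - nearest O gam rho y) / rho) ^+ 2.
  rewrite -real_normK ?num_real // exprn_ege1 //.
  by rewrite normrM normfV (gtr0_norm rho0) ler_pdivlMr // mul1r.
by have := gain_aux z01 h1; rewrite /gain W0 normr0 mulr0 subr0 mulr1.
Qed.
End Gain.

(** * Locking for all maps near the perturbation *)

Section Locking.
Variable R : realType.

(* A quantitative certificate that the orbit of [q] is the unique minimizing
   orbit: Birkhoff sums of [ln |h'|] exceed those of the orbit by [delta] for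
   each visit to [Fc], and only the orbit itself avoids [Fc] forever. *)
Definition locked (h h1 : R -> R) : Prop :=
  exists n q (Fc : set R) (delta B : R),
  [/\ perpt h n q, 0 < delta, closed Fc /\ (forall x (k : int), Fc x -> Fc (x + k%:~R)),
    forall m x, - B <= \sum_(i < m) (log_deriv h1 (iter i h x)
        - Sum h (log_deriv h1) n q / n%:R - delta * \1_Fc (iter i.+1 h x)) &
    forall x, (forall i, ~ Fc (iter i h x)) -> exists i (k : int), x = iter i h q + k%:~R].

Definition orbit_set (f : R -> R) (p : R) : set R :=
  [set x | exists i (k : int), x = iter i f p + k%:~R].

Lemma orbit_set_shift f p x (k : int) : orbit_set f p x -> orbit_set f p (x + k%:~R).
Proof. by move=> [i [j ->]]; exists i, (j + k); rewrite intrD addrA. Qed.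

Lemma orbit_set_map f d p x : (forall x, f (x + 1) = f x + d%:~R) ->
  orbit_set f p x -> orbit_set f p (f x).
Proof. by move=> fd [i [k ->]]; exists i.+1, (d * k); rewrite /= (int_per fd). Qed.

Section Near.
Variables (f f1 f2 : R -> R) (d : int) (p : R) (n : nat) (gam rho c : R).
Hypothesis Hf : C2lift f f1 f2 d.
Let O := orbit_set f p.
Hypothesis np : perpt f n p.
Hypothesis sep : forall x y, O x -> O y -> x <> y -> gam <= `|x - y|.
Hypothesis rho0 : 0 < rho.
Hypothesis rhogam : 4 * rho <= gam.
Hypothesis c0 : 0 < c.
Hypothesis c2 : c <= 1 / 2.
Let g := perturb O gam rho c f.
Let g1 := perturb1 O gam rho c f f1.

Variables (h h1 : R -> R) (L mu C : R) (D : R -> R -> R) (m0 K Ku e : R).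
Hypothesis Hh : expmap h d L mu C D.
Hypothesis m00 : 0 < m0.
Hypothesis f1_low : forall x, m0 <= `|f1 x|.
Hypothesis g1_low : forall x, m0 <= `|g1 x|.
Hypothesis h1_low : forall x, m0 <= `|h1 x|.
Hypothesis K0 : 0 <= K.
Hypothesis h1L : lipschitz_with K (log_deriv h1).
Hypothesis h1P : int_periodic (log_deriv h1).
Hypothesis hg : forall x, `|h x - g x| <= e.
Hypothesis h1g1 : forall x, `|h1 x - g1 x| <= e.

Variables (alpha : R) (u : R -> R) (s : R).
Hypothesis Ku0 : 0 <= Ku.
Hypothesis uL : lipschitz_with Ku u.
Hypothesis uP : int_periodic u.
Let psi x := log_deriv f1 x - alpha + u x - u (f x).
Hypothesis psi0 : forall x, 0 <= psi x.
Hypothesis psi_s : Sum f psi n p <= s.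
Hypothesis s0 : 0 < s.

(** Shadowing distance obtained from [n] jumps of size [e]; [kap] collects all errors made when [g]
    and its orbit are replaced by [h] and the shadowing orbit. *)
Let e' := C / (mu - 1) * (n%:R * e).
Let kap := 2 * (m0^-1 * e) + 2 * (K * e') + 2 * (Ku * e') + Ku * e.
Hypothesis Hkap : n%:R * kap <= s.

Let mu1 : 1 < mu. Proof. exact: em_mu Hh. Qed.
Let C1 : 1 <= C. Proof. exact: em_C_ge1 Hh. Qed.
Let n0 : (0 < n)%N. Proof. by case: np. Qed.
Let nR : 1 <= n%:R :> R. Proof. by rewrite ler1n. Qed.
Let e0 : 0 <= e. Proof. exact: le_trans (hg 0). Qed.
Let e'0 : 0 <= e'.
Proof.
by rewrite mulr_ge0 ?divr_ge0 ?subr_ge0 ?(ltW mu1) ?(le_trans ler01 C1) // mulr_ge0.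
Qed.

Let Oi i : O (iter i f p). Proof. by exists i, 0; rewrite addr0. Qed.

Let g_orbit i : g (iter i f p) = iter i.+1 f p /\
  log_deriv g1 (iter i f p) = log_deriv f1 (iter i f p) + ln (1 - c).
Proof.
have [gE g1E] := @perturb_fixed _ O gam rho c sep rho0 rhogam f f1 (iter i f p) (Oi i.+1).
rewrite /g gE; split=> //; rewrite /log_deriv /g1 g1E normrM.
have f10 : 0 < `|f1 (iter i f p)| by apply: lt_le_trans m00 _.
have c1 : 0 < 1 - c by move: c2; lra.
by rewrite (gtr0_norm c1) lnM ?posrE.
Qed.

Lemma shadow_orbit : exists q, perpt h n q /\
  forall i, `|iter i h q - iter i f p| <= e'.
Proof.
have [_ [k Kk]] := np.
have [q [qk Hq]] := closing Hh (Z := fun l => iter l f p) n0 Kk.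
exists q; split; first by split=> //; exists k.
have small i : (i < n)%N -> `|iter i h q - iter i f p| <= e'.
  move=> i_n; apply: le_trans (em_ge Hh _ _) _.
  apply: (@le_trans _ _ (\sum_(l < n) D (iter l h q) (iter l f p))).
    by rewrite (bigD1 (Ordinal i_n)) //= lerDl sumr_ge0 // => *; exact: metric_ge0 Hh _ _.
  apply: le_trans Hq _; rewrite ler_wpM2l //.
    by rewrite divr_ge0 ?subr_ge0 ?(ltW mu1) ?(le_trans ler01 C1).
  rewrite mulr_natl -[n in leRHS]card_ord -sumr_const; apply: ler_sum => l _.
  by have [<- _] := g_orbit l; exact: hg.
elim/ltn_ind => i IH; case: (ltnP i n) => [/small//|ni].
have hh : (i - n < i)%N by rewrite ltn_subrL n0 (leq_trans n0 ni).
have := IH _ hh.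
rewrite -{3 4}(subnK ni) !iterD qk Kk !(iter_per (em_per Hh)) !(iter_per (c2_per Hf)).
by rewrite opprD addrACA subrr addr0.
Qed.

Variables (q : R).
Hypothesis nq : perpt h n q.
Hypothesis close : forall i, `|iter i h q - iter i f p| <= e'.
Let Oh := orbit_set h q.
Let beta := Sum h (log_deriv h1) n q / n%:R.
(** [u] is tied to [f], not to [h], so [F] may be negative; [F_gain] and [Oh_low] bound it from
    below for every [h] near [g]. *)
Let F x := log_deriv h1 x + u x - u (h x) - beta.

Lemma bounded_eq x y (B : R) : (forall l, `|iter l h x - iter l h y| <= B) -> x = y.
Proof.
move=> H; apply/eqP; rewrite -subr_eq0 -normr_le0; apply: le_trans (em_ge Hh _ _) _.
rewrite leNgt; apply/negP => Dp.
have [l Hl] := exp_unbounded (C * B / D x y) mu1.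
rewrite ltr_pdivrMr // in Hl.
have := le_trans (iter_exp Hh l x y) (em_le Hh _ _).
have : C * `|iter l h x - iter l h y| <= C * B by rewrite ler_wpM2l // (le_trans ler01).
by move: Hl; lra.
Qed.

Lemma Oh_sep x y : Oh x -> Oh y -> x <> y -> gam - 2 * e' <= `|x - y|.
Proof.
move=> [i [k ->]] [j [l ->]] xy.
have hp := close i; have hq := close j.
(* If the shadowed points coincide, the shadowing ones stay within [2 * e'] of each other forever
   and coincide by expansivity. *)
have [E|nE] := eqVneq (iter i f p + k%:~R) (iter j f p + l%:~R).
  case: xy; apply: (@bounded_eq _ _ (2 * e')) => m.
  rewrite !(iter_per (em_per Hh)) -!iterD.
  have := congr1 (iter m f) E; rewrite !(iter_per (c2_per Hf)) -!iterD => E'.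
  have h3 := close (m + i); have h4 := close (m + j).
  have -> : iter (m + i) h q + (d ^+ m * k)%:~R - (iter (m + j) h q + (d ^+ m * l)%:~R) =
    (iter (m + i) h q - iter (m + i) f p) - (iter (m + j) h q - iter (m + j) f p).
    by move: E'; lra.
  by apply: le_trans (ler_normB _ _) _; lra.
have Op i' k' : O (iter i' f p + k'%:~R) by exists i', k'.
have := sep (Op i k) (Op j l) (elimN eqP nE).
have -> : iter i f p + k%:~R - (iter j f p + l%:~R) =
  (iter i h q + k%:~R - (iter j h q + l%:~R)) -
  ((iter i h q - iter i f p) - (iter j h q - iter j f p)) by ring.
have := ler_normB (iter i h q + k%:~R - (iter j h q + l%:~R))
  ((iter i h q - iter i f p) - (iter j h q - iter j f p)).
have := ler_normB (iter i h q - iter i f p) (iter j h q - iter j f p).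
by move: hp hq; lra.
Qed.

Let nn0 : 0 < n%:R :> R. Proof. by rewrite ltr0n. Qed.

(** Along the orbit the perturbation multiplies each derivative by [1 - c], [psi] averages to at
    most [s / n], and the coboundary of [u] cancels over a period. *)
Lemma beta_le : beta <= alpha + s / n%:R + ln (1 - c) + m0^-1 * e + K * e'.
Proof.
rewrite /beta ler_pdivrMr //.
have H i : log_deriv h1 (iter i h q) <=
    psi (iter i f p) + alpha + u (iter i.+1 f p) - u (iter i f p) + ln (1 - c) + m0^-1 * e + K * e'.
  have a1 : log_deriv h1 (iter i h q) - log_deriv h1 (iter i f p) <= K * e'.
    by apply: le_trans (ler_norm _) _; apply: le_trans (h1L _ _) _; rewrite ler_wpM2l.
  have a2 : log_deriv h1 (iter i f p) - log_deriv g1 (iter i f p) <= m0^-1 * e.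
    apply: le_trans (ler_norm _) _; apply: le_trans (ln_lipschitz m00 (h1_low _) (g1_low _)) _.
    rewrite ler_wpM2l ?invr_ge0 ?(ltW m00) //; apply: le_trans (ler_dist_dist _ _) _.
    exact: h1g1.
  have [_ a3] := g_orbit i.
  by rewrite /psi /=; lra.
have hs : Sum h (log_deriv h1) n q <= \sum_(i < n) (psi (iter i f p) + alpha +
    u (iter i.+1 f p) - u (iter i f p) + ln (1 - c) + m0^-1 * e + K * e').
  by apply: ler_sum => i _; exact: H.
apply: le_trans hs _.
have -> : \sum_(i < n) (psi (iter i f p) + alpha + u (iter i.+1 f p) - u (iter i f p) + ln (1 - c) + m0^-1 * e + K * e') =
   Sum f psi n p + n%:R * (alpha + ln (1 - c) + m0^-1 * e + K * e') + (u (iter n f p) - u p).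
  elim: (n) => [|j IH]; first by rewrite big_ord0 /Sum big_ord0 /=; ring.
  rewrite big_ord_recr /= IH SumS (_ : j.+1%:R = j%:R + 1) ?natr1 //; ring.
have [_ [k ->]] := np; rewrite uP subrr addr0.
have -> : (alpha + s / n%:R + ln (1 - c) + m0^-1 * e + K * e') * n%:R =
   s + n%:R * (alpha + ln (1 - c) + m0^-1 * e + K * e').
  by field; rewrite (gt_eqF m00) (gt_eqF nn0).
by rewrite lerD2r.
Qed.

Lemma F_lip : lipschitz_with (K + Ku + Ku * L) F.
Proof.
move=> x y.
have -> : F x - F y =
  (log_deriv h1 x - log_deriv h1 y) + (u x - u y) - (u (h x) - u (h y)).
  by rewrite /F; ring.
apply: le_trans (ler_normB _ _) _; rewrite mulrDl; apply: lerD.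
  apply: le_trans (ler_normD _ _) _; rewrite mulrDl; apply: lerD.
    exact: h1L.
  exact: uL.
apply: le_trans (uL _ _) _.
by rewrite -mulrA ler_wpM2l // (em_lip Hh).
Qed.

Lemma F_per : int_periodic F.
Proof. by move=> x k; rewrite /F h1P uP (int_per (em_per Hh)) uP. Qed.

Lemma Sum_F m x : Sum h F m x = Sum h (log_deriv h1) m x - m%:R * beta + u x - u (iter m h x).
Proof.
elim: m => [|m IH]; first by rewrite /Sum !big_ord0 /=; ring.
have -> : m.+1%:R = m%:R + 1 :> R by rewrite natr1.
by rewrite !SumS IH /F /=; ring.
Qed.

Lemma Oh_per x : Oh x -> exists k : int, iter n h x = x + k%:~R.
Proof.
move=> [i [k ->]]; have [_ [j e1]] := nq.
exists (d ^+ n * k + d ^+ i * j - k).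
rewrite (iter_per (em_per Hh)) -iterD addnC iterD e1 (iter_per (em_per Hh)) !intrD intrN; ring.
Qed.

Lemma Oh_sum x : Oh x -> Sum h F n x = 0.
Proof.
move=> [i [k ->]]; rewrite (Sum_per Hh) //; last exact: F_per.
have [_ [j e1]] := nq.
have S0 : Sum h F n q = 0.
  by rewrite Sum_F e1 uP addrK /beta mulrC divfK ?gt_eqF // subrr.
have := SumD h F i n q; rewrite addnC SumD S0 e1 (Sum_per Hh) //; last exact: F_per.
lra.
Qed.

Lemma Oh_low x : Oh x -> - (2 * s) <= n%:R * F x.
Proof.
move=> [i [k ->]]; rewrite F_per.
have a1 : log_deriv h1 (iter i f p) - log_deriv h1 (iter i h q) <= K * e'.
  by apply: le_trans (ler_norm _) _; apply: le_trans (h1L _ _) _; rewrite distrC ler_wpM2l.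
have a2 : log_deriv g1 (iter i f p) - log_deriv h1 (iter i f p) <= m0^-1 * e.
  apply: le_trans (ler_norm _) _; apply: le_trans (ln_lipschitz m00 (g1_low _) (h1_low _)) _.
  rewrite ler_wpM2l ?invr_ge0 ?(ltW m00) //; apply: le_trans (ler_dist_dist _ _) _.
  by rewrite distrC; exact: h1g1.
have [_ a3] := g_orbit i.
have a4 : u (iter i f p) - u (iter i h q) <= Ku * e'.
  by apply: le_trans (ler_norm _) _; apply: le_trans (uL _ _) _; rewrite distrC ler_wpM2l.
have a5 : u (iter i.+1 h q) - u (iter i.+1 f p) <= Ku * e'.
  by apply: le_trans (ler_norm _) _; apply: le_trans (uL _ _) _; rewrite ler_wpM2l.
have a6 := psi0 (iter i f p); rewrite /psi in a6.
have a7 := beta_le.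
have a8 : - (s / n%:R) - kap <= F (iter i h q).
  have a9 : 0 <= Ku * e by rewrite mulr_ge0.
  by rewrite /F /kap; move: a5; rewrite /=; lra.
have : n%:R * (- (s / n%:R) - kap) <= n%:R * F (iter i h q) by rewrite ler_pM2l.
have -> : n%:R * (- (s / n%:R) - kap) = - s - n%:R * kap by field; rewrite (gt_eqF nn0).
by move: Hkap; lra.
Qed.

Let kap0 : 0 <= kap.
Proof.
have a1 : 0 <= m0^-1 * e by rewrite mulr_ge0 // invr_ge0 ltW.
have a2 : 0 <= K * e' by exact: mulr_ge0 e'0.
have a3 : 0 <= Ku * e' by exact: mulr_ge0 e'0.
have a4 : 0 <= Ku * e by exact: mulr_ge0.
by rewrite /kap; lra.
Qed.

Lemma F_gain x : gain O gam rho c Ku (f x) - 2 * s <= F x.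
Proof.
have a2 : log_deriv g1 x - log_deriv h1 x <= m0^-1 * e.
  apply: le_trans (ler_norm _) _; apply: le_trans (ln_lipschitz m00 (g1_low _) (h1_low _)) _.
  rewrite ler_wpM2l ?invr_ge0 ?(ltW m00) //; apply: le_trans (ler_dist_dist _ _) _.
  by rewrite distrC; exact: h1g1.
have a3 : log_deriv g1 x = log_deriv f1 x + ln (1 + spread O gam rho (bump1 c rho) (f x)).
  have p1 := W1_pos O gam rho0 c0 c2 (f x).
  have f10 : 0 < `|f1 x| by apply: lt_le_trans m00 _.
  by rewrite /log_deriv /g1 /perturb1 normrM (gtr0_norm p1) lnM ?posrE.
have a4 : u (h x) - u (f x) <= Ku * e + Ku * `|spread O gam rho (bump c rho) (f x)|.
  apply: le_trans (ler_norm _) _; apply: le_trans (uL _ _) _; rewrite -mulrDr ler_wpM2l //.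
  apply: le_trans (ler_distD (g x) _ _) _; rewrite lerD //.
  by rewrite /g /perturb addrAC subrr add0r.
have a5 := psi0 x; rewrite /psi in a5.
have a7 := beta_le.
have a8 : s / n%:R <= s by rewrite ler_pdivrMr // ler_peMr // ltW.
have a9 : kap <= s by apply: le_trans Hkap; rewrite ler_peMl.
have b1 : 0 <= K * e' by rewrite mulr_ge0.
have b2 : 0 <= Ku * e' by rewrite mulr_ge0.
rewrite /gain /F; rewrite /kap in a9; lra.
Qed.

Variables (xi r Rr : R).
Hypothesis xi01 : 0 < xi <= 1 / 2.
Hypothesis Kurho : 4 * Ku * rho <= xi.
Hypothesis r0 : 0 < r.
Hypothesis rR : r <= Rr.
Hypothesis Hr : C * (2 * (xi * rho) + e + e') <= r.
Hypothesis HR : C * (2 * rho + e + e') <= Rr.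
Hypothesis Hsep1 : (1 + C * L) * Rr <= gam - 2 * e'.
Hypothesis Hsep2 : 2 * Rr <= gam - 2 * e'.
Hypothesis Hs : 128 * s <= c * (4 * xi ^+ 2).
Hypothesis HA : (K + Ku + Ku * L) / (mu - 1) * r <= c / 8.

(** Moves distances from the shadowing orbit back to the orbit of [f], where the gain is computed.
    The factor 2 absorbs [1 + c], the stretch by [id + W] of distances to orbit points. *)
Lemma far_transfer (a rr : R) x : C * (2 * a + e + e') <= rr ->
  far_from D Oh rr (h x) -> forall y, O y -> a <= `|f x - y|.
Proof.
move=> Ha Hfar y [i [k ->]].
have Oq : Oh (iter i h q + k%:~R) by exists i, k.
have Hc := close i.
set y' := iter i f p + k%:~R; set q' := iter i h q + k%:~R in Oq *.
have yq : `|y' - q'| <= e' by rewrite /y' /q' opprD addrACA subrr addr0 distrC.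
have W_le : `|spread O gam rho (bump c rho) (f x)| <= c * `|f x - y'|.
  have Oy : O y' by exists i, k.
  case: (ltP `|f x - y'| (gam / 2)) => hd.
    by rewrite /spread (nearest_in rho sep Oy hd); exact: bump_le.
  apply: le_trans (bump_bound c0 rho0 _) _; rewrite ler_pM2l //; move: rhogam rho0 hd; lra.
have h1' : rr <= C * `|h x - q'|.
  exact: le_trans (Hfar _ Oq) (em_le Hh _ _).
have h2 : `|h x - q'| <= e + (`|f x - y'| + c * `|f x - y'|) + e'.
  apply: le_trans (ler_distD y' _ _) _; apply: lerD => //.
  apply: le_trans (ler_distD (g x) _ _) _; apply: lerD => //.
  have -> : g x - y' = (f x - y') + spread O gam rho (bump c rho) (f x) by rewrite /g /perturb; ring.
  by apply: le_trans (ler_normD _ _) _; rewrite lerD2l.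
have h3 : C * `|h x - q'| <= C * (e + (`|f x - y'| + c * `|f x - y'|) + e').
  by rewrite ler_wpM2l // (le_trans ler01).
have h4 : C * (2 * a + e + e') <= C * (e + (`|f x - y'| + c * `|f x - y'|) + e').
  exact: le_trans Ha (le_trans h1' h3).
rewrite ler_pM2l in h4; last by rewrite (lt_le_trans ltr01).
have : c * `|f x - y'| <= 1 / 2 * `|f x - y'| by rewrite ler_wpM2r.
have := normr_ge0 (f x - y'); lra.
Qed.

Lemma closed_far : closed [set x | far_from D Oh r x].
Proof.
have -> : [set x | far_from D Oh r x] = \bigcap_(y in Oh) [set x | r <= D x y].
  by apply/seteqP; split => x /= H y; exact: H.
apply: closed_bigI => y _.
have cD : continuous (fun x => D x y).
  apply: (@lipschitz_continuous _ C) => x z; rewrite ler_norml.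
  have := em_tri Hh x z y; have := em_tri Hh z x y.
  have := em_le Hh x z; have := em_le Hh z x; rewrite (em_sym Hh z x) => a1 a2 a3 a4.
  by apply/andP; split; lra.
exact: (@closed_comp _ _ (fun x => D x y) [set z | r <= z] (fun x _ => cD x) (@closed_ge _ r)).
Qed.

Lemma locked_near : locked h h1.
Proof.
have /andP[xi0 xi2] := xi01.
have KK : 0 <= K + Ku + Ku * L by rewrite !addr_ge0 // mulr_ge0 // (em_L_ge0 Hh).
have OT x : Oh x -> Oh (h x) by exact: orbit_set_map (em_per Hh).
have s20 : 0 <= 2 * s by rewrite mulr_ge0 // ltW.
have F1 x : Oh x -> F x <= 2 * s.
  move=> Ox; have := Sum_orbit_le Hh OT n0 F_per Oh_per Oh_sum Oh_low 1 Ox s20.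
  by rewrite /Sum big_ord1.
pose w := orbit_potential h F.
have w_itv x : Oh x -> 0 <= w x <= 2 * s.
  by move=> Ox; have := orbit_potential_itv Hh OT n0 F_per Oh_per Oh_sum Oh_low Ox s20.
have w_step x : Oh x -> w (h x) = w x - F x.
  by move=> Ox; have := orbit_potential_step Hh OT n0 F_per Oh_per Oh_sum Oh_low Ox s20.
have OD x y : Oh x -> Oh y -> x <> y -> gam - 2 * e' <= D x y.
  by move=> Ox Oy xy; apply: le_trans (em_ge Hh _ _); exact: Oh_sep.
have sigma'0 : 0 <= Ku * (c * rho) + 2 * s by rewrite addr_ge0 // !mulr_ge0 // ltW.
(* Half of the gain guaranteed beyond radius [r]; the other half covers [4 * s], by [Hs]. *)
pose delta := c * xi ^+ 2 / 8.
have delta0 : 0 < delta by rewrite divr_gt0 // mulr_gt0 // exprn_gt0.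
have F_low x : - (Ku * (c * rho) + 2 * s) <= F x.
  by have := F_gain x; have := gain_low O gam rho0 c0 c2 Ku0 (f x); lra.
have F_r x : far_from D Oh r (h x) -> c * xi ^+ 2 / 4 - 2 * s <= F x.
  move=> /(far_transfer Hr) H; have := F_gain x.
  have xi1 : 0 < xi <= 1 by apply/andP; split=> //; move: xi2; lra.
  have := gain_far gam rho0 c0 c2 Ku0 xi1 Kurho H; lra.
have F_R x : far_from D Oh Rr (h x) -> c / 2 - 2 * s <= F x.
  move=> /(far_transfer HR) H; have := F_gain x.
  by have := gain_out gam Ku rho0 c0 c2 H; lra.
have cxi : c * xi ^+ 2 <= c / 4.
  have : xi ^+ 2 <= (1 / 2) ^+ 2 by rewrite lerXn2r ?nnegrE ?(ltW xi0) // divr_ge0.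
  rewrite -(ler_pM2l c0); lra.
have H1 : 2 * s + delta <= c * xi ^+ 2 / 4 - 2 * s by rewrite /delta; move: Hs; lra.
have H2 : (Ku * (c * rho) + 2 * s) + 2 * s + (K + Ku + Ku * L) / (mu - 1) * r + 2 * delta <= c / 2 - 2 * s.
  have : c * (4 * Ku * rho) <= c * (1 / 2) by rewrite ler_pM2l // (le_trans Kurho).
  by rewrite /delta; move: Hs HA c0; lra.
have [B HB] := domination Hh KK F_lip OT OD w_itv w_step F1 r0 rR Hsep1 Hsep2 s20 sigma'0
  (ltW delta0) F_low F_r F_R H1 H2.
(* [2 * Ku] bounds the telescoped coboundary of [u], which is absent from the definition of
   [locked]. *)
exists n, q, [set x | far_from D Oh r x], delta, (B + 2 * Ku); split=> //.
- split; first exact: closed_far.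
  move=> x k Hx y Oy; rewrite -[y](subrK k%:~R) (em_shift Hh).
  by apply: Hx; rewrite -intrN; exact: orbit_set_shift.
- move=> m x.
  have := HB m x.
  have -> : \sum_(i < m) (F (iter i h x) - delta * far_ind D Oh r (iter i.+1 h x)) =
    \sum_(i < m) (log_deriv h1 (iter i h x) - Sum h (log_deriv h1) n q / n%:R -
      delta * \1_([set x | far_from D Oh r x]) (iter i.+1 h x)) + (u x - u (iter m h x)).
    elim: m => [|m IH]; first by rewrite !big_ord0 subrr addr0.
    by rewrite !big_ord_recr IH /F /beta /far_ind /= indicE /in_mem /=; ring.
  have := periodic_bounded Ku0 uL uP x; have := periodic_bounded Ku0 uL uP (iter m h x).
  rewrite !ler_norml => /andP[b1 b2] /andP[b3 b4]; lra.
- move=> x Hx.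
  exact: (stays_near Hh OT OD rR Hsep1 Hx).
Qed.
End Near.
End Locking.

(** * Choice of the scales and density of locked maps *)

Section Density.
Variable R : realType.

Lemma orbit_set_sep (f : R -> R) d p n (gam : R) :
  (forall x, f (x + 1) = f x + d%:~R) -> perpt f n p -> gam <= 1 ->
  gap_at_least f n p gam ->
  forall x y, orbit_set f p x -> orbit_set f p y -> x <> y -> gam <= `|x - y|.
Proof.
move=> fd [n0 [K eK]] gam1 gap.
have red i : exists k : int, iter i f p = iter (i %% n) f p + k%:~R.
  elim/ltn_ind: i => i IH; case: (ltnP i n) => [h|ni].
    by exists 0; rewrite modn_small // addr0.
  have hh : (i - n < i)%N by rewrite ltn_subrL n0 (leq_trans n0 ni).
  have [k ek] := IH _ hh.
  exists (k + d ^+ (i - n) * K).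
  rewrite -{1}(subnK ni) iterD eK (iter_per fd) ek -{3}(subnK ni) modnDr intrD; ring.
move=> x y [i [k ->]] [j [l ->]]; have [a ->] := red i; have [b ->] := red j.
set i' := (i %% n)%N; set j' := (j %% n)%N.
have i'n : (i' < n)%N by rewrite ltn_mod. have j'n : (j' < n)%N by rewrite ltn_mod.
case: (ltngtP i' j') => [ij|ji|->] xy.
- have := gap i' j' (b + l - a - k) ij j'n; congr (_ <= `| _ |).
  by rewrite !intrB !intrD; ring.
- have := gap j' i' (a + k - b - l) ji i'n; rewrite distrC; congr (_ <= `| _ |).
  by rewrite !intrB !intrD; ring.
apply: (le_trans gam1).
have E : iter j' f p + a%:~R + k%:~R - (iter j' f p + b%:~R + l%:~R) = (a + k - b - l)%:~R.
  by rewrite !intrB !intrD; ring.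
rewrite E -intr_norm -[leLHS]/(1%:~R) ler_int -gtz0_ge1 normr_gt0.
by apply/eqP => e0; apply: xy; apply/eqP; rewrite -subr_eq0 E e0.
Qed.

Lemma log_deriv_periodic (f f1 f2 : R -> R) d : C2lift f f1 f2 d -> int_periodic (log_deriv f1).
Proof.
move=> Hf x k; rewrite /log_deriv.
by rewrite (nat_periodic (derive1_periodic (c2_d1 Hf) (c2_per Hf))).
Qed.

(** Ratios fixed before the orbit: [ep1] will be [c / rho], [xi1] will be [r / rho], and [theta]
    will be [rho / gam]. *)
Lemma choice_of_scales (L L2 C A Ku eps kap : R) : 0 <= L -> 0 <= L2 -> 1 <= C -> 0 <= A -> 0 <= Ku ->
  0 < eps -> 0 < kap ->
  exists ep1 xi1 theta : R,
  [/\ [/\ 0 < ep1, ep1 <= 1 / 2, ep1 * (1 + 6 * L + 24 * L ^+ 2 + 6 * L2) <= eps &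
          ep1 * (1 + 6 * L + 24 * L ^+ 2 + 6 * L2) <= kap / 2],
      [/\ 0 < xi1, xi1 <= 1 & A * xi1 <= ep1 / 8] &
      [/\ 0 < theta, 4 * Ku * theta <= xi1 / (4 * C), 16 * C * theta <= 1 &
          8 * C * (1 + C * L) * theta <= 1]].
Proof.
move=> L0 L20 C1 A0 Ku0 eps0 kap0.
set Q := 1 + 6 * L + 24 * L ^+ 2 + 6 * L2.
have Q1 : 1 <= Q by rewrite /Q -!addrA lerDl !addr_ge0 // mulr_ge0 // sqr_ge0.
have Q0 : 0 < Q by rewrite (lt_le_trans ltr01).
pose epk := Num.min eps (kap / 2).
have epk0 : 0 < epk by rewrite lt_min eps0 divr_gt0.
pose ep1 := Num.min (1 / 2) (epk / Q).
have ep10 : 0 < ep1 by rewrite lt_min !divr_gt0.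
have ep1Q : ep1 * Q <= epk by rewrite -ler_pdivlMr // ge_min lexx orbT.
pose xi1 := Num.min 1 (ep1 / (8 * (A + 1))).
have A1 : 0 < 8 * (A + 1) by rewrite mulr_gt0 // ltr_wpDl.
have xi10 : 0 < xi1 by rewrite lt_min ltr01 divr_gt0.
have C0 : 0 < C by rewrite (lt_le_trans ltr01).
have den1 : 0 < 4 * (Ku + 1) by rewrite mulr_gt0 // ltr_wpDl.
have CL0 : 0 <= C * L by rewrite mulr_ge0 // ltW.
have d1 : 0 <= 8 * C * (1 + C * L) by rewrite !mulr_ge0 ?addr_ge0 // ltW.
have d2 : 0 < 16 * C by rewrite mulr_gt0.
have den2 : 0 < 8 * C * (1 + C * L) + 16 * C by rewrite ltr_wpDl.
pose xi := xi1 / (4 * C).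
have xi0 : 0 < xi by rewrite divr_gt0 // mulr_gt0.
pose theta := Num.min (xi / (4 * (Ku + 1))) (8 * C * (1 + C * L) + 16 * C)^-1.
have theta0 : 0 < theta by rewrite lt_min divr_gt0 // invr_gt0.
have h2 : theta * (8 * C * (1 + C * L) + 16 * C) <= 1.
  by rewrite -ler_pdivlMr // div1r /theta ge_min lexx orbT.
have e1 := mulr_ge0 d1 (ltW theta0); have e2 := mulr_ge0 (ltW d2) (ltW theta0).
exists ep1, xi1, theta; split; split=> //.
- by rewrite ge_min lexx.
- by apply: le_trans ep1Q _; rewrite ge_min lexx.
- by apply: le_trans ep1Q _; rewrite ge_min lexx orbT.
- by rewrite ge_min lexx.
- have : xi1 * (8 * (A + 1)) <= ep1 by rewrite -ler_pdivlMr // ge_min lexx orbT.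
  by clear -A0 xi10; lra.
- have : theta * (4 * (Ku + 1)) <= xi by rewrite -ler_pdivlMr // ge_min lexx.
  by rewrite -/xi; clear -theta0; lra.
- by clear -h2 e1; lra.
- by clear -h2 e2; lra.
Qed.

Lemma locked_dense (f f1 f2 : R -> R) d : C2lift f f1 f2 d -> expanding f ->
  forall eps, 0 < eps -> exists (g g1 g2 : R -> R) (e : R),
    [/\ C2lift g g1 g2 d, expanding g,
      [/\ forall x, `|g x - f x| <= eps, forall x, `|g1 x - f1 x| <= eps &
          forall x, `|g2 x - f2 x| <= eps],
      0 < e &
      forall h h1 h2 : R -> R, C2lift h h1 h2 d -> (forall x, `|h x - g x| <= e) ->
        (forall x, `|h1 x - g1 x| <= e) -> (forall x, `|h2 x - g2 x| <= e) ->
        locked h h1].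
Proof.
move=> Hf fexp eps eps0.
have [N [mu [m0 [L [L2 [kap [[N0 mu1 m00 kap0 L1] U]]]]]]] := uniform_expansion Hf fexp.
have refl (v : R -> R) x : `|v x - v x| <= kap by rewrite subrr normr0 ltW.
have [fm fL fL2 fN] := U f f1 f2 Hf (refl f) (refl f1) (refl f2).
have L0 : 0 <= L by rewrite (le_trans ler01).
have L20 : 0 <= L2 by exact: le_trans (fL2 0).
pose C := \sum_(i < N) (L / mu) ^+ i.
have em (h h1 h2 : R -> R) : C2lift h h1 h2 d -> (forall x, `|h1 x| <= L) ->
    (forall x y, mu ^+ N * `|x - y| <= `|iter N h x - iter N h y|) ->
    expmap h d L mu C (Dist h mu N).
  move=> Hh hL hN; apply: Dist_expmap => //; first exact: c2_per Hh.
  exact: lipschitz_of_derive (c2_d1 Hh) hL.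
have Ef := em f f1 f2 Hf fL fN.
have C1 : 1 <= C := em_C_ge1 Ef.
pose K := m0^-1 * L2.
have K0 : 0 <= K by rewrite mulr_ge0 // invr_ge0 ltW.
have lipl (h h1 h2 : R -> R) : C2lift h h1 h2 d -> (forall x, m0 <= `|h1 x|) ->
   (forall x, `|h2 x| <= L2) -> lipschitz_with K (log_deriv h1).
  by move=> Hh; exact: log_deriv_lip (c2_d2 Hh).
pose phi := log_deriv f1.
have phiL : lipschitz_with K phi := lipl f f1 f2 Hf fm fL2.
have phiP : int_periodic phi := log_deriv_periodic Hf.
pose alpha := minimal_average f phi.
pose u := subaction f phi.
have mu10 : 0 < mu - 1 by rewrite subr_gt0.
pose Ku := K * (C / (mu - 1)).
have Ku0 : 0 <= Ku by rewrite mulr_ge0 // divr_ge0 ?(ltW mu10) // (le_trans ler01).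
have uL : lipschitz_with Ku u := subaction_lip Ef K0 phiL phiP.
have uP : int_periodic u := subaction_periodic Ef K0 phiL phiP.
pose K3 := K + Ku + Ku * L.
have K30 : 0 <= K3 by rewrite !addr_ge0 // mulr_ge0.
have psiL : lipschitz_with K3 (normalized f phi) := normalized_lip Ef K0 phiL phiP.
have psiP := normalized_periodic Ef K0 phiL phiP.
have psi0 := normalized_ge0 Ef K0 phiL phiP.
have psi_small := small_periodic_average Ef K0 phiL phiP.
pose A := K3 / (mu - 1).
have A0 : 0 <= A by rewrite divr_ge0 // ltW.
have [ep1 [xi1 [theta [[ep10 ep12 epe epk] [xi10 xi11 Axi] [theta0 th1 th2 th6]]]]] :=
  choice_of_scales L0 L20 C1 A0 Ku0 eps0 kap0.
have C0 : 0 < C by rewrite (lt_le_trans ltr01).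
pose xi := xi1 / (4 * C).
have C40 : 0 < 4 * C by rewrite mulr_gt0.
have xi0 : 0 < xi by rewrite divr_gt0.
have xiC : 4 * C * xi = xi1 by rewrite /xi mulrC divfK // gt_eqF.
have xi2 : xi <= 1 / 2.
  rewrite /xi ler_pdivrMr //; clear -xi11 C1; lra.
have th4 : 16 * theta <= 16 * C * theta by rewrite ler_pM2r // ler_peMr.
(* Then [s = eta * gam] equals [c * xi ^+ 2 / 32], the equality case of [Hs]. *)
pose eta := ep1 * theta * xi ^+ 2 / 32.
have eta0 : 0 < eta by rewrite divr_gt0 // mulr_gt0 ?exprn_gt0 // mulr_gt0.
have [n [p [s [np /andP[s0 seta] psis gap]]]] := good_gap_orbit Ef K30 psiL psiP psi0 psi_small eta0.
set gam := s / eta in gap.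
have gam0 : 0 < gam by rewrite divr_gt0.
have gam1 : gam <= 1 by rewrite ler_pdivrMr // mul1r.
have sE : s = eta * gam by rewrite /gam mulrC divfK // gt_eqF.
pose rho := theta * gam.
have rho0 : 0 < rho by rewrite mulr_gt0.
have th5 : theta <= 1 / 16 by clear -th2 th4; lra.
have rho_gam : rho <= gam / 16.
  have : theta * gam <= 1 / 16 * gam by rewrite ler_pM2r.
  by rewrite /rho; clear; lra.
(* The second derivative of the bump, of order [c / rho = ep1], stays small however small the gap
   is. *)
pose c := ep1 * rho.
have c0 : 0 < c by rewrite mulr_gt0.
have rho1 : rho <= 1 by clear -rho_gam gam1; lra.
have cep : c <= ep1 by rewrite ler_piMr // ltW.
have c2 : c <= 1 / 2 by exact: le_trans cep ep12.
have sep := orbit_set_sep (c2_per Hf) np gam1 gap.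
have shiftO x (k : int) : orbit_set f p x -> orbit_set f p (x + k%:~R).
  exact: orbit_set_shift.
have rhogam : 4 * rho <= gam by clear -rho_gam gam0; lra.
pose O := orbit_set f p.
pose g := perturb O gam rho c f.
pose g1 := perturb1 O gam rho c f f1.
pose g2 := perturb2 O gam rho c f f1 f2.
have Hg : C2lift g g1 g2 d := perturb_C2lift c sep shiftO rho0 rhogam Hf.
have LL : 0 <= ep1 * L by rewrite mulr_ge0 // ltW.
have LL2 : 0 <= ep1 * L2 by rewrite mulr_ge0 // ltW.
have LLL : 0 <= ep1 * L ^+ 2 by rewrite mulr_ge0 ?sqr_ge0 // ltW.
set Qe := ep1 * _ in epe epk.
have QE : Qe = ep1 + 6 * (ep1 * L) + 24 * (ep1 * L ^+ 2) + 6 * (ep1 * L2) by rewrite /Qe; ring.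
have gd0 x : `|g x - f x| <= Qe.
  apply: le_trans (perturb_dist _ _ rho0 c0 _ _) _.
  have : c * rho <= c * 1 by rewrite ler_pM2l.
  by rewrite QE; clear -cep LL LL2 LLL; lra.
have gd1 x : `|g1 x - f1 x| <= Qe.
  apply: le_trans (perturb1_dist _ _ rho0 c0 _ fL _) _.
  have : c * L <= ep1 * L by rewrite ler_wpM2r.
  by rewrite QE; clear -ep10 LL LL2 LLL; lra.
have gd2 x : `|g2 x - f2 x| <= Qe.
  apply: le_trans (perturb2_dist _ _ rho0 c0 _ fL fL2 _) _.
  have : c * L2 <= ep1 * L2 by rewrite ler_wpM2r.
  have -> : c / rho = ep1 by rewrite /c mulfK // gt_eqF.
  by rewrite QE; clear -ep10 LL LL2 LLL; lra.
have gk (v v' : R -> R) : (forall x, `|v x - v' x| <= Qe) -> forall x, `|v x - v' x| <= kap.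
  by move=> H x; apply: le_trans (H x) (le_trans epk _); clear -kap0; lra.
have [gm gL gL2 gN] := U g g1 g2 Hg (gk _ _ gd0) (gk _ _ gd1) (gk _ _ gd2).
pose Cn := C / (mu - 1) * n%:R.
have Cn0 : 0 <= Cn by rewrite mulr_ge0 // divr_ge0 // ltW.
pose Z := 2 * m0^-1 + 2 * (K * Cn) + 2 * (Ku * Cn) + Ku + 1.
have Z0 : 0 < Z.
  have z1 : 0 < m0^-1 by rewrite invr_gt0.
  have z2 := mulr_ge0 K0 Cn0; have z3 := mulr_ge0 Ku0 Cn0.
  by rewrite /Z; clear -z1 z2 z3 Ku0; lra.
have n0 : 0 < n%:R :> R by rewrite ltr0n; case: np.
(* The bounds keep [h] in the neighbourhood of [f], the total error [n * kap] of the locking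
   argument below [s], and shadowing errors below the radii. *)
pose e := Num.min (kap / 2) (Num.min (s / (n%:R * Z)) (xi1 * rho / (2 * C * (1 + Cn)))).
have nZ : 0 < n%:R * Z by rewrite mulr_gt0.
have CCn : 0 < 2 * C * (1 + Cn) by rewrite !mulr_gt0 // ltr_pwDl.
have e0 : 0 < e by rewrite !lt_min !divr_gt0 // mulr_gt0.
have ek : e <= kap / 2 by rewrite ge_min lexx.
have es : n%:R * Z * e <= s.
  by rewrite mulrC -ler_pdivlMr // /e !ge_min lexx !orbT.
have ex : C * (e + Cn * e) <= xi1 * rho / 2.
  have : e <= xi1 * rho / (2 * C * (1 + Cn)) by rewrite /e !ge_min lexx !orbT.
  by rewrite ler_pdivlMr //; clear; lra.
exists g, g1, g2, e; split=> //.
- exact: expmap_expanding (c2_d1 Hg) (em g g1 g2 Hg gL gN).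
- by split=> x; apply: le_trans _ epe.
move=> h h1 h2 Hh hg hg1 hg2.
have kk (v v' v'' : R -> R) : (forall x, `|v x - v' x| <= e) -> (forall x, `|v' x - v'' x| <= Qe) ->
    forall x, `|v x - v'' x| <= kap.
  by move=> H1 H2 x; have := ler_distD (v' x) (v x) (v'' x); have := H1 x; have := H2 x; clear -epk ek; lra.
have [hm hL hL2 hN] := U h h1 h2 Hh (kk _ _ _ hg gd0) (kk _ _ _ hg1 gd1) (kk _ _ _ hg2 gd2).
have Eh := em h h1 h2 Hh hL hN.
have [q [nq close]] := shadow_orbit Hf np sep rho0 rhogam c2 Eh m00 fm hg.
have e'E : C / (mu - 1) * (n%:R * e) = Cn * e by rewrite /Cn; ring.
have Cne : 0 <= Cn * e by rewrite mulr_ge0 // ltW.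
have ce1 : e + Cn * e <= C * (e + Cn * e) by rewrite ler_peMl // addr_ge0 // ltW.
have xr : xi1 * rho <= rho by rewrite ler_piMl // ltW.
have gamCne : 2 * (Cn * e) <= gam / 2 by clear -xr ex ce1 rho_gam e0 Cne gam0; lra.
apply: (locked_near Hf np sep rho0 rhogam c0 c2 Eh m00 fm gm hm K0
  (lipl h h1 h2 Hh hm hL2) (log_deriv_periodic Hh) hg hg1 Ku0 uL uP psi0 psis s0 _ nq close
  (xi := xi) (r := xi1 * rho) (Rr := 4 * C * rho)); rewrite ?e'E.
- apply: le_trans es; rewrite -mulrA ler_pM2l //.
  have -> : Z * e = 2 * (m0^-1 * e) + 2 * (K * (Cn * e)) + 2 * (Ku * (Cn * e)) + Ku * e + e.
    by rewrite /Z; ring.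
  by rewrite lerDl ltW.
- by rewrite xi0.
- have : 4 * Ku * theta * gam <= 4 * Ku * theta * 1.
    apply: ler_wpM2l gam1; apply: mulr_ge0 (ltW theta0); exact: mulr_ge0.
  by rewrite /rho; move: th1; rewrite -/xi; clear; lra.
- by rewrite mulr_gt0.
- have : 1 * rho <= C * rho by rewrite ler_pM2r.
  by rewrite mul1r; clear -xr rho0; lra.
- have -> : C * (2 * (xi * rho) + e + Cn * e) = 4 * C * xi * rho / 2 + C * (e + Cn * e) by field.
  by rewrite xiC; clear -ex; lra.
- have -> : C * (2 * rho + e + Cn * e) = 2 * (C * rho) + C * (e + Cn * e) by ring.
  have : 1 * rho <= C * rho by rewrite ler_pM2r.
  by rewrite mul1r; clear -ex xr rho0; lra.
- have -> : (1 + C * L) * (4 * C * rho) = 8 * C * (1 + C * L) * theta / 2 * gam by rewrite /rho; field.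
  have : 8 * C * (1 + C * L) * theta / 2 * gam <= 1 / 2 * gam.
    by rewrite ler_pM2r //; clear -th6; lra.
  by clear -gamCne; lra.
- have -> : 2 * (4 * C * rho) = 16 * C * theta / 2 * gam by rewrite /rho; field.
  have : 16 * C * theta / 2 * gam <= 1 / 2 * gam.
    by rewrite ler_pM2r //; clear -th2; lra.
  by clear -gamCne; lra.
- by rewrite sE /eta /c /rho le_eqVlt; apply/orP; left; apply/eqP; clear; field.
- have : A * xi1 * rho <= ep1 / 8 * rho by rewrite ler_pM2r.
  by rewrite /A /K3 /c; clear; lra.
Qed.
End Density.

(** * Minimizing measures *)

Section OrbitMeasure.
Variable R : realType.

(** Indexed by [n.+1] points, repetitions allowed, so that it is a probability for every [n]. *)
Definition orbit_measure (n : nat) (y : nat -> R) : set R -> \bar R :=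
  mscale ((n.+1%:R)^-1)%:nng (msum (fun i => dirac (y i)) n.+1).

HB.instance Definition _ n y := Measure.on (orbit_measure n y).

Lemma orbit_measureE n y (A : set R) :
  orbit_measure n y A = ((n.+1%:R)^-1 * \sum_(i < n.+1) \1_A (y i))%:E.
Proof.
rewrite EFinM -sumEFin /orbit_measure /mscale /=; congr (_ * _)%E.
Qed.

Lemma orbit_measure_setT n y : orbit_measure n y setT = 1%E.
Proof.
rewrite orbit_measureE (eq_bigr (fun=> 1)); last by move=> i _; rewrite indicT.
by rewrite sumr_const card_ord mulVf // pnatr_eq0.
Qed.

HB.instance Definition _ n y :=
  Measure_isProbability.Build _ _ _ (orbit_measure n y) (orbit_measure_setT n y).

End OrbitMeasure.

Section Bounded.
Variable R : realType.
Implicit Types (g : R -> R) (Q : probability R R).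

Definition bounded_measurable g := measurable_fun setT g /\ exists B : R, forall x, `|g x| <= B.

Lemma bm_integrable Q g : bounded_measurable g -> Q.-integrable setT (EFin \o g).
Proof.
move=> [mg [B HB]]; apply: measurable_bounded_integrable => //.
  by apply: (@le_lt_trans _ _ 1%E); [exact: probability_le1 | exact: ltry].
exists B; split; first exact: num_real.
by move=> M BM x _; apply: le_trans (HB x) (ltW BM).
Qed.

Lemma bm_comp g (T : R -> R) : measurable_fun setT T -> bounded_measurable g ->
  bounded_measurable (g \o T).
Proof.
move=> mT [mg [B HB]]; split; first exact: measurableT_comp.
by exists B => x; exact: HB.
Qed.

Lemma bm_D g1 g2 : bounded_measurable g1 -> bounded_measurable g2 ->
  bounded_measurable (fun x => g1 x + g2 x).
Proof.
move=> [m1 [B1 H1]] [m2 [B2 H2]]; split; first exact: measurable_funD.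
exists (B1 + B2) => x; exact: le_trans (ler_normD _ _) (lerD (H1 x) (H2 x)).
Qed.

Lemma bm_cst (a : R) : bounded_measurable (fun=> a).
Proof. by split; [exact: measurable_cst | exists `|a|]. Qed.

Lemma bm_scale (a : R) g : bounded_measurable g -> bounded_measurable (fun x => a * g x).
Proof.
move=> [m [B H]]; split; first exact: measurable_funM.
by exists (`|a| * B) => x; rewrite normrM ler_wpM2l.
Qed.

Lemma bm_indic (A : set R) : measurable A -> bounded_measurable (\1_A).
Proof.
move=> mA; split; first exact: measurable_indic.
by exists 1 => x; rewrite indicE normr_nat lern1 leq_b1.
Qed.

Lemma bm_sum (G : nat -> R -> R) m : (forall i, bounded_measurable (G i)) ->
  bounded_measurable (fun x => \sum_(i < m) G i x).
Proof.
move=> H; elim: m => [|m IH].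
  have -> : (fun x => \sum_(i < 0) G i x) = fun=> 0 by apply/funext => x; rewrite big_ord0.
  exact: bm_cst.
have -> : (fun x => \sum_(i < m.+1) G i x) = fun x => \sum_(i < m) G i x + G m x.
  by apply/funext => x; rewrite big_ord_recr.
exact: bm_D.
Qed.

Variables (Q : probability R R) (T : R -> R).
Hypothesis mT : measurable_fun setT T.
Hypothesis QT : forall A : set R, measurable A -> Q (T @^-1` A) = Q A.

Lemma integral_invariant g : bounded_measurable g ->
  \int[Q]_x g (T x) = \int[Q]_x g x.
Proof.
move=> bg; rewrite /Rintegral; congr fine.
have mg : measurable_fun setT (EFin \o g) by apply/measurable_EFinP; case: bg.
have ig := bm_integrable Q (bm_comp mT bg).
have := @integral_pushforward _ _ _ _ R T mT Q setT (EFin \o g) mg ig measurableT.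
rewrite preimage_setT => <-.
by apply: eq_measure_integral => A mA _; exact: QT.
Qed.

Lemma measurable_iter i : measurable_fun setT (iter i T).
Proof. by elim: i => [|i IH]; [exact: measurable_id | exact: measurableT_comp]. Qed.

Lemma integral_iter i g : bounded_measurable g -> \int[Q]_x g (iter i T x) = \int[Q]_x g x.
Proof.
move=> bg; elim: i => [//|i IH].
rewrite -IH -(integral_invariant (bm_comp (measurable_iter i) bg)).
by apply: eq_Rintegral => x _; rewrite iterSr.
Qed.

Lemma integral_birkhoff m g : bounded_measurable g ->
  \int[Q]_x (\sum_(i < m) g (iter i T x)) = m%:R * \int[Q]_x g x.
Proof.
move=> bg; elim: m => [|m IH].
  under eq_Rintegral do rewrite big_ord0.
  by rewrite Rintegral_cst // !mul0r.
have bi i : bounded_measurable (fun x => g (iter i T x)) := bm_comp (measurable_iter i) bg.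
under eq_Rintegral do rewrite big_ord_recr /=.
rewrite RintegralD //; [|exact/bm_integrable/(bm_sum (G := fun i x => g (iter i T x)))|exact/bm_integrable].
by rewrite IH integral_iter // -natr1 mulrDl mul1r.
Qed.

Lemma integral_cst_prob (a : R) : \int[Q]_x a = a.
Proof. rewrite Rintegral_cst //; transitivity (a * 1); last exact: mulr1.
by congr (a * _); exact: (congr1 fine (probability_setT Q)). Qed.

(** By invariance [m] times the integral is at least [- B] for every [m]. *)
Lemma integral_lower g B : bounded_measurable g ->
  (forall m x, - B <= \sum_(i < m) g (iter i T x)) -> 0 <= \int[Q]_x g x.
Proof.
move=> bg H.
have bi i : bounded_measurable (fun x => g (iter i T x)) := bm_comp (measurable_iter i) bg.
have main m : - B <= m%:R * \int[Q]_x g x.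
  rewrite -integral_birkhoff // -[leLHS]integral_cst_prob.
  apply: le_Rintegral => //; first exact/bm_integrable/bm_cst.
  exact/bm_integrable/(bm_sum (G := fun i x => g (iter i T x))).
move: main; set I := \int[Q]_x g x => main.
rewrite leNgt; apply/negP => neg.
have := main (Num.truncn (`|B| / - I)).+1.
have : `|B| / - I < (Num.truncn (`|B| / - I)).+1%:R by exact: truncnS_gt.
rewrite ltr_pdivrMr ?oppr_gt0 // mulrN => h1 h2.
have := ler_norm B; lra.
Qed.

Lemma integral_ae_cst (N : set R) (c : R) g : measurable N -> Q N = 0%E -> bounded_measurable g ->
  (forall x, ~ N x -> g x = c) -> \int[Q]_x g x = c.
Proof.
move=> mN N0 [mg _] H; rewrite -[RHS]integral_cst_prob; congr fine.
apply: ae_eq_integral => //; first exact/measurable_EFinP.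
exists N; split=> // x /= Hx; apply: contrapT => Nx; apply: Hx => _.
by rewrite H.
Qed.

Lemma integral_indic_fine (A : set R) : measurable A -> \int[Q]_x \1_A x = fine (Q A).
Proof. by move=> mA; rewrite /Rintegral integral_indic // setIT. Qed.

End Bounded.

Definition uniquely_minimized (R : realType) (h : R -> R) : Prop := exists P : probability R R,
  [/\ lyap_minimizing h P,
      forall Q : probability R R, lyap_minimizing h Q ->
        forall A : set R, measurable A -> Q A = P A &
      is_periodic_orbit_measure h P].

(** * A locked orbit carries the unique minimizing measure *)

Section MinimizingMeasure.
Variable R : realType.
Variables (h h1 h2 : R -> R) (d : int).
Hypothesis Hh : C2lift h h1 h2 d.

Let T := circ_map h.

Lemma frac_shift (x : R) (k : int) : frac (x + k%:~R) = frac x.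
Proof. by rewrite /frac floorDrz ?intr_int // intrKfloor intrD; ring. Qed.

Lemma frac_itv (x : R) : 0 <= frac x < 1.
Proof. by rewrite /frac; have := floor_itv x; rewrite intrD /=; lra. Qed.

Lemma frac_id (x : R) : 0 <= x < 1 -> frac x = x.
Proof.
move=> /andP[x0 x1]; rewrite /frac (_ : Num.floor x = 0) ?subr0 //.
by apply/floor_def; rewrite x0 add0r.
Qed.

Lemma circ_map_shift (x : R) (k : int) : T (x + k%:~R) = T x.
Proof. by rewrite /T /circ_map (int_per (c2_per Hh)) frac_shift. Qed.

Lemma iter_circ i (x : R) : exists k : int, iter i T x = iter i h x + k%:~R.
Proof.
elim: i => [|i [k IH]]; first by exists 0; rewrite addr0.
exists (d * k - Num.floor (h (iter i T x))).
by rewrite /= {1}/T /circ_map /frac {1}IH (int_per (c2_per Hh)) intrB addrA.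
Qed.

Lemma measurable_circ_map : measurable_fun setT T.
Proof.
have mh : measurable_fun setT h.
  by apply: continuous_measurable_fun; exact: is_derive_continuous (c2_d1 Hh).
have mf : measurable_fun setT (@frac R).
  apply: measurable_funB; first exact: measurable_id.
  by apply: nondecreasing_measurable => // x y xy; rewrite ler_int le_floor.
exact: measurableT_comp mf mh.
Qed.


Lemma circ_map_frac (x : R) : T (frac x) = frac (h x).
Proof. by rewrite {1}/frac -intrN circ_map_shift. Qed.

Lemma iter_circ_frac i (x : R) : iter i T (frac x) = frac (iter i h x).
Proof. by elim: i => [//|i IH]; rewrite iterS IH circ_map_frac. Qed.

Hypothesis h1_away : exists2 c0, 0 < c0 & forall x, c0 <= `|h1 x|.
Let phi := log_deriv h1.

Lemma log_deriv_bm : bounded_measurable phi.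
Proof.
have [c0 c00 Hc] := h1_away.
have h1per := derive1_periodic (c2_d1 Hh) (c2_per Hh).
have h2per : forall x, h2 (x + 1) = h2 x.
  by apply: (derive1_periodic (c := 0) (c2_d2 Hh)) => x; rewrite h1per addr0.
have [L2 _ HL2] := continuous_periodic_bounded (c2_cont Hh) h2per.
have cphi : continuous phi.
  exact: lipschitz_continuous (log_deriv_lip c00 (c2_d2 Hh) Hc HL2).
split; first exact: continuous_measurable_fun.
have [|B _ HB] := continuous_periodic_bounded cphi; last by exists B.
by move=> x; have := log_deriv_periodic Hh x 1.
Qed.

Lemma null_fundamental (Q : probability R R) :
  Q `[0, 1[%classic = 1%E -> Q (~` `[0, 1[%classic) = 0%E.
Proof. by move=> Q1; rewrite probability_setC // Q1 subee. Qed.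

Lemma lyapE (Q : probability R R) : Q `[0, 1[%classic = 1%E ->
  lyap h Q = (\int[Q]_x phi x)%:E.
Proof.
move=> Q1; have iphi := bm_integrable Q log_deriv_bm.
have [_ e1 _] := C2lift_E Hh.
rewrite /lyap e1 /Rintegral fineK; last exact: integrable_fin_num.
rewrite (negligible_integral _ _ _ (null_fundamental Q1)) //.
  by rewrite setTD setCK.
exact: measurableC.
Qed.

Variables (n : nat) (q : R) (Fc : set R) (delta B : R).
Hypothesis nq : perpt h n q.
Hypothesis delta0 : 0 < delta.
Hypothesis Fc_closed : closed Fc.
Hypothesis Fc_per : forall x (k : int), Fc x -> Fc (x + k%:~R).
Hypothesis lower : forall m x, - B <= \sum_(i < m) (log_deriv h1 (iter i h x)
        - Sum h (log_deriv h1) n q / n%:R - delta * \1_Fc (iter i.+1 h x)).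
Hypothesis escape : forall x, (forall i, ~ Fc (iter i h x)) ->
  exists i (k : int), x = iter i h q + k%:~R.

Let beta := Sum h phi n q / n%:R.
Let y i := iter i T (frac q).
Let orb : set R := \bigcup_i [set y i].

Let n0 : (0 < n)%N. Proof. by case: nq. Qed.
Let nR0 : n%:R != 0 :> R. Proof. by rewrite pnatr_eq0 -lt0n n0. Qed.

Let y_itv i : 0 <= y i < 1.
Proof. by rewrite /y iter_circ_frac frac_itv. Qed.

Let y_per i : y (i + n) = y i.
Proof.
rewrite /y iterD; congr iter; rewrite iter_circ_frac.
by have [_ [k ->]] := nq; rewrite frac_shift.
Qed.

Let mT := measurable_circ_map.
Let mFc : measurable Fc. Proof. exact: closed_measurable. Qed.

Let indic_per x (k : int) : \1_Fc (x + k%:~R) = \1_Fc x :> R.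
Proof.
rewrite !indicE; congr (_%:R); congr nat_of_bool; apply/idP/idP; rewrite !inE.
  by move=> /(Fc_per (- k)); rewrite intrN addrK.
exact: Fc_per.
Qed.

Lemma integral_log_deriv_ge (Q : probability R R) : invariant h Q ->
  beta + delta * fine (Q Fc) <= \int[Q]_x phi x.
Proof.
move=> [_ QT].
have b1 := log_deriv_bm.
have b2 := bm_comp mT (bm_indic mFc).
have b3 := bm_scale (- delta) b2.
have b4 := bm_D (bm_cst (- beta)) b3.
have := integral_lower (B := B) mT QT (bm_D b1 b4).
rewrite RintegralD; [|exact: measurableT|exact: bm_integrable|exact: bm_integrable].
rewrite RintegralD; [|exact: measurableT|exact/bm_integrable/bm_cst|exact: bm_integrable].
rewrite integral_cst_prob RintegralZl; [|exact: measurableT|exact: bm_integrable].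
rewrite (integral_invariant mT QT (bm_indic mFc)) integral_indic_fine //.
move=> H; suff : 0 <= \int[Q]_x phi x + (- beta + - delta * fine (Q Fc)).
  by rewrite mulNr; lra.
apply: H => m x; apply: le_trans (lower m x) _.
rewrite le_eqVlt; apply/orP; left; apply/eqP; apply: eq_bigr => i _.
have [k ek] := iter_circ i x; have [k' ek'] := iter_circ i.+1 x.
rewrite /= -/T in ek' *; rewrite ek' ek -[h (iter i h x)]/(iter i.+1 h x).
by rewrite /phi indic_per (log_deriv_periodic Hh) mulNr addrA.
Qed.

Lemma orbit_sum (F : R -> R) j : \sum_(i < n) F (y (i + j)) = \sum_(i < n) F (y i).
Proof.
elim: j => [|j <-]; first by under eq_bigr do rewrite addn0.
case: n n0 y_per => [//|m] _ yp.
rewrite big_ord_recr [RHS]big_ord_recl /= addrC; congr (_ + _).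
  by rewrite -addSnnS addnC yp.
by apply: eq_bigr => i _; rewrite addnS.
Qed.

(** The sum of [g] over [n] steps is the same from every point of [orb], hence constant almost
    everywhere; invariance gives the integral without computing the masses of points. *)
Lemma orbit_integral (Q : probability R R) (g : R -> R) : invariant h Q ->
  Q (~` orb) = 0%E -> bounded_measurable g ->
  \int[Q]_x g x = n%:R^-1 * \sum_(i < n) g (y i).
Proof.
move=> [_ QT] Q0 bg.
have morb : measurable orb by apply: bigcupT_measurable => i; exact: measurable_set1.
have := integral_birkhoff mT QT n bg.
rewrite (integral_ae_cst (N := ~` orb) (c := \sum_(i < n) g (y i))) //.
- by move=> ->; rewrite mulKf.
- exact: measurableC.
- by apply: (bm_sum (G := fun i x => g (iter i T x))) => i; exact: bm_comp (measurable_iter mT i) bg.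
- move=> x /contrapT [j _ ->]; rewrite -(orbit_sum g j).
  by apply: eq_bigr => i _; rewrite /y iterD.
Qed.

Let P : probability R R := orbit_measure n.-1 y.

Let PE (A : set R) : P A = (n%:R^-1 * \sum_(i < n) \1_A (y i))%:E.
Proof. by have := orbit_measureE n.-1 y A; rewrite prednK. Qed.

Lemma orbit_invariant : invariant h P.
Proof.
split.
  rewrite PE (eq_bigr (fun=> 1)); last first.
    by move=> i _; rewrite indicE mem_set //= in_itv /= y_itv.
  by rewrite sumr_const card_ord mulVf.
move=> A _; rewrite !PE -(orbit_sum \1_A 1); congr (_ * _)%:E.
by apply: eq_bigr => i _; rewrite addn1.
Qed.

Lemma orbit_integral_log_deriv : \int[P]_x phi x = beta.
Proof.
rewrite (orbit_integral orbit_invariant) /=; last exact: log_deriv_bm.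
  rewrite mulrC; congr (_ / _); apply: eq_bigr => i _.
  by rewrite /y iter_circ_frac /frac -intrN /phi (log_deriv_periodic Hh).
rewrite PE big1 ?mulr0 // => i _; rewrite indicE memNset //=.
by apply; exists (i : nat).
Qed.

Lemma alphaE : alpha h = beta%:E.
Proof.
apply/le_anti/andP; split.
  apply: ereal_inf_lbound; exists P; first exact: orbit_invariant.
  by rewrite lyapE ?orbit_integral_log_deriv //; case: orbit_invariant.
apply/ereal_infP => _ [Q /= IQ <-]; rewrite lyapE; last by case: IQ.
rewrite lee_fin; apply: le_trans (integral_log_deriv_ge IQ).
by rewrite lerDl mulr_ge0 ?(ltW delta0) // fine_ge0.
Qed.

(** Equality in the lower bound forces [Q Fc = 0]. All preimages of [Fc] are then null, so almost
    every point avoids [Fc] forever and [escape] applies. *)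
Lemma minimizing_on_orbit (Q : probability R R) : lyap_minimizing h Q -> Q (~` orb) = 0%E.
Proof.
move=> [IQ]; have [Q1 QT] := IQ; rewrite lyapE // alphaE => -[eQ].
have QF : Q Fc = 0%E.
  apply/eqP; rewrite -[Q Fc]fineK ?fin_num_measure // eqe.
  have := integral_log_deriv_ge IQ; rewrite eQ gerDl pmulr_rle0 // => le0.
  by rewrite eq_le le0 fine_ge0.
have morb : measurable orb by apply: bigcupT_measurable => i; exact: measurable_set1.
have miter i := measurable_iter mT i.
have mpre i : measurable (iter i T @^-1` Fc) by rewrite -[X in measurable X]setTI; exact: miter.
apply: (measure_negligible (measurableC morb)).
apply: (negligibleS (A := ~` `[0, 1[%classic `|` \bigcup_i (iter i T @^-1` Fc))).
  move=> x nx; apply: contrapT => /not_orP [/contrapT].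
  rewrite /= in_itv /= => x01 nF; apply: nx.
  have [] := escape (x := x).
    move=> i Fi; apply: nF; exists i => //=; have [k ->] := iter_circ i x.
    exact: Fc_per.
  move=> i [k xk]; exists i => //=.
  by rewrite /y iter_circ_frac -(frac_id x01) xk frac_shift.
apply: negligibleU.
  by apply/negligibleP; [exact: measurableC | exact: null_fundamental].
apply: negligible_bigcup => i; apply/negligibleP => //.
elim: i => [//|i IH]; apply: etrans (etrans (QT _ (mpre i)) IH); congr (Q _).
by apply/seteqP; split => x /=; rewrite -/T -iterSr.
Qed.

Lemma orbit_uniquely_minimizing : uniquely_minimized h.
Proof.
exists P; split.
- split; first exact: orbit_invariant.
  by rewrite alphaE lyapE ?orbit_integral_log_deriv //; case: orbit_invariant.
- move=> Q HQ A mA; have Q0 := minimizing_on_orbit HQ.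
  rewrite PE -(orbit_integral _ Q0 (bm_indic mA)); last by case: HQ.
  by rewrite integral_indic_fine // fineK ?fin_num_measure.
- exists (frac q), n; split=> //; first exact: frac_itv.
  by have := y_per 0; rewrite add0n.
Qed.

End MinimizingMeasure.

Lemma locked_uniquely_minimized (R : realType) (h h1 h2 : R -> R) (d : int) :
  C2lift h h1 h2 d -> (exists2 c0, 0 < c0 & forall x, c0 <= `|h1 x|) ->
  locked h h1 -> uniquely_minimized h.
Proof.
move=> Hh h1_away [n [q [Fc [delta [B [nq delta0 [clF perF] lower escape]]]]]].
exact: (orbit_uniquely_minimizing Hh h1_away nq delta0 clF perF lower escape).
Qed.

(** * The C2 distance *)

Section Distance.
Variable R : realType.
Implicit Types (x y z : R) (F : R -> R).

Lemma circ_dist_shift x y (k : int) : circ_dist x y = circ_dist (x - k%:~R) y.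
Proof. by rewrite /circ_dist addrAC -intrN frac_shift. Qed.

Lemma circ_dist_le x y : circ_dist x y <= `|x - y|.
Proof.
rewrite /circ_dist /frac; set z := x - y.
have := floor_itv z; rewrite intrD => /andP[a b].
have [k0|k0] := lerP 0 (Num.floor z).
  have k0' : 0 <= (Num.floor z)%:~R :> R by rewrite ler0z.
  rewrite ge_min; apply/orP; left; apply: le_trans (ler_norm _); lra.
have k0' : (Num.floor z)%:~R <= -1 :> R by rewrite -(intrN _ 1) ler_int; lia.
rewrite ge_min; apply/orP; right; rewrite -normrN; apply: le_trans (ler_norm _); lra.
Qed.

Lemma circ_dist_eq x y : exists k : int, circ_dist x y = `|x - k%:~R - y|.
Proof.
rewrite /circ_dist; have := frac_itv (x - y); rewrite /frac => /andP[a b].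
case: ltP => _.
  by exists (Num.floor (x - y)); rewrite ger0_norm; lra.
by exists (Num.floor (x - y) + 1); rewrite intrD ler0_norm; lra.
Qed.

Lemma circ_dist_triangle x y z : circ_dist x z <= circ_dist x y + circ_dist y z.
Proof.
have [k ->] := circ_dist_eq x y; have [l ->] := circ_dist_eq y z.
rewrite (circ_dist_shift _ _ (k + l)); apply: le_trans (circ_dist_le _ _) _.
by apply: le_trans (ler_normD _ _); rewrite intrD le_eqVlt; apply/orP; left; apply/eqP; congr `|_|; ring.
Qed.

Lemma sup_range_le F a : (forall x, F x <= a) -> sup (range F) <= a.
Proof. by move=> H; apply: ge_sup; [exists (F 0), 0 | move=> _ [x _ <-]]. Qed.

Lemma sup_range_ge F B x : (forall x, F x <= B) -> F x <= sup (range F).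
Proof. by move=> H; apply: ub_le_sup; [exists B => _ [z _ <-] | exists x]. Qed.

Lemma dC2_le (f g : R -> R) a b c : (forall x, circ_dist (f x) (g x) <= a) ->
  (forall x, `|f^`()%classic x - g^`()%classic x| <= b) ->
  (forall x, `|f^`(2)%classic x - g^`(2)%classic x| <= c) -> dC2 f g <= a + b + c.
Proof. by move=> Ha Hb Hc; rewrite /dC2 !lerD //; exact: sup_range_le. Qed.

Lemma derives_bounded (f : R -> R) : is_C2_circle_lift f ->
  exists B, forall x, `|f^`()%classic x| <= B /\ `|f^`(2)%classic x| <= B.
Proof.
move=> /C2liftP [d Hf].
have f1per := derive1_periodic (c2_d1 Hf) (c2_per Hf).
have f2per : forall x, f^`(2)%classic (x + 1) = f^`(2)%classic x.
  by apply: (derive1_periodic (c := 0) (c2_d2 Hf)) => x; rewrite f1per addr0.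
have [B1 B10 H1] := continuous_periodic_bounded (is_derive_continuous (c2_d2 Hf)) f1per.
have [B2 B20 H2] := continuous_periodic_bounded (c2_cont Hf) f2per.
by exists (B1 + B2) => x; split; [apply: le_trans (H1 x) _ | apply: le_trans (H2 x) _]; lra.
Qed.

Lemma sup_circ_dist_ge (f g : R -> R) x :
  circ_dist (f x) (g x) <= sup (range (fun x => circ_dist (f x) (g x))).
Proof.
apply: (sup_range_ge (F := fun x => circ_dist (f x) (g x)) (B := 1)) => z.
by rewrite /circ_dist ge_min; have /andP[_ /ltW ->] := frac_itv (f z - g z).
Qed.

Lemma sup_derive_ge (f g : R -> R) x : is_C2_circle_lift f -> is_C2_circle_lift g ->
  `|f^`()%classic x - g^`()%classic x| <=
    sup (range (fun x => `|f^`()%classic x - g^`()%classic x|)) /\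
  `|f^`(2)%classic x - g^`(2)%classic x| <=
    sup (range (fun x => `|f^`(2)%classic x - g^`(2)%classic x|)).
Proof.
move=> /derives_bounded [A HA] /derives_bounded [B HB]; split.
- apply: (sup_range_ge (F := fun x => `|f^`()%classic x - g^`()%classic x|) (B := A + B)) => z.
  have [a _] := HA z; have [b _] := HB z.
  by apply: le_trans (ler_normB _ _) (lerD a b).
- apply: (sup_range_ge (F := fun x => `|f^`(2)%classic x - g^`(2)%classic x|) (B := A + B)) => z.
  have [_ a] := HA z; have [_ b] := HB z.
  by apply: le_trans (ler_normB _ _) (lerD a b).
Qed.

Lemma dC2_ge (f g : R -> R) x y z : is_C2_circle_lift f -> is_C2_circle_lift g ->
  circ_dist (f x) (g x) + `|f^`()%classic y - g^`()%classic y|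
    + `|f^`(2)%classic z - g^`(2)%classic z| <= dC2 f g.
Proof.
move=> Hf Hg; apply: lerD; last by have [_ +] := sup_derive_ge z Hf Hg.
by apply: lerD; [exact: sup_circ_dist_ge | have [+ _] := sup_derive_ge y Hf Hg].
Qed.

Lemma dC2_triangle (f g h : R -> R) : is_C2_circle_lift f -> is_C2_circle_lift g ->
  is_C2_circle_lift h -> dC2 f h <= dC2 f g + dC2 g h.
Proof.
move=> Hf Hg Hh.
have -> : dC2 f g + dC2 g h =
    (sup (range (fun x => circ_dist (f x) (g x))) +
     sup (range (fun x => circ_dist (g x) (h x)))) +
    (sup (range (fun x => `|f^`()%classic x - g^`()%classic x|)) +
     sup (range (fun x => `|g^`()%classic x - h^`()%classic x|))) +
    (sup (range (fun x => `|f^`(2)%classic x - g^`(2)%classic x|)) +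
     sup (range (fun x => `|g^`(2)%classic x - h^`(2)%classic x|))).
  by rewrite /dC2 addrACA; congr (_ + _); exact: addrACA.
apply: dC2_le => x.
- apply: le_trans (circ_dist_triangle _ (g x) _) _.
  exact: lerD (sup_circ_dist_ge f g x) (sup_circ_dist_ge g h x).
- apply: le_trans (ler_distD (g^`()%classic x) _ _) _.
  have [a _] := sup_derive_ge x Hf Hg; have [b _] := sup_derive_ge x Hg Hh.
  exact: lerD a b.
- apply: le_trans (ler_distD (g^`(2)%classic x) _ _) _.
  have [_ a] := sup_derive_ge x Hf Hg; have [_ b] := sup_derive_ge x Hg Hh.
  exact: lerD a b.
Qed.

(** [dC2] sees the lifts only modulo 1. Since [h - g] has derivative at most [r < 1], its integer
    increment over a period is 0, and one integer [k] corrects the lift everywhere, at the cost of a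
    second [r]. *)
Lemma dC2_near (h g h1 h2 g1 g2 : R -> R) d d' r : C2lift h h1 h2 d' -> C2lift g g1 g2 d ->
  r < 1 -> dC2 h g < r ->
  [/\ d' = d, exists k : int, forall x, `|h x - k%:~R - g x| <= 2 * r,
      forall x, `|h1 x - g1 x| <= r & forall x, `|h2 x - g2 x| <= r].
Proof.
move=> Hh Hg r1 near.
have [lh eh1 eh2] := C2lift_E Hh; have [lg eg1 eg2] := C2lift_E Hg.
have key x y z := le_lt_trans (dC2_ge x y z lh lg) near.
have cd0 x y : 0 <= circ_dist x y by have [k ->] := circ_dist_eq x y.
have near1 x : `|h1 x - g1 x| <= r.
  have := key x x x; rewrite eh1 eg1.
  have := cd0 (h x) (g x); have := normr_ge0 (h^`(2)%classic x - g^`(2)%classic x); lra.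
have near2 x : `|h2 x - g2 x| <= r.
  have := key x x x; rewrite eh2 eg2.
  have := cd0 (h x) (g x); have := normr_ge0 (h^`()%classic x - g^`()%classic x); lra.
have r0 : 0 <= r by apply: le_trans (near1 0).
pose u := h - g.
have du x : is_derive x 1 u (h1 x - g1 x).
  by apply: is_deriveB; [exact: (c2_d1 Hh) | exact: (c2_d1 Hg)].
have lu := lipschitz_of_derive du near1.
have u1 x : u (x + 1) = u x + (d' - d)%:~R.
  by rewrite /u !fctE (c2_per Hh) (c2_per Hg) intrB; ring.
have dd : d' = d.
  have := lu 1 0; have := u1 0; rewrite add0r subr0 normr1 mulr1 => ->.
  rewrite addrAC subrr add0r => le_r.
  have := le_lt_trans le_r r1; rewrite -intr_norm ltrz1; lia.
split=> //.
have [k ek] := circ_dist_eq (h 0) (g 0).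
have uk : `|u 0 - k%:~R| <= r.
  have := key 0 0 0; rewrite ek /u !fctE addrAC => lt_r.
  have := normr_ge0 (h^`()%classic 0 - g^`()%classic 0).
  have := normr_ge0 (h^`(2)%classic 0 - g^`(2)%classic 0); lra.
exists k => x; have [m /andP[m0 m1]] := frac_exists x.
have uper : u x = u (x - m%:~R).
  rewrite -intrN nat_periodic // => z.
  by rewrite u1 dd subrr addr0.
have -> : h x - k%:~R - g x = (u (x - m%:~R) - u 0) + (u 0 - k%:~R).
  by rewrite -uper /u !fctE; ring.
have := lu (x - m%:~R) 0; rewrite subr0 (ger0_norm m0) => le1.
have : r * (x - m%:~R) <= r by rewrite ler_piMr // ltW.
have := ler_normD (u (x - m%:~R) - u 0) (u 0 - k%:~R); lra.
Qed.

Lemma C2lift_shift (h h1 h2 : R -> R) d (k : int) : C2lift h h1 h2 d ->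
  C2lift (fun x => h x - k%:~R) h1 h2 d.
Proof.
move=> Hh; split; [|move=> x|exact: (c2_d2 Hh)|exact: (c2_cont Hh)].
  by move=> x; rewrite (c2_per Hh) addrAC.
have -> : (fun x => h x - k%:~R) = h - cst k%:~R by [].
by rewrite -[h1 x]subr0; apply: is_deriveB; exact: (c2_d1 Hh).
Qed.

End Distance.

(** * Independence of the lift, and the theorem *)

Section Shift.
Variable R : realType.

Lemma uniquely_minimized_shift (h h1 h2 : R -> R) d (k : int) : C2lift h h1 h2 d ->
  uniquely_minimized (fun x => h x - k%:~R) -> uniquely_minimized h.
Proof.
move=> Hh; have Hk := C2lift_shift k Hh.
have [_ e1 _] := C2lift_E Hh; have [_ e2 _] := C2lift_E Hk.
have ec : circ_map (fun x => h x - k%:~R) = circ_map h.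
  by apply/funext => x; rewrite /circ_map -intrN frac_shift.
rewrite /uniquely_minimized /lyap_minimizing /is_periodic_orbit_measure /alpha /invariant /lyap.
by rewrite ec e1 e2.
Qed.

Lemma derive_away (h h1 h2 : R -> R) d : C2lift h h1 h2 d -> expanding h ->
  exists2 c0, 0 < c0 & forall x, c0 <= `|h1 x|.
Proof.
move=> Hh [C [lam [C0 [lam1 Hlam]]]]; exists (C * lam).
  by rewrite mulr_gt0 // (lt_trans ltr01).
move=> x; have := Hlam 1%N x isT.
by rewrite expr1 (derive1_fun (f := iter 1 h) (c2_d1 Hh)).
Qed.

End Shift.

Theorem theoremA (R : realType) :
  exists U : set (R -> R),
    [/\ open_in_E2 U, dense_in_E2 U &
      forall f, U f ->
        exists P : probability R R,
          [/\ lyap_minimizing f P,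
              forall Q : probability R R, lyap_minimizing f Q ->
                forall A : set R, measurable A -> Q A = P A &
              is_periodic_orbit_measure f P]].
Proof.
(* The interior of the set of uniquely minimized maps: openness is the triangle inequality, and only
   density needs the construction. *)
exists [set f | E2 f /\ exists2 e, 0 < e & forall g, E2 g -> dC2 g f < e -> uniquely_minimized g].
split.
- split=> [f [] //|f [Ef [e e0 He]]].
  exists (e / 2); first by rewrite divr_gt0.
  move=> g Eg gf; split=> //; exists (e / 2); first by rewrite divr_gt0.
  move=> h Eh hg; apply: He => //.
  rewrite [e]splitr.
  exact: le_lt_trans (dC2_triangle (proj1 Eh) (proj1 Eg) (proj1 Ef)) (ltrD hg gf).
- move=> f [Cf Xf] e e0; have [d Hf] := C2liftP Cf.
  have e4 : 0 < e / 4 by rewrite divr_gt0.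
  have [g [g1 [g2 [r [Hg Xg [n0 n1 n2] r0 Hlock]]]]] := locked_dense Hf Xf e4.
  have [Cg eg1 eg2] := C2lift_E Hg.
  exists g; last first.
    apply: (@le_lt_trans _ _ (e / 4 + e / 4 + e / 4)); last by lra.
    by apply: dC2_le => x; rewrite ?eg1 ?eg2 //; apply: le_trans (circ_dist_le _ _) _.
  split; first by split.
  (* [s < 1] makes the degrees agree, and [2 * s] is the uniform distance given by [dC2_near]. *)
  have [s [s0 s1 sr sr']] : exists s, [/\ 0 < s, s < 1, 2 * s <= r & s <= r].
    exists (Num.min (r / 2) (1 / 2)).
    by have [le|lt] := lerP (r / 2) (1 / 2); split; lra.
  exists s => // h [Ch Xh] hg; have [d' Hh] := C2liftP Ch.
  have [dd [k Hk] near1 near2] := dC2_near Hh Hg s1 hg; rewrite dd in Hh.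
  have Hhk := C2lift_shift k Hh.
  apply: (uniquely_minimized_shift (k := k) Hh).
  apply: (locked_uniquely_minimized Hhk (derive_away Hh Xh)).
  apply: Hlock Hhk _ _ _ => x.
  + exact: le_trans (Hk x) sr.
  + by apply: le_trans (near1 x) _.
  + by apply: le_trans (near2 x) _.
- move=> f [Ef [e e0 He]]; apply: He => //.
  apply: le_lt_trans e0; rewrite -[X in _ <= X](addr0 0) -[X in _ <= X + _](addr0 0).
  apply: dC2_le => x; rewrite ?subrr ?normr0 //.
  by apply: le_trans (circ_dist_le _ _) _; rewrite subrr normr0.
Qed.
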